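(* Let $\alpha\ge2$ and $a\in\mathsf{CSL}^\alpha$, and let the eigenvalues $\lambda_j^{(n)}$ of $T_n(a)$ ($n$ sufficiently large) be numbered as described in the context. Let $j=j(n)\in\{1,\dots,n\}$ and $n\to\infty$. (i) If $\frac{j}{n+1}\to0$, then $$\lambda_j^{(n)}=g(0)+\frac{\pi^2g''(0)}{2}\,\frac{j^2}{(n+1)^2}+\Delta_4^{(n)}(j),\qquad \Delta_4^{(n)}(j)=o\!\left(\frac{j^2}{n^2}\right).$$ (ii) If $\frac{n+1-j}{n+1}\to0$, then $$\lambda_j^{(n)}=g(\pi)+\frac{\pi^2g''(\pi)}{2}\,\frac{(n+1-j)^2}{(n+1)^2}+\Delta_5^{(n)}(j),\qquad \Delta_5^{(n)}(j)=o\!\left(\frac{(n+1-j)^2}{n^2}\right).$$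
   Context: Symbols. $\mathbb{T}$ is the complex unit circle. For $a\in L^1(\mathbb{T})$ let $a_l=\frac1{2\pi}\int_0^{2\pi}a(e^{ix})e^{-ilx}dx$ and $T_n(a)=(a_{j-k})_{j,k=1}^n$. For $\alpha\ge0$, $W^\alpha$ is the set of $a:\mathbb{T}\to\mathbb{C}$ with $\|a\|_\alpha:=\sum_{j\in\mathbb{Z}}|a_j|(|j|+1)^\alpha<\infty$. For $\alpha\ge2$, $\mathsf{CSL}^\alpha$ is the set of all $a\in W^\alpha$ such that $g(\varphi):=a(e^{i\varphi})$ satisfies: (1) $g(\varphi)=g(2\pi-\varphi)$ for $\varphi\in[0,2\pi]$ (equivalently $a_j=a_{-j}$); (2) the range of $g$ is a simple arc (no self-intersections; $g$ is injective on $[0,\pi]$) with distinct end points $g(0)=g(2\pi)$ and $g(\pi)$, $g'(\varphi)\ne0$ for $\varphi\in(0,\pi)$, $g''(0)=g''(2\pi)\neq0$ and $g''(\pi)\ne0$. Truncation. $a_n(t)=\sum_{j=-(n-1)}^{n-1}a_jt^j$, and $g_n(z)=a_n(e^{iz})$ for complex $z$. $\Pi_n(a)=\{\varphi+i\delta:\ \varphi\in[cn^{-1},\pi-cn^{-1}],\ \delta\in[-Cn^{-1},Cn^{-1}]\}$, where $c>0$ (small enough) and $C>0$ (large enough) are fixed constants depending only on $a$. The function $\eta_n$. For $s\in\Pi_n(a)$ let $b_n(t,s)=\frac{(a_n(t)-g_n(s))e^{is}}{(t-e^{is})(t^{-1}-e^{is})}$, a Laurent polynomial in $t$. For $n$ large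 it has a Wiener–Hopf factorization $b_n(t,s)=b_{n,+}(t,s)b_{n,+}(t^{-1},s)$ with $b_{n,+}(\cdot,s)$ a polynomial of degree at most $n-2$ without zeros in $|t|\le e^{C/n}$; $\eta_n(s)=\frac1i[\log b_{n,+}(e^{is},s)-\log b_{n,+}(e^{-is},s)]$ with any continuous branch of $\log b_{n,+}(\cdot,s)$ on $|t|\le e^{C/n}$. Numbering of eigenvalues. $d_{j,n}=\frac{\pi j}{n+1}$, $e_{j,n}=d_{j,n}-\frac{\eta_n(d_{j,n})}{n+1}$, $1\le j\le n$. For all sufficiently large $n$ the eigenvalues of $T_n(a)$ are pairwise distinct and are numbered $\lambda^{(n)}_1,\dots,\lambda^{(n)}_n$ so that $\lambda_j^{(n)}=g_n(s_{j,n})$ with $s_{j,n}\in\Pi_n(a)$ and $|s_{j,n}-e_{j,n}|\le c_n/(n+1)$, where $c_n\to0$ does not depend on $j$; for large $n$ this determines the numbering. *)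

(* Defs.v *)
From HB Require Import structures.
From mathcomp Require Import all_boot all_order all_algebra.
From mathcomp Require Import all_classical all_reals all_analysis.
From mathcomp Require Import complex.

Set Implicit Arguments.
Unset Strict Implicit.
Unset Printing Implicit Defensive.

Import Order.TTheory GRing.Theory Num.Theory.
Import numFieldNormedType.Exports.

Local Open Scope classical_set_scope.
Local Open Scope ring_scope.
Local Open Scope complex_scope.

(* The topology of the complex plane, as a normed space over itself. *)
HB.instance Definition _ (R : realType) := NormedModule.copy R[i] R[i]^o.

Section ComplexCalculus.
Variable R : realType.

Definition cexp (z : R[i]) : R[i] :=
  (expR (complex.Re z))%:C * (cos (complex.Im z) +i* sin (complex.Im z)).

(* [R[i]] is not declared as a normed space over [R], so derivatives and
   integrals of functions of a real variable are taken componentwise. *)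
Definition cderive1 (f : R -> R[i]) (x : R) : R[i] :=
  derive1 (fun y => complex.Re (f y)) x +i* derive1 (fun y => complex.Im (f y)) x.

Definition cintegral (D : set R) (f : R -> R[i]) : R[i] :=
  (\int[lebesgue_measure]_(x in D) complex.Re (f x)) +i*
  (\int[lebesgue_measure]_(x in D) complex.Im (f x)).

Definition unit_circle : set R[i] := [set t | `|t| = 1].

End ComplexCalculus.

Section Symbols.
Variable R : realType.

(* A symbol [a : T -> C] is a total function on [R[i]] of which only the values
   on the unit circle are ever used. *)
Implicit Types (a : R[i] -> R[i]) (n : nat) (c C : R).

Definition fourier a (l : int) : R[i] :=
  ((2 * pi)^-1)%:C *
  cintegral `[0, 2 * pi]
    (fun x => a (cexp ('i * x%:C)) * cexp (- ('i * l%:~R * x%:C))).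

Definition toeplitz a n : 'M[R[i]]_n :=
  \matrix_(j, k) fourier a (j%:Z - k%:Z).

(* An element of [W^alpha] is an integrable function up to null sets; the
   condition on the coefficients gives it a unique continuous representative,
   and [a] is that representative. *)
Definition wiener (alpha : R) a : Prop :=
  {within @unit_circle R, continuous a} /\
  (\esum_(l in [set: int])
     (complex.Re `|fourier a l| * (`|l|%N.+1)%:R `^ alpha)%:E < +oo)%E.

Definition gfun a (phi : R) : R[i] := a (cexp ('i * phi%:C)).

Record CSL (alpha : R) a : Prop := {
  CSL_wiener : wiener alpha a;
  CSL_even : forall phi, 0 <= phi <= 2 * pi ->
    gfun a phi = gfun a (2 * pi - phi);
  CSL_inj : {in `[0, pi] &, injective (gfun a)};
  CSL_ends : gfun a 0 = gfun a (2 * pi) /\ gfun a 0 != gfun a pi;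
  CSL_deriv : forall phi, 0 < phi < pi -> cderive1 (gfun a) phi != 0;
  CSL_deriv2_0 : cderive1 (cderive1 (gfun a)) 0 =
                   cderive1 (cderive1 (gfun a)) (2 * pi) /\
                 cderive1 (cderive1 (gfun a)) 0 != 0;
  CSL_deriv2_pi : cderive1 (cderive1 (gfun a)) pi != 0
}.

(* The index [k] runs over [0 .. 2n-2] and stands for [k - (n-1)]. *)
Definition trunc_symbol a n (t : R[i]) : R[i] :=
  \sum_(0 <= k < n.*2.-1)
    fourier a (k%:Z - n.-1%:Z) * t ^ (k%:Z - n.-1%:Z).

Definition gn a n (z : R[i]) : R[i] := trunc_symbol a n (cexp ('i * z)).

Definition Pi_n c C n : set R[i] :=
  [set s | c / n%:R <= complex.Re s <= pi - c / n%:R /\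
           - (C / n%:R) <= complex.Im s <= C / n%:R].

Definition bn a n (s t : R[i]) : R[i] :=
  (trunc_symbol a n t - gn a n s) * cexp ('i * s) /
  ((t - cexp ('i * s)) * (t^-1 - cexp ('i * s))).

Definition disc C n : set R[i] := [set t | `|t| <= (expR (C / n%:R))%:C].

(* [bn a n s] is a Laurent polynomial whose defining quotient is [0 / 0] at
   [t = e^{is}] and [t = e^{-is}]; an identity between Laurent polynomials is
   determined by the other values of [t]. *)
Definition wiener_hopf a C n (s : R[i]) (p : {poly R[i]}) : Prop :=
  [/\ (size p <= n.-1)%N,
      forall t, disc C n t -> ~~ root p t
    & forall t, t != 0 -> t != cexp ('i * s) -> t != cexp (- ('i * s)) ->
        bn a n s t = p.[t] * p.[t^-1]].

Definition log_branch C n (p : {poly R[i]}) (L : R[i] -> R[i]) : Prop :=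
  {within disc C n, continuous L} /\
  forall t, disc C n t -> cexp (L t) = p.[t].

Definition is_eta a C n (s v : R[i]) : Prop :=
  exists p L, [/\ wiener_hopf a C n s p, log_branch C n p L
    & v = 'i^-1 * (L (cexp ('i * s)) - L (cexp (- ('i * s))))].

(* The factor is unique up to sign and two branches of its logarithm differ by
   a constant, so at most one value satisfies [is_eta]; the default [0] is
   used only where there is no factorization. *)
Definition eta a C n (s : R[i]) : R[i] := xget 0 [set v | is_eta a C n s v].

Definition dgrid n (j : nat) : R := pi * j%:R / n.+1%:R.

Definition egrid a C n (j : nat) : R[i] :=
  (dgrid n j)%:C - eta a C n (dgrid n j)%:C / n.+1%:R.

(* [lam n j], for [1 <= j <= n], is the [j]-th eigenvalue of [T_n(a)]. *)
Definition eigenvalue_numbering a c C (lam : nat -> nat -> R[i]) : Prop :=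
  exists2 cn : nat -> R, cn @ \oo --> (0 : R) &
  \forall n \near \oo,
    [/\ forall j k, (1 <= j <= n)%N -> (1 <= k <= n)%N ->
          lam n j = lam n k -> j = k,
        forall z, eigenvalue (toeplitz a n) z <->
          exists2 j, (1 <= j <= n)%N & z = lam n j
      & forall j, (1 <= j <= n)%N ->
          exists s, [/\ Pi_n c C n s, lam n j = gn a n s
            & `|s - egrid a C n j| <= (cn n / n.+1%:R)%:C]].

End Symbols.

(* Main.v *)
Require Import Defs.
From mathcomp Require Import all_boot all_order all_algebra.
From mathcomp Require Import all_classical all_reals all_analysis.
From mathcomp Require Import complex ring lra zify.

(** The eigenvalue is [g_n(s)] with [|s - d + eta(d)/(n+1)| = o(1/(n+1))], where
    [d = pi j/(n+1)], and [g_n] has a second-order expansion at [0], uniform in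
    the strip [|Im s| <= C/n]; so everything rests on [eta(d) = o(j)].

    Put [F(x) = log b_+(e^{ix})] and [B(x) = F(x) + F(-x)].  Then
    [i eta(s) = F(s) - F(-s)] is the conjugate function of [B] at [s], and
    [exp B(x) = (g_n(x) - g_n(s)) / (2 cos s - 2 cos x)], a cosine polynomial
    with explicit coefficients.  Because [sum k^2 |a_k|] is finite, [g] is
    injective on [0, pi] and [g''(0) <> 0], this quotient is bounded away from
    [0]; it varies by at most [o(1) min(n |x - y|, 1)] near [0], and so does [B].
    The principal value integral is replaced by a quadrature formula with nodes
    [pi (i + 1/2)/N], [N] a large multiple of [n + 1].  It is exact for
    polynomials of degree at most [2N], to which [F] is exponentially close
    because the zeros of [b_+] lie outside the closed disc.

    The end point [pi] is carried to [0] by [x -> pi - x], which multiplies the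
    Fourier coefficient [a_k] by [(-1)^k].  That [g] is the sum of its Fourier
    series is proved by Korovkin's argument with the Fejer kernel. *)

Set Implicit Arguments.
Unset Strict Implicit.
Unset Printing Implicit Defensive.

Import Order.TTheory GRing.Theory Num.Theory.
Import numFieldNormedType.Exports.

Local Open Scope classical_set_scope.
Local Open Scope ring_scope.
Local Open Scope complex_scope.

(** * Real-valued modulus and the complex exponential *)

Section ComplexModulus.
Variable R : realType.
Implicit Types z w : R[i].

(** The hypothesis [2 <= alpha] gives summability of [k^2 |a_k|] without a rate, so every [o(1)]
    comes from cutting a weighted series into a head and a small tail, uniformly in [n]
    ([bounded_sums_min]). The target [o(j)] for the phase is generous, and this shapes the
    estimates. Near [s] the conjugation kernel has size [s / ((x + s) |x - s|)]; against an
    oscillation [eps * min(n |x - s|, 1)] it integrates to about [eps * (1 + log j)], which is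
    simply bounded by a multiple of [eps * j]. The part far from [s] costs [O(s)]; it is small
    because [j / n] is, and [1 <= j] absorbs it. Only exponentials of [F] and [B] are known
    explicitly. Differences of their values are recovered along paths on which the exponential of
    the difference stays close to 1. The quotient of [g_n(x) - g_n(s)] by [cos x - cos s] is
    replaced by a cosine sum that makes sense at [x = s] too. Its limit at [x = s = 0] is
    [- g''(0) / 2]; this is where the condition on the second derivative enters. *)

Definition cabs z : R := complex.Re `|z|.

Lemma cabsE z : `|z| = (cabs z)%:C.
Proof. by rewrite /cabs normc_def. Qed.

Lemma cabs_ge0 z : 0 <= cabs z.
Proof. by rewrite -lecR -cabsE normr_ge0. Qed.

Lemma cabs0 : cabs 0 = 0.
Proof. by apply: complexI; rewrite -cabsE normr0. Qed.

Lemma cabs1 : cabs 1 = 1.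
Proof. by apply: complexI; rewrite -cabsE normr1. Qed.

Lemma cabsM z w : cabs (z * w) = cabs z * cabs w.
Proof. by apply: complexI; rewrite rmorphM /= -!cabsE normrM. Qed.

Lemma cabsN z : cabs (- z) = cabs z.
Proof. by apply: complexI; rewrite -!cabsE normrN. Qed.

Lemma cabsC z w : cabs (z - w) = cabs (w - z).
Proof. by rewrite -cabsN opprB. Qed.

Lemma cabsV z : cabs z^-1 = (cabs z)^-1.
Proof. by apply: complexI; rewrite fmorphV /= -!cabsE normfV. Qed.

Lemma cabsX z n : cabs (z ^+ n) = cabs z ^+ n.
Proof. by apply: complexI; rewrite rmorphXn /= -!cabsE normrX. Qed.

Lemma cabsD z w : cabs (z + w) <= cabs z + cabs w.
Proof. by rewrite -lecR rmorphD /= -!cabsE ler_normD. Qed.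

Lemma cabsB z w : cabs (z - w) <= cabs z + cabs w.
Proof. by rewrite (le_trans (cabsD _ _))// cabsN. Qed.

Lemma cabs_dist z w : `|cabs z - cabs w| <= cabs (z - w).
Proof.
have := cabsD (z - w) w; have := cabsD (w - z) z; rewrite !subrK (cabsC w).
by rewrite ler_norml => h1 h2; apply/andP; split; lra.
Qed.

Lemma cabs_sum I (r : seq I) (P : pred I) (F : I -> R[i]) :
  cabs (\sum_(i <- r | P i) F i) <= \sum_(i <- r | P i) cabs (F i).
Proof.
elim/big_ind2 : _ => [|x a y b xa yb|//]; first by rewrite cabs0.
by rewrite (le_trans (cabsD _ _))// lerD.
Qed.

Lemma cabs_real (x : R) : cabs x%:C = `|x|.
Proof. by apply: complexI; rewrite -cabsE normc_def/= expr0n addr0 sqrtr_sqr. Qed.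

Lemma cabs_nat n : cabs n%:R = n%:R.
Proof.
by rewrite -[in LHS](rmorph_nat (real_complex R)) cabs_real ger0_norm.
Qed.

Lemma cabs_eq0 z : (cabs z == 0) = (z == 0).
Proof. by rewrite -(inj_eq (@complexI R)) -cabsE normr_eq0. Qed.

Lemma cabs_gt0 z : (0 < cabs z) = (z != 0).
Proof. by rewrite lt_neqAle cabs_ge0 andbT eq_sym cabs_eq0. Qed.

Lemma cabs_i : cabs 'i = 1.
Proof.
by rewrite /cabs normc_def/= expr0n expr1n add0r sqrtr1.
Qed.

Lemma Re_le_cabs z : `|complex.Re z| <= cabs z.
Proof. by rewrite -lecR -cabsE normc_ge_Re. Qed.

Lemma sqr_cabs z : cabs z ^+ 2 = complex.Re z ^+ 2 + complex.Im z ^+ 2.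
Proof. by apply: complexI; rewrite add_Re2_Im2 rmorphXn /= -cabsE. Qed.

Lemma Im_le_cabs z : `|complex.Im z| <= cabs z.
Proof.
rewrite -(@ler_pXn2r _ 2)// ?nnegrE ?cabs_ge0// sqr_cabs real_normK ?num_real//.
by rewrite lerDr sqr_ge0.
Qed.

Lemma cabs_le z : cabs z <= `|complex.Re z| + `|complex.Im z|.
Proof.
rewrite -(@ler_pXn2r _ 2)// ?nnegrE ?cabs_ge0 ?addr_ge0//.
rewrite sqr_cabs sqrrD !real_normK ?num_real// addrAC lerDl.
by rewrite mulrn_wge0// mulr_ge0.
Qed.

Lemma ReD z w : complex.Re (z + w) = complex.Re z + complex.Re w.
Proof. by case: z w => [a b] [c d]. Qed.

Lemma ImD z w : complex.Im (z + w) = complex.Im z + complex.Im w.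
Proof. by case: z w => [a b] [c d]. Qed.

Lemma ReN z : complex.Re (- z) = - complex.Re z.
Proof. by case: z. Qed.

Lemma ImN z : complex.Im (- z) = - complex.Im z.
Proof. by case: z. Qed.

Lemma ReM z w : complex.Re (z * w) =
  complex.Re z * complex.Re w - complex.Im z * complex.Im w.
Proof. by case: z w => [a b] [c d]. Qed.

Lemma ImM z w : complex.Im (z * w) =
  complex.Re z * complex.Im w + complex.Im z * complex.Re w.
Proof. by case: z w => [a b] [c d]. Qed.

Lemma complex_ext z w : complex.Re z = complex.Re w -> complex.Im z = complex.Im w ->
  z = w.
Proof. by case: z w => [a b] [c d] /= -> ->. Qed.

Lemma Re_sum I (r : seq I) (P : pred I) (F : I -> R[i]) :
  complex.Re (\sum_(i <- r | P i) F i) = \sum_(i <- r | P i) complex.Re (F i).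
Proof. by elim/big_rec2 : _ => // i y1 y2 _ <-; rewrite ReD. Qed.

Lemma Im_sum I (r : seq I) (P : pred I) (F : I -> R[i]) :
  complex.Im (\sum_(i <- r | P i) F i) = \sum_(i <- r | P i) complex.Im (F i).
Proof. by elim/big_rec2 : _ => // i y1 y2 _ <-; rewrite ImD. Qed.

Lemma Re_cexp z : complex.Re (cexp z) = expR (complex.Re z) * cos (complex.Im z).
Proof. by rewrite /cexp ReM/= mul0r subr0. Qed.

Lemma Im_cexp z : complex.Im (cexp z) = expR (complex.Re z) * sin (complex.Im z).
Proof. by rewrite /cexp ImM/= mul0r addr0. Qed.

Lemma cexpD z w : cexp (z + w) = cexp z * cexp w.
Proof.
rewrite /cexp ReD ImD expRD cosD sinD.
by apply: complex_ext; rewrite !(ReM, ImM)/=; ring.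
Qed.

Lemma cexp0 : cexp (0 : R[i]) = 1.
Proof. by rewrite /cexp expR0 cos0 sin0; apply: complex_ext => /=; ring. Qed.

Lemma cabs_cexp z : cabs (cexp z) = expR (complex.Re z).
Proof.
apply/eqP; rewrite -(@eqrXn2 _ 2) ?cabs_ge0 ?expR_ge0// sqr_cabs.
rewrite /cexp ReM ImM/= !mul0r subr0 addr0 !exprMn -mulrDr.
by rewrite cos2Dsin2 mulr1.
Qed.

Lemma cexp_neq0 z : cexp z != 0.
Proof. by rewrite -cabs_gt0 cabs_cexp expR_gt0. Qed.

Lemma cexpN z : cexp (- z) = (cexp z)^-1.
Proof.
apply: (mulfI (cexp_neq0 z)); rewrite divff ?cexp_neq0//.
by rewrite -cexpD subrr cexp0.
Qed.

Lemma cexpB z w : cexp (z - w) = cexp z / cexp w.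
Proof. by rewrite cexpD cexpN. Qed.

Lemma cexpX z n : cexp z ^+ n = cexp (n%:R * z).
Proof.
elim: n => [|n IH]; first by rewrite mul0r cexp0.
by rewrite exprS IH -cexpD -natr1 mulrDl mul1r addrC.
Qed.

Lemma cexp_i (x : R) : cexp ('i * x%:C) = cos x +i* sin x.
Proof.
rewrite /cexp ReM ImM/= !(mul0r, mulr0, mul1r, add0r, subr0, addr0).
by rewrite oppr0 expR0; apply: complex_ext => /=; ring.
Qed.

Lemma cabs_cexp_i (x : R) : cabs (cexp ('i * x%:C)) = 1.
Proof.
by rewrite cabs_cexp ReM/= mul0r mulr0 subrr expR0.
Qed.

Lemma mulNi (x : R) : - ('i * x%:C) = 'i * (- x)%:C.
Proof. by apply: complex_ext => /=; ring. Qed.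

Lemma cexp_i2cos (x : R) :
  cexp ('i * x%:C) + cexp (- ('i * x%:C)) = (2 * cos x)%:C.
Proof.
rewrite mulNi !cexp_i cosN sinN.
by apply: complex_ext => /=; ring.
Qed.

Lemma cexp_i2sin (x : R) :
  cexp ('i * x%:C) - cexp (- ('i * x%:C)) = 'i * (2 * sin x)%:C.
Proof.
rewrite mulNi !cexp_i cosN sinN.
by apply: complex_ext => /=; ring.
Qed.

End ComplexModulus.

(** * Derivatives of complex functions of a real variable *)

Section ComplexDerivative.
Variable R : realType.
Implicit Types (f g : R -> R[i]) (x : R) (d e : R[i]).

(** Componentwise, to match [cderive1]; unlike [cderive1] it also asserts differentiability. *)
Definition is_cderive f x d :=
  is_derive x 1 (fun y => complex.Re (f y)) (complex.Re d) /\
  is_derive x 1 (fun y => complex.Im (f y)) (complex.Im d).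

Lemma is_cderive_eq f x d e : is_cderive f x d -> d = e -> is_cderive f x e.
Proof. by move=> + <-. Qed.

Lemma is_cderive_ext f g x d : f =1 g -> is_cderive f x d -> is_cderive g x d.
Proof. by move=> /funext ->. Qed.

Lemma is_cderive_cst c x : is_cderive (fun=> c) x 0.
Proof. by split; exact: is_derive_cst. Qed.

Lemma is_cderive_id x : is_cderive (fun y => y%:C) x 1.
Proof. by split; [exact: is_derive_id|exact: is_derive_cst]. Qed.

Lemma is_cderiveD f g x d e : is_cderive f x d -> is_cderive g x e ->
  is_cderive (fun y => f y + g y) x (d + e).
Proof.
move=> [f1 f2] [g1 g2]; split.
  rewrite ReD; have := is_deriveD f1 g1; congr is_derive.
  by apply/funext => y; rewrite /= !fctE ReD.
rewrite ImD; have := is_deriveD f2 g2; congr is_derive.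
by apply/funext => y; rewrite /= !fctE ImD.
Qed.

Lemma is_cderiveM f g x d e : is_cderive f x d -> is_cderive g x e ->
  is_cderive (fun y => f y * g y) x (d * g x + f x * e).
Proof.
move=> [f1 f2] [g1 g2]; split.
  have H := is_deriveB (is_deriveM f1 g1) (is_deriveM f2 g2).
  have {}H := is_derive_eq (df := complex.Re (d * g x + f x * e)) H
    ltac:(rewrite ReD !ReM /GRing.scale/=; ring).
  by move: H; congr is_derive; apply/funext => y; rewrite /= !fctE ReM.
have H := is_deriveD (is_deriveM f1 g2) (is_deriveM f2 g1).
have {}H := is_derive_eq (df := complex.Im (d * g x + f x * e)) H
  ltac:(rewrite ImD !ImM /GRing.scale/=; ring).
by move: H; congr is_derive; apply/funext => y; rewrite /= !fctE ImM.
Qed.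

Lemma is_cderive_scale c f x d : is_cderive f x d ->
  is_cderive (fun y => c * f y) x (c * d).
Proof.
move=> fd; apply: is_cderive_eq (is_cderiveM (is_cderive_cst c x) fd) _.
by rewrite mul0r add0r.
Qed.

Lemma is_cderive_sum n (f : nat -> R -> R[i]) x (d : nat -> R[i]) :
  (forall k, (k < n)%N -> is_cderive (f k) x (d k)) ->
  is_cderive (fun y => \sum_(k < n) f k y) x (\sum_(k < n) d k).
Proof.
elim: n => [|n IH] fd.
  rewrite big_ord0; apply: is_cderive_ext (is_cderive_cst 0 x) => y.
  by rewrite big_ord0.
rewrite big_ord_recr/=.
have := is_cderiveD (IH (fun k kn => fd k (ltnW kn))) (fd n (leqnn _)).
by apply: is_cderive_ext => y; rewrite big_ord_recr.
Qed.

Lemma is_cderiveX n x :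
  is_cderive (fun y => y%:C ^+ n.+1) x (n.+1%:R * x%:C ^+ n).
Proof.
elim: n => [|n IH].
  by rewrite expr0 mulr1; exact: is_cderive_id.
apply: is_cderive_ext (is_cderive_eq (is_cderiveM (is_cderive_id x) IH) _).
  by move=> y; rewrite [RHS]exprS.
by rewrite mul1r mulrCA -exprS -{1}(mul1r (_ ^+ _)) -mulrDl nat1r.
Qed.

Lemma is_cderive_cexp f x d : is_cderive f x d ->
  is_cderive (fun y => cexp (f y)) x (d * cexp (f x)).
Proof.
move=> [f1 f2].
set u := fun y => complex.Re (f y) in f1.
set v := fun y => complex.Im (f y) in f2.
have eu : is_derive x 1 (fun y => expR (u y)) (complex.Re d * expR (u x)).
  by have := is_derive1_comp (is_derive_expR (u x)) f1; rewrite /= mulrC.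
have cv : is_derive x 1 (fun y => cos (v y)) (- (complex.Im d * sin (v x))).
  have := is_derive1_comp (is_derive_cos (v x)) f2.
  by rewrite /= [_ * complex.Im d]mulrC mulrN.
have sv : is_derive x 1 (fun y => sin (v y)) (complex.Im d * cos (v x)).
  by have := is_derive1_comp (is_derive_sin (v x)) f2; rewrite /= mulrC.
have E : is_cderive (fun y => (expR (u y))%:C) x (complex.Re d * expR (u x))%:C.
  by split => //=; exact: is_derive_cst.
have T : is_cderive (fun y => cos (v y) +i* sin (v y)) x
    ((- (complex.Im d * sin (v x))) +i* (complex.Im d * cos (v x))) by split.
apply: is_cderive_eq (is_cderiveM E T) _.
by rewrite /cexp -/(u x) -/(v x); apply: complex_ext; rewrite !(ReM, ImM, ReD, ImD)/=; ring.
Qed.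

Lemma is_cderive_comp f (h : R -> R) x h' d :
  is_cderive f (h x) d -> is_derive x 1 h h' ->
  is_cderive (fun y => f (h y)) x (d * h'%:C).
Proof.
move=> [f1 f2] hh; split.
  have := is_derive1_comp f1 hh; rewrite ReM/= mulr0 subr0.
  by [].
have := is_derive1_comp f2 hh; rewrite ImM/= mulr0 add0r.
by [].
Qed.

Lemma is_cderive_deriv f x d : is_cderive f x d -> cderive1 f x = d.
Proof.
move=> [[_ f1] [_ f2]]; rewrite /cderive1 !derive1E f1 f2.
by case: d {f1 f2}.
Qed.

(** No single intermediate point serves both components, so the mean value theorem is applied to
    each one separately; this costs the factor 2. *)
Lemma cMVT f (f' : R -> R[i]) M (a b : R) : a <= b ->
  (forall x, a <= x <= b -> is_cderive f x (f' x)) ->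
  (forall x, a <= x <= b -> cabs (f' x) <= M) ->
  cabs (f b - f a) <= 2 * M * (b - a).
Proof.
move=> ab fd fM.
have key (p : R[i] -> R) : (forall z w, p (z - w) = p z - p w) ->
   (forall z, `|p z| <= cabs z) ->
   (forall x, a <= x <= b -> is_derive x 1 (fun y => p (f y)) (p (f' x))) ->
   `|p (f b - f a)| <= M * (b - a).
  move=> pB pa pd.
  have [||c cab] := @MVT_segment _ (p \o f) (p \o f') a b ab.
  - by move=> x /[!in_itv]/= /andP[? ?]; apply: pd; rewrite !ltW.
  - apply: derivable_within_continuous => x /[!in_itv]/= xab.
    by have [] := pd _ xab.
  rewrite /= pB => ->; rewrite in_itv/= in cab.
  rewrite normrM [`|b - a|]ger0_norm ?subr_ge0//.
  by rewrite ler_wpM2r ?subr_ge0//; apply: le_trans (pa _) (fM _ cab).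
apply: le_trans (cabs_le _) _.
rewrite -mulrA mulr2n mulrDl !mul1r lerD//.
  apply: key; [by move=> z w; rewrite ReD ReN|exact: Re_le_cabs|].
  by move=> x /fd[].
apply: key; [by move=> z w; rewrite ImD ImN|exact: Im_le_cabs|].
by move=> x /fd[].
Qed.

End ComplexDerivative.

#[global] Opaque cexp.

(** * Logarithms recovered from exponentials along a path *)

Section LogarithmAlongPath.
Variable R : realType.
Implicit Types (x y : R) (w : R[i]).

Lemma MVT_real (f f' : R -> R) x y : (forall z : R, is_derive z 1 f (f' z)) ->
  exists c, [/\ Num.min x y <= c, c <= Num.max x y & f y - f x = f' c * (y - x)].
Proof.
move=> fd; have [xy|yx] := leP x y.
  have [|c] := MVT_segment xy (fun z _ => fd z).
    by apply: derivable_within_continuous => z _; have [] := fd z.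
  by rewrite in_itv/= => /andP[? ?] ?; exists c.
have [|c] := MVT_segment (ltW yx) (fun z _ => fd z).
  by apply: derivable_within_continuous => z _; have [] := fd z.
rewrite in_itv/= => /andP[? ?] e; exists c; split => //.
by rewrite -opprB e -mulrN opprB.
Qed.

Lemma sin_lip x y : `|sin y - sin x| <= `|y - x|.
Proof.
have [c [_ _ ->]] := @MVT_real sin cos x y (@is_derive_sin R).
by rewrite normrM ler_piMl// ler_norml cos_geN1 cos_le1.
Qed.

Lemma cos_lip x y : `|cos y - cos x| <= `|y - x|.
Proof.
have [c [_ _ ->]] := @MVT_real cos (fun z => - sin z) x y (@is_derive_cos R).
by rewrite normrM normrN ler_piMl// ler_norml sin_geN1 sin_le1.
Qed.

Lemma abs_sin_le x : `|sin x| <= `|x|.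
Proof. by have := sin_lip 0 x; rewrite sin0 !subr0. Qed.

Lemma cos_ge x : 1 - x ^+ 2 / 2 <= cos x.
Proof.
have -> : cos x = 1 - 2 * sin (x / 2) ^+ 2.
  rewrite [in LHS](_ : x = x / 2 + x / 2); last by field.
  by rewrite cosD -!expr2 cos2sin2; ring.
have : sin (x / 2) ^+ 2 <= (x / 2) ^+ 2.
  rewrite -[leLHS]real_normK ?num_real// -[leRHS]real_normK ?num_real//.
  by rewrite ler_pXn2r ?nnegrE// abs_sin_le.
by move: (sin _ ^+ 2) => t; lra.
Qed.

Lemma sin_ge x : 0 <= x <= 1 -> x / 2 <= sin x.
Proof.
move=> /andP[x0 x1].
have [c [+ + e]] := @MVT_real sin cos 0 x (@is_derive_sin R).
move: e; rewrite sin0 !subr0 min_l// max_r// => -> c0 cx.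
rewrite mulrC ler_wpM2r//; have := cos_ge c.
suff : c ^+ 2 <= 1 by move: (c ^+ 2) => t; lra.
by rewrite expr_le1 ?(le_trans cx).
Qed.

Lemma abs_sin_ge x : `|x| <= 1 -> `|x| / 2 <= `|sin x|.
Proof.
move=> x1; have [x0|x0] := leP 0 x.
  rewrite (ger0_norm x0) in x1 *.
  by rewrite (le_trans _ (ler_norm _))// sin_ge ?x0.
have <- : `|- x| = `|x| by rewrite normrN.
have <- : `|sin (- x)| = `|sin x| by rewrite sinN normrN.
rewrite -normrN gtr0_norm ?oppr_gt0// in x1 *.
by rewrite (le_trans _ (ler_norm _))// sin_ge// x1 oppr_ge0 ltW.
Qed.

(** The left side is the distance from 1 to the line through 0 and [cexp w]. *)
Lemma abs_sin_le_cexp w : `|sin (complex.Im w)| <= cabs (cexp w - 1).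
Proof.
rewrite -(@ler_pXn2r _ 2)// ?nnegrE ?cabs_ge0// sqr_cabs real_normK ?num_real//.
rewrite !(ReD, ImD, ReN, ImN, Re_cexp, Im_cexp)/=.
set e := expR _; set c := cos _; set s := sin _.
have cs : c ^+ 2 = 1 - s ^+ 2 by rewrite /c /s cos2sin2.
rewrite oppr0 addr0.
rewrite -subr_ge0 (_ : _ - _ = (e - c) ^+ 2) ?sqr_ge0//.
rewrite (_ : _ - _ = (1 - s ^+ 2 - c ^+ 2) * (1 - e ^+ 2) + (e - c) ^+ 2); last by ring.
by rewrite cs subrr mul0r add0r.
Qed.

(** With [d] the distance from [cexp w] to 1, the modulus [expR (Re w)] lies within [d] of 1, which
    gives [|Re w| <= 2 d]; the sine of [Im w] is at most [d], which gives [|Im w| <= 2 d]. *)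
Lemma cexp_sub1_ge w : `|complex.Im w| <= 1 -> cabs (cexp w - 1) <= 1 / 4 ->
  cabs w <= 4 * cabs (cexp w - 1).
Proof.
move=> b1; set d := cabs _ => d4; set a := complex.Re w.
have d0 : 0 <= d := cabs_ge0 _.
have ed : expR a <= 1 + d.
  by rewrite -cabs_cexp -{1}(addrNK 1 (cexp w)) (le_trans (cabsD _ _))// cabs1 addrC.
have de : 1 - d <= expR a.
  rewrite -cabs_cexp lerBlDr -cabs1 -{1}(addrNK (cexp w) 1).
  by rewrite (le_trans (cabsD _ _))// addrC /d cabsC.
have ad : `|a| <= 2 * d.
  rewrite ler_norml; apply/andP; split; last first.
    by have := expR_ge1Dx a; lra.
  have := expR_ge1Dx (- a); rewrite expRN => h.
  have : (1 - a) * expR a <= 1 by rewrite -ler_pdivlMr ?expR_gt0// mul1r.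
  have [a0|a0] := leP 0 a; first by lra.
  by nra.
have := abs_sin_le_cexp w; have := abs_sin_ge b1; have := cabs_le w.
by rewrite -/a -/d; move: (cabs w) (`|sin _|) => u v; lra.
Qed.

(** The imaginary part of [E u - E x] starts at 0 and cannot take the values 1 and -1, since
    [|sin 1| >= 1/2] exceeds the allowed 1/4. By the intermediate value theorem it stays between
    them, so no multiple of [2 pi i] is picked up and [cexp_sub1_ge] applies. *)
Lemma log_path (E : R -> R[i]) x y :
  continuous (fun u => complex.Im (E u)) ->
  (forall u, Num.min x y <= u <= Num.max x y ->
     cabs (cexp (E u - E x) - 1) <= 1 / 4) ->
  cabs (E y - E x) <= 4 * cabs (cexp (E y - E x) - 1).
Proof.
move=> cE hE.
have yb : Num.min x y <= y <= Num.max x y by rewrite ge_min le_max lexx !orbT.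
apply: cexp_sub1_ge; last exact: hE.
rewrite leNgt; apply/negP => b1.
set v := fun u => complex.Im (E u) - complex.Im (E x).
have vE u : v u = complex.Im (E u - E x) by rewrite ImD ImN.
have cv : continuous v by move=> u; apply: cvgB; [exact: cE|exact: cvg_cst].
have no u r : Num.min x y <= u <= Num.max x y -> `|r| = 1 -> v u = r -> False.
  move=> /hE hu r1 vr; have := abs_sin_le_cexp (E u - E x).
  have := @abs_sin_ge r; rewrite r1 lexx => /(_ isT).
  rewrite -vE vr; move: (`|sin r|) hu; set t := cabs _ => q; lra.
have ivt r : Num.min 0 (v y) <= r <= Num.max 0 (v y) ->
    exists2 u, Num.min x y <= u <= Num.max x y & v u = r.
  have vx : v x = 0 by rewrite /v subrr.
  rewrite -vx; have [xy|yx] := leP x y => hr.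
    have [|c + cr] := @IVT _ v x y r xy _ hr.
      by apply: continuous_subspaceT.
    by rewrite in_itv/= => ?; exists c.
  have [||c + cr] := @IVT _ v y x r (ltW yx).
  - by apply: continuous_subspaceT.
  - by rewrite minC maxC.
  by rewrite in_itv/= => ?; exists c.
rewrite -vE in b1; have [v0|v0] := leP 0 (v y).
  rewrite (ger0_norm v0) in b1.
  have [|u hu vu] := ivt 1; last by apply: (no u 1) => //; rewrite normr1.
  by rewrite min_l// max_r// ler01 ltW.
rewrite (ltr0_norm v0) in b1.
have [|u hu vu] := ivt (- 1); last by apply: (no u (- 1)) => //; rewrite normrN1.
by rewrite (min_r (ltW v0)) (max_l (ltW v0)); apply/andP; split; lra.
Qed.

End LogarithmAlongPath.

(** * Trigonometric sums over Chebyshev nodes *)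

Section Quadrature.
Variable R : realType.
Implicit Types (N J k : nat) (s : R).

(** The cosines of these points are the zeros of the Chebyshev polynomial [T_N]. The points
    interlace with the grid [pi J / N] that will contain [s], so the kernel is never singular at a
    node. *)
Definition node N i : R := pi * (i%:R + 1 / 2) / N%:R.

Lemma sin_nat_pi k : sin (k%:R * pi : R) = 0.
Proof.
by elim: k => [|k IH]; rewrite ?mul0r ?sin0// -natr1 mulrDl mul1r sinDpi IH oppr0.
Qed.

Lemma node_in N i : (i < N)%N -> 0 < node N i < pi.
Proof.
move=> iN; have N0 : (0 : R) < N%:R by rewrite ltr0n (leq_ltn_trans _ iN).
rewrite /node; apply/andP; split.
  by rewrite divr_gt0// mulr_gt0 ?pi_gt0// ltr_wpDl// divr_gt0.
rewrite ltr_pdivrMr// ltr_pM2l ?pi_gt0//.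
have : i.+1%:R <= N%:R :> R by rewrite ler_nat.
by rewrite -natr1; lra.
Qed.

(** Multiplied by [2 sin h], where [h] is half the step of the angles, the sum telescopes to
    [sin (k pi) = 0]; the range of [k] puts [h] strictly between 0 and [pi]. *)
Lemma sum_cos_nodes N k : (0 < k < N.*2)%N ->
  \sum_(i < N) cos (k%:R * node N i) = 0.
Proof.
move=> /andP[k0 kN].
have N0 : (0 : R) < N%:R by rewrite ltr0n; case: N kN.
have kN' : k%:R < 2 * N%:R :> R by rewrite -natrM mul2n ltr_nat.
set h : R := k%:R * pi / (2 * N%:R).
have sh : sin h != 0.
  rewrite gt_eqF// sin_gt0_pi// /h; apply/andP; split.
    by apply: divr_gt0; apply: mulr_gt0; rewrite ?pi_gt0 ?N0 ?ltr0n.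
  by rewrite ltr_pdivrMr ?mulr_gt0// mulrC ltr_pM2l ?pi_gt0.
have sh2 : 2 * sin h != 0 by rewrite mulf_neq0// pnatr_eq0.
apply: (mulfI sh2); rewrite mulr0 mulr_sumr.
rewrite -(big_mkord xpredT (fun i => 2 * sin h * cos (k%:R * node N i))).
rewrite (eq_bigr (fun i => sin (k%:R * (pi * i.+1%:R / N%:R)) -
                           sin (k%:R * (pi * i%:R / N%:R)))); last first.
  move=> i _; have -> : k%:R * (pi * i.+1%:R / N%:R) = k%:R * node N i + h.
    by rewrite /h /node -natr1; field; rewrite gt_eqF.
  have -> : k%:R * (pi * i%:R / N%:R) = k%:R * node N i - h.
    by rewrite /h /node; field; rewrite gt_eqF.
  by rewrite sinD sinB; ring.
rewrite telescope_sumr// !mulr0 mul0r mulr0 sin0 subr0.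
by rewrite mulfK ?gt_eqF// sin_nat_pi.
Qed.

Lemma cos_neq x y : 0 <= x <= pi -> 0 <= y <= pi -> x != y ->
  (cos x - cos y : R) != 0.
Proof.
move=> xp yp; apply: contra_neq => /eqP; rewrite subr_eq0 => /eqP.
by apply: cos_inj; rewrite in_itv.
Qed.

(** Parity: equality would give [2 i + 1 = 2 J]. *)
Lemma node_neq N J i : (0 < N)%N -> node N i != pi * J%:R / N%:R.
Proof.
move=> N0; rewrite /node; apply/eqP.
have Nn : N%:R != 0 :> R by rewrite pnatr_eq0 -lt0n.
move=> /(congr1 (fun t => t * N%:R / pi * 2)).
rewrite !divfK// ![pi * _]mulrC !mulfK ?gt_eqF ?pi_gt0//.
rewrite mulrDl divfK ?pnatr_eq0// -natrM -(natrM R J) natr1 => /eqP.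
by rewrite eqr_nat => /eqP/(congr1 odd); rewrite /= !oddM !andbF.
Qed.

Lemma grid_in N J : (0 < J < N)%N -> 0 < (pi * J%:R / N%:R : R) < pi.
Proof.
move=> /andP[J0 JN]; have N0 : (0 : R) < N%:R by rewrite ltr0n (leq_ltn_trans _ JN).
apply/andP; split; last by rewrite ltr_pdivrMr// ltr_pM2l ?pi_gt0 ?ltr_nat.
by rewrite divr_gt0// mulr_gt0 ?pi_gt0 ?ltr0n.
Qed.

(* The discrete counterpart of [PV int_0^pi (cos kx - cos ks)/(cos x - cos s) dx
   = pi sin ks / sin s]. *)
Lemma hilbert_quadrature N J k (s := pi * J%:R / N%:R : R) :
  (0 < J < N)%N -> (k <= N.*2)%N ->
  sin s * (\sum_(i < N) (cos (k%:R * node N i) - cos (k%:R * s)) /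
                        (cos (node N i) - cos s)) = N%:R * sin (k%:R * s).
Proof.
move=> JN kN; have N0 : (0 < N)%N by case/andP: JN => _; case: (N).
have /andP[s0 sp] := grid_in JN; rewrite -/s in s0 sp.
have dn i : (i < N)%N -> cos (node N i) - cos s != 0.
  move=> /node_in/andP[? ?]; apply: cos_neq; rewrite ?ltW//.
  exact: node_neq.
pose S k := \sum_(i < N) (cos (k%:R * node N i) - cos (k%:R * s)) /
                        (cos (node N i) - cos s).
rewrite -/(S k).
have SS m : (m.+2 <= N.*2)%N -> S m.+2 = 2 * cos s * S m.+1 - S m.
  (* The recursion for [cos (m x)] leaves the extra term [2 * \sum cos (m.+1 * node)], which
     vanishes as long as [m.+1 < 2 N]. The quantities [sin (m s)] obey the same recursion. *)
  move=> mN; rewrite -[LHS]subr0.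
  rewrite -(mulr0 2) -(@sum_cos_nodes N m.+1) //.
  rewrite /S !mulr_sumr -!sumrB; apply: eq_bigr => i _.
  have d := dn i (ltn_ord i).
  have aux (x : R) : cos (m.+2%:R * x) = 2 * cos x * cos (m.+1%:R * x) - cos (m%:R * x).
    have -> : m.+2%:R * x = m.+1%:R * x + x by rewrite -[m.+2%:R]natr1; ring.
    have -> : m%:R * x = m.+1%:R * x - x by rewrite -[m.+1%:R]natr1; ring.
    by rewrite cosD cosB; ring.
  by rewrite !aux; field.
have key m : (m.+1 <= N.*2)%N -> sin s * S m = N%:R * sin (m%:R * s) /\
    sin s * S m.+1 = N%:R * sin (m.+1%:R * s).
  elim: m => [_|m IH mN].
    split; first by rewrite mul0r sin0 mulr0 /S big1 ?mulr0// => i _; rewrite !mul0r subrr mul0r.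
    rewrite mul1r mulrC; congr (_ * _); rewrite /S.
    rewrite (eq_bigr (fun=> 1)); first by rewrite sumr_const card_ord.
    by move=> i _; rewrite !mul1r divff ?dn.
  have [I1 I2] := IH (ltnW mN); split => //.
  rewrite SS// mulrBr I1 mulrCA I2.
  have -> : m.+2%:R * s = m.+1%:R * s + s by rewrite -[m.+2%:R]natr1; ring.
  have -> : m%:R * s = m.+1%:R * s - s by rewrite -[m.+1%:R]natr1; ring.
  by rewrite sinB sinD; ring.
case: k kN => [_|k kN]; last by have [] := key k kN.
by have [] := key 0%N; rewrite ?double_gt0.
Qed.

End Quadrature.

(** * Approximation of logarithms of zero-free polynomials *)

Section OuterFunctions.
Variable R : realType.
Implicit Types (x r c e : R) (z : R[i]) (rs : seq R[i]).

Lemma geometric_sum_le r n : 0 <= r < 1 -> \sum_(k < n) r ^+ k <= (1 - r)^-1.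
Proof.
move=> /andP[r0 r1]; rewrite -[leRHS]mul1r ler_pdivlMr ?subr_gt0//.
rewrite mulrC (_ : _ * _ = 1 - r ^+ n); last first.
  by rewrite -opprB mulNr -subrX1 opprB.
by rewrite gerBl exprn_ge0.
Qed.

Lemma geometric_eventually_le r c e : 0 <= r < 1 -> 0 < e ->
  exists K0, forall K, (K0 <= K)%N -> c * r ^+ K <= e.
Proof.
move=> /andP[r0 r1] e0.
have rn : `|r| < 1 by rewrite ger0_norm.
have /cvgrPdist_le/(_ (e / (`|c| + 1))) : (fun n => r ^+ n) @ \oo --> (0 : R) by apply: cvg_expr.
have c0 : 0 < `|c| + 1 by rewrite ltr_wpDl.
case; first by rewrite divr_gt0.
move=> K0 _ hK; exists K0 => K KK0; have := hK K KK0.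
rewrite /= sub0r normrN normrX ger0_norm// ler_pdivlMr// mulrC => h.
apply: le_trans h; rewrite ler_wpM2r ?exprn_ge0//.
by rewrite (le_trans (ler_norm _))// lerDl.
Qed.

(** With [q = (1 + r) / 2] one has [r <= q^2]; one factor [q^K] absorbs [K], because [K q^K] is at
    most the geometric sum, and the other tends to 0. *)
Lemma nat_geometric_eventually_le r c e : 0 <= r < 1 -> 0 < e -> 0 <= c ->
  exists K0, forall K, (K0 <= K)%N -> K%:R * (c * r ^+ K) <= e.
Proof.
move=> /andP[r0 r1] e0 c0; set q := (1 + r) / 2.
have q01 : 0 <= q < 1 by rewrite /q; apply/andP; split; lra.
have /andP[q0 q1] := q01.
have [K0 hK] := geometric_eventually_le (c * (1 - q)^-1) q01 e0.
exists K0 => K /hK; apply: le_trans.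
have rq : r ^+ K <= q ^+ K * q ^+ K.
  have rq : r <= q * q by have := sqr_ge0 (1 - r); rewrite /q; nra.
  by rewrite -exprMn lerXn2r// nnegrE mulr_ge0.
have Kq : K%:R * q ^+ K <= (1 - q)^-1.
  apply: le_trans (geometric_sum_le K q01).
  rewrite mulr_natl -[X in _ *+ X]card_ord -sumr_const; apply: ler_sum => i _.
  by rewrite ler_wiXn2l ?(ltW q1)// ltnW.
rewrite mulrCA -mulrA ler_wpM2l//.
apply: le_trans (_ : K%:R * (q ^+ K * q ^+ K) <= _).
  by rewrite ler_wpM2l.
by rewrite mulrA ler_wpM2r ?exprn_ge0.
Qed.

Lemma is_cderive_ray z (K : nat) x :
  is_cderive (fun t => \sum_(k < K) z ^+ k.+1 / k.+1%:R * t%:C ^+ k.+1) x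
             (\sum_(k < K) z ^+ k.+1 * x%:C ^+ k).
Proof.
apply: (@is_cderive_sum _ _ (fun k t => z ^+ k.+1 / k.+1%:R * t%:C ^+ k.+1) x
  (fun k => z ^+ k.+1 * x%:C ^+ k)) => k _.
apply: is_cderive_eq (is_cderive_scale _ (is_cderiveX k x)) _.
by rewrite mulrA divfK ?pnatr_eq0.
Qed.

(* On the ray [t z] the derivative of [(1 - t z) exp (sum_(k <= K) (t z)^k / k)]
   telescopes to a single term of order [K]. *)
Lemma primary_factor_bound r z (K : nat) : 0 <= r < 1 -> cabs z <= r ->
  cabs ((1 - z) * cexp (\sum_(k < K) z ^+ k.+1 / k.+1%:R) - 1) <=
  2 * expR (1 - r)^-1 * r ^+ K.
Proof.
move=> /andP[r0 r1] zr.
pose Q (t : R) : R[i] := \sum_(k < K) z ^+ k.+1 / k.+1%:R * t%:C ^+ k.+1.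
pose f (t : R) := (1 + - z * t%:C) * cexp (Q t).
pose f' (t : R) := - (z * (z * t%:C) ^+ K * cexp (Q t)).
have fd t : is_cderive f t (f' t).
  have d1 := is_cderiveD (is_cderive_cst 1 t) (is_cderive_scale (- z) (is_cderive_id t)).
  apply: is_cderive_eq (is_cderiveM d1 (is_cderive_cexp (is_cderive_ray z K t))) _.
  rewrite /f' -/(Q t).
  have -> : \sum_(k < K) z ^+ k.+1 * t%:C ^+ k = z * \sum_(k < K) (z * t%:C) ^+ k.
    by rewrite mulr_sumr; apply: eq_bigr => k _; rewrite exprMn exprS mulrA.
  rewrite mulr1 add0r [X in _ + X]mulrA.
  rewrite (_ : (1 + - z * t%:C) * _ = - (z * ((z * t%:C) ^+ K - 1))); last first.
    by rewrite subrX1; ring.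
  by ring.
have Qle t : 0 <= t <= 1 -> complex.Re (Q t) <= (1 - r)^-1.
  move=> /andP[t0 t1]; apply: le_trans (ler_norm _) _.
  apply: le_trans (Re_le_cabs _) _; apply: le_trans (cabs_sum _ _ _) _.
  apply: le_trans (_ : \sum_(k < K) r ^+ k <= _); last by rewrite geometric_sum_le// r0.
  apply: ler_sum => k _; rewrite !cabsM !cabsX cabsV cabs_nat cabs_real (ger0_norm t0).
  apply: le_trans (_ : cabs z ^+ k.+1 / k.+1%:R <= _).
    by rewrite ler_piMr ?exprn_ile1// mulr_ge0 ?exprn_ge0 ?cabs_ge0 ?invr_ge0.
  apply: le_trans (_ : cabs z ^+ k.+1 <= _).
    by rewrite ler_piMr ?exprn_ge0 ?cabs_ge0// invf_le1 ?ler1n ?ltr0n.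
  apply: le_trans (_ : r ^+ k.+1 <= _); first by rewrite lerXn2r ?nnegrE ?cabs_ge0.
  by rewrite exprS ler_piMl ?exprn_ge0// ltW.
have f1 : (1 - z) * cexp (\sum_(k < K) z ^+ k.+1 / k.+1%:R) = f 1.
  rewrite /f /Q mulr1; congr (_ * cexp _); apply: eq_bigr => k _.
  by rewrite expr1n mulr1.
have Q0 : Q 0 = 0.
  by apply: big1 => k _; rewrite [0%:C ^+ _]expr0n mulr0.
have f0 : f 0 = 1 by rewrite /f Q0 cexp0 mulr1 [_ * 0%:C]mulr0 addr0.
rewrite f1 -[X in _ - X]f0.
have := @cMVT _ f f' (expR (1 - r)^-1 * r ^+ K) 0 1 ler01 (fun t _ => fd t).
rewrite subr0 mulr1 mulrA; apply => t /[dup] t01 /andP[t0 t1].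
rewrite /f' cabsN cabsM cabs_cexp mulrC ler_pM ?cabs_ge0 ?expR_ge0 ?ler_expR ?Qle//.
rewrite cabsM cabsX cabsM cabs_real (ger0_norm t0).
apply: le_trans (_ : 1 * r ^+ K <= _); last by rewrite mul1r.
rewrite ler_pM ?exprn_ge0 ?mulr_ge0 ?cabs_ge0//; first by rewrite (le_trans zr)// ltW.
by rewrite lerXn2r ?nnegrE ?mulr_ge0 ?cabs_ge0// -[r]mulr1 ler_pM ?cabs_ge0.
Qed.

Definition expi x : R[i] := cexp ('i * x%:C).

Lemma cabs_expi x : cabs (expi x) = 1.
Proof. exact: cabs_cexp_i. Qed.

Lemma expiE x : expi x = cos x +i* sin x.
Proof. exact: cexp_i. Qed.

Lemma cexp_expi x : cexp ('i * x%:C) = expi x.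
Proof. by []. Qed.

Lemma expiX x k : expi x ^+ k = expi (k%:R * x).
Proof.
by rewrite /expi cexpX rmorphM/= rmorph_nat mulrCA.
Qed.

Lemma outer_factors_approx rs e : 0 < e -> all (fun z => cabs z < 1) rs ->
  exists K0, forall K, (K0 <= K)%N -> exists l : nat -> R[i], forall x,
    K%:R * cabs ((\prod_(z <- rs) (1 - z * expi x)) *
                 cexp (\sum_(k < K) l k * expi x ^+ k.+1) - 1) <= e.
Proof.
move=> + /allP; elim: rs e => [|z rs IH] e e0 hrs.
  exists 0%N => K _; exists (fun=> 0) => x.
  rewrite big_nil big1 => [|k _]; last by rewrite mul0r.
  by rewrite cexp0 mulr1 subrr cabs0 mulr0 ltW.
(* The product of two quantities within [a] and [b] of 1 is within [a + b + a b] of 1; with [b <= 1]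
   this is at most [2 a + b], hence the division by 3. *)
set d := Num.min (e / 3) 1.
have d0 : 0 < d by rewrite lt_min ltr01 divr_gt0.
have [d3 d1] : d <= e / 3 /\ d <= 1 by rewrite !ge_min !lexx orbT.
have [K1 H1] := IH d d0 (fun w hw => hrs w (mem_behead (s := z :: rs) hw)).
have r01 : 0 <= cabs z < 1 by rewrite cabs_ge0 hrs ?mem_head.
have [|K2 H2] := @nat_geometric_eventually_le (cabs z) (2 * expR (1 - cabs z)^-1) d r01 d0.
  by rewrite mulr_ge0 ?expR_ge0.
exists (maxn 1 (maxn K1 K2)) => K; rewrite !geq_max => /and3P[K0 /H1[l hl] /H2 hK].
exists (fun k => z ^+ k.+1 / k.+1%:R + l k) => x.
rewrite big_cons.
under [X in cexp X]eq_bigr do rewrite mulrDl.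
rewrite big_split/= cexpD.
set s1 := \sum_(k < K) _ / _ * _.
have -> : s1 = \sum_(k < K) (z * expi x) ^+ k.+1 / k.+1%:R.
  by apply: eq_bigr => k _; rewrite [in RHS]exprMn [RHS]mulrAC.
have zx : cabs (z * expi x) = cabs z by rewrite cabsM cabs_expi mulr1.
have := @primary_factor_bound (cabs z) (z * expi x) K r01.
rewrite zx lexx => /(_ isT).
move: (hl x); clear -K0 hK d0 d1 d3.
set A := \prod_(j <- rs) _; set E1 := cexp (\sum_(k < K) l k * _).
set B := 1 - _; set E2 := cexp _.
have -> : B * A * (E2 * E1) - 1 = (B * E2 - 1) * (A * E1 - 1) + (B * E2 - 1) + (A * E1 - 1).
  by ring.
move=> hA hB.
have {}hB : K%:R * cabs (B * E2 - 1) <= d by apply: le_trans hK; rewrite ler_wpM2l.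
have K1 : 1 <= K%:R :> R by rewrite ler1n.
have hB1 : cabs (B * E2 - 1) <= 1.
  by apply: le_trans d1; apply: le_trans hB; rewrite ler_peMl ?cabs_ge0.
move: hA hB hB1; set a := A * E1 - 1; set b := B * E2 - 1 => hA hB hB1.
apply: le_trans (_ : K%:R * (cabs a + cabs b + cabs a) <= _).
  rewrite ler_wpM2l//; apply: le_trans (cabsD _ _) _; rewrite lerD//.
  apply: le_trans (cabsD _ _) _; rewrite lerD// cabsM ler_piMl ?cabs_ge0//.
rewrite !mulrDr; lra.
Qed.

Lemma is_cderive_expiX k x :
  is_cderive (fun y => expi y ^+ k) x ('i * k%:R * expi x ^+ k).
Proof.
apply: is_cderive_ext (_ : is_cderive (fun y => cexp (k%:R * 'i * y%:C)) _ _).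
  by move=> y; rewrite /expi cexpX mulrA.
apply: is_cderive_eq (is_cderive_cexp (is_cderive_scale _ (is_cderive_id x))) _.
by rewrite mulr1 [k%:R * _]mulrC /expi cexpX !mulrA ['i * _]mulrC.
Qed.

#[global] Opaque expi.

Lemma is_cderive_cont (f : R -> R[i]) (f' : R -> R[i]) :
  (forall x, is_cderive f x (f' x)) ->
  continuous (fun x => complex.Re (f x)) /\ continuous (fun x => complex.Im (f x)).
Proof.
move=> fd; split => x; have [[d1 _] [d2 _]] := fd x;
  by apply: differentiable_continuous; apply/derivable1_diffP.
Qed.

(** The [z] in [rs] are the reciprocals of the zeros of a polynomial that has none in the closed
    unit disc. *)
Definition outer (F : R -> R[i]) := exists (c : R[i]) rs, all (fun z => cabs z < 1) rs /\
  forall x, cexp (F x) = c * \prod_(z <- rs) (1 - z * expi x).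

(** The product formula controls only [cexp (F x)]. Adding the truncated series [S] makes the
    exponential almost constant, and [log_path] then shows that [F + S] itself is almost constant;
    [kappa] is its value at 0. *)
Lemma outer_approx (F : R -> R[i]) e : 0 < e ->
  continuous (fun x => complex.Im (F x)) -> outer F ->
  exists K0, forall K, (K0 <= K)%N -> exists (l : nat -> R[i]) kappa, forall x,
    K%:R * cabs (F x - kappa - \sum_(k < K) l k * expi x ^+ k.+1) <= e.
Proof.
move=> e0 cF [c [rs [hrs hF]]].
(* A factor 4 is lost in dividing by [G 0], of modulus at least 1/2, and another one in [log_path],
   whose hypothesis [4 * (1 / 16) <= 1 / 4] explains the second bound. *)
set d := Num.min (e / 16) (1 / 16).
have d0 : 0 < d by rewrite lt_min !divr_gt0.
have [de d1] : d <= e / 16 /\ d <= 1 / 16 by rewrite !ge_min !lexx orbT.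
have [K0 hK] := outer_factors_approx d0 hrs.
exists (maxn 1 K0) => K; rewrite geq_max => /andP[K1 /hK[l hl]].
have K1' : 1 <= K%:R :> R by rewrite ler1n.
pose S x := \sum_(k < K) l k * expi x ^+ k.+1.
pose E x := F x + S x.
exists (fun k => - l k), (E 0) => x.
have -> : F x - E 0 - \sum_(k < K) - l k * expi x ^+ k.+1 = E x - E 0.
  under eq_bigr do rewrite mulNr.
  by rewrite sumrN opprK addrAC.
pose G y := (\prod_(z <- rs) (1 - z * expi y)) * cexp (S y).
have EG y : cexp (E y) = c * G y by rewrite /E /G cexpD hF [RHS]mulrA.
have Gd y : cabs (G y - 1) <= d / K%:R.
  by rewrite ler_pdivlMr ?(lt_le_trans ltr01)// mulrC; apply: hl.
have cE : continuous (fun y => complex.Im (E y)).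
  have [_ cS] := @is_cderive_cont S (fun y => \sum_(k < K) l k * ('i * k.+1%:R * expi y ^+ k.+1))
    (fun y => is_cderive_sum (f := fun k y => l k * expi y ^+ k.+1)
               (fun k _ => is_cderive_scale _ (is_cderive_expiX k.+1 y))).
  have -> : (fun y => complex.Im (E y)) = (fun y => complex.Im (F y) + complex.Im (S y)).
    by apply/funext => y; rewrite ImD.
  by move=> y; apply: cvgD; [exact: cF|exact: cS].
clearbody E G.
have dK : d / K%:R <= 1 / 16.
  by rewrite ler_pdivrMr ?(lt_le_trans ltr01)// (le_trans d1)// ler_peMr// divr_ge0.
have c0 : c != 0.
  by have := cexp_neq0 (E 0); rewrite EG; apply: contra_neq => ->; rewrite mul0r.
have G0 : 1 / 2 <= cabs (G 0).
  have := cabsB (G 0) (G 0 - 1); rewrite opprB addrC addrNK cabs1.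
  by have := Gd 0; lra.
have key y : cabs (cexp (E y - E 0) - 1) <= 4 * (d / K%:R).
  rewrite cexpB !EG -mulf_div divff// mul1r.
  have G0n : G 0 != 0 by rewrite -cabs_gt0; lra.
  have -> : G y / G 0 - 1 = ((G y - 1) - (G 0 - 1)) / G 0 by field.
  rewrite cabsM cabsV ler_pdivrMr ?cabs_gt0//.
  have := cabsB (G y - 1) (G 0 - 1); have := Gd y; have := Gd 0.
  have : 0 <= d / K%:R by rewrite divr_ge0// ltW.
  move: G0; move: (cabs (G 0)) (cabs (G y - 1)) (cabs (G 0 - 1)) (d / K%:R) => a b b' q.
  move=> h1 h2 h3 h4 h5; apply: le_trans h5 _.
  have : 0 <= q * (2 * a - 1) by rewrite mulr_ge0//; lra.
  by lra.
have h : cabs (E x - E 0) <= 4 * (4 * (d / K%:R)).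
  apply: le_trans (_ : 4 * cabs (cexp (E x - E 0) - 1) <= _); last by rewrite ler_wpM2l.
  by apply: log_path => // u _; rewrite (le_trans (key u))//; lra.
apply: le_trans (ler_wpM2l _ h) _; first by [].
have -> : K%:R * (4 * (4 * (d / K%:R))) = 16 * d.
  by field; rewrite pnatr_eq0 -lt0n.
by lra.
Qed.

Lemma outer_of_poly (p : {poly R[i]}) (F : R -> R[i]) :
  (forall t, `|t| <= 1 -> ~~ root p t) ->
  (forall x, cexp (F x) = p.[expi x]) -> outer F.
Proof.
move=> hp hF; have [rs hrs] := closed_field_poly_normal p.
have p0 : p != 0 by apply: contraTneq (hp 0 ltac:(by rewrite normr0 ler01)) => ->; rewrite root0.
have rs1 z : z \in rs -> 1 < cabs z.
  move=> zrs; rewrite ltNge; apply/negP => z1.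
  have : `|z| <= 1 by rewrite cabsE -(rmorph1 (real_complex R)) lecR.
  by move=> /hp; rewrite hrs rootZ ?lead_coef_eq0// root_prod_XsubC zrs.
exists (lead_coef p * \prod_(z <- rs) - z), [seq z^-1 | z <- rs]; split.
  apply/allP => w /mapP[z /rs1 z1 ->]; rewrite cabsV invf_lt1//.
  by rewrite (lt_trans ltr01).
move=> x; rewrite hF {1}hrs hornerZ horner_prod -mulrA; congr (_ * _).
rewrite big_map -big_split/= big_seq [RHS]big_seq; apply: eq_bigr => z /rs1 z1.
rewrite hornerXsubC mulrBr mulr1 mulrA mulNr divff; first by ring.
by rewrite -cabs_gt0 (lt_trans ltr01).
Qed.

End OuterFunctions.

(** * Estimates for the discretized conjugate function *)

Section ConjugateFunction.
Variable R : realType.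
Implicit Types (x s : R) (F : R -> R[i]).

Lemma pi_le4 : pi <= 4 :> R.
Proof. by have := @pihalf_lt2 R; lra. Qed.

Lemma cos_anti x y : 0 <= x -> x <= y -> y <= pi -> cos y <= cos x.
Proof.
move=> x0 xy yp.
have xi : x \in `[0, pi] by rewrite in_itv/= x0 (le_trans xy yp).
have yi : y \in `[0, pi] by rewrite in_itv/= yp (le_trans x0 xy).
by rewrite leNgt ltr_cos// -leNgt.
Qed.

(** The difference is [- 2 sin ((x + s) / 2) sin ((x - s) / 2)], and on this range each sine is at
    least half its argument in modulus. *)
Lemma cos_kernel_near x s : 0 <= x <= 1 -> 0 < s <= 1 ->
  (x + s) * `|x - s| / 8 <= `|cos x - cos s|.
Proof.
move=> /andP[x0 x1] /andP[s0 s1].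
have -> : cos x - cos s = - 2 * sin ((x + s) / 2) * sin ((x - s) / 2).
  rewrite [in cos x](_ : x = (x + s) / 2 + (x - s) / 2); last by field.
  rewrite [in cos s](_ : s = (x + s) / 2 - (x - s) / 2); last by field.
  by rewrite cosB cosD; ring.
rewrite 2!normrM normrN [`|2|]ger0_norm//.
have h1 : (x + s) / 2 / 2 <= `|sin ((x + s) / 2)|.
  by rewrite (le_trans _ (ler_norm _))// sin_ge//; apply/andP; split; lra.
have h2 : `|x - s| / 2 / 2 <= `|sin ((x - s) / 2)|.
  have <- : `|(x - s) / 2| = `|x - s| / 2 by rewrite normrM [`|2^-1|]gtr0_norm// invr_gt0.
  apply: abs_sin_ge; rewrite ler_norml; apply/andP; split; lra.
apply: le_trans (_ : 2 * ((x + s) / 2 / 2 * (`|x - s| / 2 / 2)) <= _); first by lra.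
rewrite -[leRHS]mulrA ler_wpM2l// ler_pM//; by lra.
Qed.

(** Since [(a + 1/2)^2 >= a (a + 1)], the terms are dominated by the telescoping differences
    [1/a - 1/(a + 1)]. *)
Lemma sum_inv_sqr_le (N J : nat) : (0 < J)%N ->
  \sum_(i < N) ((i%:R + 1 / 2 + J%:R) ^+ 2)^-1 <= (J%:R)^-1 :> R.
Proof.
move=> J0; have J0' : (0 : R) < J%:R by rewrite ltr0n.
rewrite -(big_mkord xpredT (fun i => ((i%:R + 1 / 2 + J%:R) ^+ 2)^-1)).
apply: le_trans (_ : \sum_(0 <= i < N) (- (i.+1%:R + J%:R)^-1 - - (i%:R + J%:R)^-1) <= _).
  apply: ler_sum => i _.
  have i0 : (0 : R) <= i%:R by [].
  rewrite -[i.+1%:R]natr1; set a := i%:R + J%:R; have a0 : 0 < a by rewrite /a; lra.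
  rewrite (_ : i%:R + 1 + _ = a + 1); last by rewrite /a; ring.
  rewrite (_ : _ - _ = (a * (a + 1))^-1); last by field; apply/andP; split; lra.
  have a1 : 0 < a * (a + 1) by rewrite mulr_gt0//; lra.
  rewrite (_ : i%:R + _ + _ = a + 1 / 2); last by rewrite /a; ring.
  rewrite lef_pV2 ?posrE ?exprn_gt0//; last by lra.
  by rewrite expr2; lra.
rewrite telescope_sumr// add0r opprK addrC lerBlDr lerDl.
by rewrite invr_ge0 addr_ge0.
Qed.

(** By linearity this reduces to single powers, where conjugation turns [2 cos (k x)] into
    [2 i sin (k s)]: this is [hilbert_quadrature]. *)
Lemma conj_quadrature (N J K : nat) (l : nat -> R[i]) s (q : R -> R[i]) :
  (0 < J < N)%N -> (K <= N.*2)%N -> s = pi * J%:R / N%:R ->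
  (forall x, q x = \sum_(k < K) l k * expi x ^+ k.+1) ->
  q s - q (- s) = 'i * \sum_(i < N) (sin s / N%:R / (cos (node R N i) - cos s))%:C *
     ((q (node R N i) + q (- node R N i)) - (q s + q (- s))).
Proof.
move=> JN KN sE qE; have N0 : N%:R != 0 :> R.
  by rewrite pnatr_eq0; case/andP: JN => _; case: (N).
have qp x : q x + q (- x) = \sum_(k < K) l k * (2 * cos (k.+1%:R * x))%:C.
  rewrite !qE -big_split/=; apply: eq_bigr => k _.
  by rewrite -mulrDr !expiX mulrN -cexp_i2cos mulNi.
have qm x : q x - q (- x) = \sum_(k < K) l k * ('i * (2 * sin (k.+1%:R * x))%:C).
  rewrite !qE -sumrB/=; apply: eq_bigr => k _.
  by rewrite -mulrBr !expiX mulrN -cexp_i2sin mulNi.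
rewrite qm; under [in RHS]eq_bigr => i _ do rewrite !qp -sumrB.
rewrite (eq_bigr (fun i : 'I_N => \sum_(k < K) (sin s / N%:R / (cos (node R N i) - cos s))%:C *
    (l k * (2 * cos (k.+1%:R * node R N i))%:C - l k * (2 * cos (k.+1%:R * s))%:C))); last first.
  by move=> i _; rewrite mulr_sumr.
rewrite exchange_big/= mulr_sumr; apply: eq_bigr => k _.
under eq_bigr do rewrite -mulrBr mulrCA -rmorphB/= -rmorphM/=.
rewrite -mulr_sumr mulrCA; congr (_ * (_ * _)).
rewrite -rmorph_sum/=; congr (_%:C).
have H := @hilbert_quadrature R N J k.+1 JN (leq_trans (ltn_ord k) KN); rewrite -sE in H.
apply: (mulfI N0); rewrite mulrCA -H !mulr_sumr.
apply: eq_bigr => i _; move: (_ - cos s)^-1 => a.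
by field.
Qed.

Lemma kernel_near x x0 s : 0 <= x <= x0 -> x0 <= 1 -> 0 < s <= 1 -> x != s ->
  `|sin s / (cos x - cos s)| <= 8 * (s / (x + s)) / `|x - s|.
Proof.
move=> /andP[xge xx0] x01 /andP[s0 s1] xs.
have xs0 : 0 < `|x - s| by rewrite normr_gt0 subr_eq0.
have xps : 0 < x + s by rewrite ltr_wpDl.
have h : (x + s) * `|x - s| / 8 <= `|cos x - cos s|.
  by apply: cos_kernel_near; rewrite ?xge ?s0 ?(le_trans xx0).
rewrite normrM normfV.
apply: le_trans (_ : s / ((x + s) * `|x - s| / 8) <= _).
  rewrite ler_pM ?invr_ge0//.
    by rewrite (le_trans (abs_sin_le _))// gtr0_norm.
  by rewrite lef_pV2 ?posrE ?(lt_le_trans _ h)// divr_gt0// mulr_gt0.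
rewrite le_eqVlt; apply/orP; left; apply/eqP; field.
by rewrite (gt_eqF xs0) (gt_eqF xps).
Qed.

Lemma kernel_far x x0 s : 0 < x0 <= 1 -> x0 <= x <= pi -> 0 < s <= x0 / 2 ->
  `|sin s / (cos x - cos s)| <= s / (cos (x0 / 2) - cos x0).
Proof.
move=> /andP[x00 x01] /andP[x0x xpi] /andP[s0 sx0].
have pi2 := @pi_ge2 R.
have k00 : 0 < cos (x0 / 2) - cos x0.
  by rewrite subr_gt0 ltr_cos ?in_itv/=; [lra|apply/andP; split; lra|apply/andP; split; lra].
have h : cos (x0 / 2) - cos x0 <= `|cos x - cos s|.
  by rewrite distrC (le_trans _ (ler_norm _))// lerB// cos_anti//; lra.
rewrite normrM normfV ler_pM ?invr_ge0//.
  by rewrite (le_trans (abs_sin_le _))// gtr0_norm.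
by rewrite lef_pV2 ?posrE ?(lt_le_trans k00 h).
Qed.

Lemma node_dist (N J i : nat) : (0 < N)%N ->
  N%:R^-1 <= `|node R N i - pi * J%:R / N%:R|.
Proof.
move=> N0; have NR0 : 0 < N%:R :> R by rewrite ltr0n.
rewrite /node (_ : _ - _ = pi * (i%:R + 1 / 2 - J%:R) / N%:R); last by field; rewrite gt_eqF.
rewrite !normrM (gtr0_norm (@pi_gt0 R)) [`|N%:R^-1|]gtr0_norm ?invr_gt0//.
rewrite -[leLHS]mul1r ler_wpM2r ?invr_ge0//.
have : 1 / 2 <= `|i%:R + 1 / 2 - J%:R| :> R.
  have [iJ|Ji] := ltnP i J.
    have : i.+1%:R <= J%:R :> R by rewrite ler_nat.
    by rewrite -natr1 => h; rewrite ler0_norm; lra.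
  have : J%:R <= i%:R :> R by rewrite ler_nat.
  by move=> h; rewrite ger0_norm; lra.
have := @pi_ge2 R; move: (`|_|) => u; move: (pi : R) => p; nra.
Qed.

Lemma node_sqr (N J i : nat) (s := pi * J%:R / N%:R : R) : (0 < N)%N -> (0 < J)%N ->
  s / (N%:R * (node R N i + s) ^+ 2) = J%:R / (i%:R + 1 / 2 + J%:R) ^+ 2 / pi.
Proof.
move=> N0 J0; have h : 0 < i%:R + 1 / 2 + J%:R :> R.
  by rewrite ltr_wpDr// ltr_wpDl// divr_gt0.
have NR0 : 0 < N%:R :> R by rewrite ltr0n.
have -> : node R N i + s = pi * (i%:R + 1 / 2 + J%:R) / N%:R.
  by rewrite /node /s; field; rewrite gt_eqF.
move: (i%:R + _ + _) h => u u0; rewrite /s.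
move: (@pi_gt0 R); move: (pi : R) => p p0.
by field; rewrite (gt_eqF u0) (gt_eqF NR0) (gt_eqF p0).
Qed.

(** Trades the singularity [1/D] for a factor [j]. In [x + s <= D + 2 s], the bound [mn <= 1 <= j]
    handles [D], while [mn <= n D] with [n s <= 4 j] handles [2 s]; together they give [9 j D], and
    [72 = 8 * 9]. *)
Lemma kernel_near_weighted x s D mn (j n : R) : 1 <= j -> 0 < n -> n * s <= 4 * j ->
  0 <= x -> 0 < s -> 0 < D -> x - s <= D -> 0 <= mn -> mn <= 1 -> mn <= n * D ->
  8 * (s / (x + s)) / D * mn <= 72 * j * (s / (x + s) ^+ 2).
Proof.
move=> j1 n0 ns x0 s0 D0 xsD mn0 mn1 mn2.
have xs : 0 < x + s by rewrite ltr_wpDl.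
have key : mn * (x + s) <= 9 * j * D.
  apply: le_trans (_ : mn * (D + 2 * s) <= _).
    by rewrite ler_wpM2l//; lra.
  have h1 : mn * D <= j * D by rewrite (ler_wpM2r (ltW D0))//; lra.
  have h2 : mn * s <= n * D * s by rewrite (ler_wpM2r (ltW s0)).
  have h3 : n * D * s <= 4 * j * D by rewrite mulrAC (ler_wpM2r (ltW D0)).
  by lra.
rewrite (_ : 8 * _ / D * _ = 8 * (s / (x + s) ^+ 2) * (mn * (x + s) / D)); last first.
  by field; rewrite !gt_eqF.
rewrite (_ : 72 * _ * _ = 8 * (s / (x + s) ^+ 2) * (9 * j)); last by ring.
rewrite ler_wpM2l//; last by rewrite ler_pdivrMr.
by rewrite mulr_ge0// divr_ge0 ?sqr_ge0 ?ltW.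
Qed.

(** The bound does not depend on the number [N] of nodes, which can thus grow until the quadrature
    error is negligible. The smoothness scale [n] is separate from [N], so that the lemma serves
    both for [B] and for the approximation error. *)
Lemma kernel_sum_le (N J : nat) (n s x0 eps M : R) (f : nat -> R) j :
  (0 < J < N)%N -> s = pi * J%:R / N%:R -> 1 <= j -> 0 < n -> n * s <= 4 * j ->
  0 < x0 <= 1 -> s <= x0 / 2 -> 0 <= eps -> 0 <= M ->
  (forall i, (i < N)%N -> node R N i <= x0 ->
     0 <= f i <= eps * Num.min (n * `|node R N i - s|) 1) ->
  (forall i, (i < N)%N -> 0 <= f i <= M) ->
  \sum_(i < N) `|sin s / (cos (node R N i) - cos s)| / N%:R * f i <=
    36 * eps * j + s * M / (cos (x0 / 2) - cos x0).
Proof.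
move=> JN sE j1 n0 ns /andP[x00 x01] sx0 eps0 M0 near far.
have N0 : (0 < N)%N by case/andP: JN => _; case: (N).
have J0 : (0 < J)%N by case/andP: JN.
have NR0 : 0 < N%:R :> R by rewrite ltr0n.
have JR0 : 0 < J%:R :> R by rewrite ltr0n.
have s0 : 0 < s by rewrite sE; case/andP: (grid_in R JN).
set k0 := cos (x0 / 2) - cos x0.
have pi2 := @pi_ge2 R.
have k00 : 0 < k0.
  by rewrite subr_gt0 ltr_cos ?in_itv/=; [lra|apply/andP; split; lra|apply/andP; split; lra].
apply: le_trans (_ : \sum_(i < N) (36 * eps * j * (J%:R / (i%:R + 1 / 2 + J%:R) ^+ 2) +
      s * M / k0 / N%:R) <= _); last first.
  rewrite big_split/= sumr_const card_ord -[X in _ + X <= _]mulr_natr divfK ?gt_eqF//.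
  rewrite lerD2r -mulr_sumr -[leRHS]mulr1 ler_wpM2l//.
    by rewrite !mulr_ge0// (le_trans ler01).
  have JRn : J%:R != 0 :> R by rewrite gt_eqF.
  by rewrite -mulr_sumr -[leRHS](mulfV JRn) ler_wpM2l// sum_inv_sqr_le.
apply: ler_sum => i _; have iN := ltn_ord i.
have /andP[xi0 xipi] := node_in R iN.
have /andP[f0 fM] := far _ iN.
have [xx0|xx0] := leP (node R N i) x0; last first.
  apply: le_trans (_ : s / k0 / N%:R * M <= _).
    rewrite ler_pM ?divr_ge0// ler_wpM2r ?invr_ge0//.
    by rewrite kernel_far ?x00 ?s0 ?(ltW xx0) ?(ltW xipi).
  rewrite (_ : _ * M = s * M / k0 / N%:R); last by rewrite mulrAC [s / k0 * M]mulrAC.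
  by rewrite lerDr mulr_ge0 ?divr_ge0 ?sqr_ge0// !mulr_ge0// (le_trans ler01).
apply: le_trans (_ : 36 * eps * j * (J%:R / (i%:R + 1 / 2 + J%:R) ^+ 2) <= _); last first.
  by rewrite lerDl !divr_ge0 ?mulr_ge0// ltW.
have xs : 0 < `|node R N i - s|.
  by rewrite sE (lt_le_trans _ (node_dist J i N0))// invr_gt0.
set D := `|node R N i - s| in xs *.
have /andP[_ fe] := near _ iN xx0; rewrite -/D in fe.
apply: le_trans (_ : 8 * (s / (node R N i + s)) / D / N%:R * (eps * Num.min (n * D) 1) <= _).
  rewrite ler_pM ?divr_ge0// ler_wpM2r ?invr_ge0//.
  apply: (@kernel_near _ x0); rewrite ?(ltW xi0) ?s0//=.
    by rewrite (le_trans sx0)//; lra.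
  by rewrite -subr_eq0 -normr_gt0.
set mn := Num.min _ _.
have h := @kernel_near_weighted (node R N i) s D mn j n j1 n0 ns (ltW xi0) s0 xs (ler_norm _).
have {}h : 8 * (s / (node R N i + s)) / D * mn <= 72 * j * (s / (node R N i + s) ^+ 2).
  have nD : 0 <= n * D by rewrite mulr_ge0 ?(ltW n0) ?(ltW xs).
  by apply: h; rewrite /mn ?ge_min ?le_min ?lexx ?ler01 ?orbT ?nD.
apply: le_trans (_ : 72 * j * (s / (node R N i + s) ^+ 2) * (eps / N%:R) <= _).
  apply: le_trans (ler_wpM2r _ h); last by rewrite divr_ge0.
  by rewrite le_eqVlt; apply/orP; left; apply/eqP; clearbody mn D; ring.
have -> : 72 * j * (s / (node R N i + s) ^+ 2) * (eps / N%:R) =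
          72 * j * eps * (s / (N%:R * (node R N i + s) ^+ 2)).
  by rewrite [in RHS]invfM; ring.
rewrite sE node_sqr//; set Y := J%:R / _.
have Y0 : 0 <= Y by rewrite divr_ge0 ?sqr_ge0.
(* The estimate [2 <= pi] turns 72 into 36. *)
have hY : Y / pi <= Y / 2 by rewrite ler_wpM2l// lef_pV2 ?posrE ?pi_gt0.
rewrite (_ : 36 * eps * j * Y = 72 * j * eps * (Y / 2)); last by field.
have j0 : 0 <= j by apply: le_trans j1.
by rewrite ler_wpM2l// mulr_ge0// mulr_ge0.
Qed.

(** Up to an arbitrarily small [d], the odd part of [F] at [s] is the kernel sum of the even part
    [B], so its size is governed by the oscillation of [B] around [s]. *)
Lemma conj_bound F (n j : nat) (eps M x0 s : R) (B := (fun x => F x + F (- x)) : R -> R[i]) :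
  outer F -> continuous (fun x => complex.Im (F x)) -> (0 < j < n)%N ->
  s = pi * j%:R / n%:R ->
  0 < x0 <= 1 -> s <= x0 / 2 -> 0 <= eps -> 0 <= M ->
  (forall x, 0 <= x <= x0 -> cabs (B x - B s) <= eps * Num.min (n%:R * `|x - s|) 1) ->
  (forall x, 0 <= x <= pi -> cabs (B x - B s) <= M) ->
  cabs (F s - F (- s)) <= 36 * eps * j%:R + s * M / (cos (x0 / 2) - cos x0).
Proof.
move=> oF cF jn sE x01 sx0 eps0 M0 near far.
apply/ler_addgt0Pr => d d0.
have pi0 := @pi_gt0 R.
have j1 : 1 <= j%:R :> R by rewrite ler1n; case/andP: jn.
have n0 : 0 < n%:R :> R by rewrite ltr0n; case/andP: jn => _; case: (n).
have ns : n%:R * s <= 4 * j%:R.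
  by rewrite sE mulrC divfK ?gt_eqF// ler_wpM2r ?pi_le4.
have s0 : 0 < s by rewrite sE; case/andP: (grid_in R jn).
set k0 := cos (x0 / 2) - cos x0.
have k00 : 0 <= k0.
  case/andP: x01 => x00 x01; have pi2 := @pi_ge2 R.
  by rewrite subr_ge0 cos_anti//; lra.
(* The approximation will cost at most [e * (73 + s * 2 / k0)]: [e] from the values at [s] and
   [- s], the rest from the kernel sum. *)
have [e e0 eE] : exists2 e, 0 < e & e * (145 + s * 4 / k0) = d.
  have h : 0 < 145 + s * 4 / k0 by rewrite ltr_wpDr// divr_ge0// mulr_ge0// ltW.
  by exists (d / (145 + s * 4 / k0)); [exact: divr_gt0|rewrite divfK// gt_eqF].
have [K0 hK] := outer_approx e0 cF oF.
(* Refining by a common factor keeps [s = pi j / n] on the grid [pi J / N], and makes [N] large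
   enough for the approximation of [F]. *)
pose m := K0.+1; pose N := (n * m)%N; pose J := (j * m)%N.
have N0 : (0 < N)%N by rewrite muln_gt0 andbT -(ltr0n R).
have JN : (0 < J < N)%N by rewrite muln_gt0 ltn_mul2r; case/andP: jn => -> ->.
have NR0 : 0 < N%:R :> R by rewrite ltr0n.
have sN : s = pi * J%:R / N%:R.
  have m0 : m%:R != 0 :> R by rewrite pnatr_eq0.
  by rewrite sE /J /N !natrM; field; rewrite m0 gt_eqF.
have KN : (K0 <= N.*2)%N.
  rewrite (leq_trans (leqnSn _))// (leq_trans (_ : _ <= N)%N) ?leq_pmull -?(ltr0n R)//.
  by rewrite -addnn leq_addr.
clearbody N J; have [l [kap hl]] := hK _ KN.
pose q x : R[i] := \sum_(k < N.*2) l k * expi x ^+ k.+1.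
pose er x : R[i] := F x - kap - q x.
have her x : cabs (er x) <= e / (2 * N%:R).
  rewrite ler_pdivlMr ?mulr_gt0// mulrC -natrM mul2n; exact: hl.
pose x_ := node R N.
pose ker i : R := sin s / N%:R / (cos (x_ i) - cos s).
pose EB x := er x + er (- x).
(* In [F = er + kap + q] the quadrature is exact on [q] and the constant [kap] cancels, so only [er]
   produces an error. *)
have decomp : F s - F (- s) = (er s - er (- s)) +
    ('i * (\sum_(i < N) (ker i)%:C * (B (x_ i) - B s)) -
     'i * (\sum_(i < N) (ker i)%:C * (EB (x_ i) - EB s))).
  have h := conj_quadrature (q := q) JN (leqnn N.*2) sN (fun=> erefl).
  rewrite -mulrBr -sumrB.
  have Fq x : F x = er x + kap + q x by rewrite /er addrAC !subrK.
  have -> : F s - F (- s) = er s - er (- s) + (q s - q (- s)).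
    by rewrite !Fq; move: (er _) (er _) (q _) (q _) => *; ring.
  congr (_ + _); rewrite h; congr (_ * _); apply: eq_bigr => i _.
  rewrite -mulrBr; congr (_ * _); rewrite /B /EB !Fq -/(x_ i).
  by move: (er _) (er _) (er _) (er _) (q _) (q _) (q _) (q _) => *; ring.
clearbody er q.
have x_in i : (i < N)%N -> 0 <= x_ i <= pi.
  by move=> /(node_in R)/andP[? ?]; rewrite !ltW.
have kerE i : `|ker i| = `|sin s / (cos (x_ i) - cos s)| / N%:R.
  by rewrite /ker mulrAC normrM [`|N%:R^-1|]gtr0_norm ?invr_gt0.
have main : \sum_(i < N) `|ker i| * cabs (B (x_ i) - B s) <= 36 * eps * j%:R + s * M / k0.
  under eq_bigr do rewrite kerE.
  apply: (@kernel_sum_le N J n%:R s x0 eps M (fun i => cabs (B (x_ i) - B s))) => //.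
    move=> i iN xx0; rewrite cabs_ge0 near//.
    by case/andP: (x_in _ iN) => ->.
  by move=> i iN; rewrite cabs_ge0 far// x_in.
(* No node is within [1 / N] of [s], so the error term too obeys the hypotheses
   of [kernel_sum_le], at the scale [N] instead of [n]. *)
have errb : \sum_(i < N) `|ker i| * cabs (EB (x_ i) - EB s) <=
    36 * (2 * e / N%:R) * J%:R + s * (2 * e / N%:R) / k0.
  under eq_bigr do rewrite kerE.
  have e2 : 0 <= 2 * e / N%:R by rewrite divr_ge0// mulr_ge0// ltW.
  have EBle i : cabs (EB (x_ i) - EB s) <= 2 * e / N%:R.
    apply: le_trans (cabsB _ _) _.
    have := cabsD (er (x_ i)) (er (- x_ i)); have := cabsD (er s) (er (- s)).
    have := her (x_ i); have := her (- x_ i); have := her s; have := her (- s).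
    have -> : 2 * e / N%:R = 4 * (e / (2 * N%:R)) by field; rewrite gt_eqF.
    rewrite /EB; clear; move: (e / _) => a; lra.
  apply: (@kernel_sum_le N J N%:R s x0 _ _ (fun i => cabs (EB (x_ i) - EB s))) => //.
  - by rewrite ler1n; case/andP: JN.
  - by rewrite sN mulrC divfK ?gt_eqF// ler_wpM2r ?pi_le4.
  - move=> i iN xx0; rewrite cabs_ge0/= min_r ?mulr1//.
    have := node_dist J i N0; rewrite -sN -/(x_ i) => h.
    by rewrite -[leLHS](mulfV (lt0r_neq0 NR0)) ler_wpM2l.
  - by move=> i iN; rewrite cabs_ge0 EBle.
have c1 : cabs (er s - er (- s)) <= e / N%:R.
  apply: le_trans (cabsB _ _) _; have := her s; have := her (- s).
  have -> : e / N%:R = 2 * (e / (2 * N%:R)) by field; rewrite gt_eqF.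
  by clear; move: (e / _) => a; lra.
have sumker (G : R -> R[i]) : cabs ('i * (\sum_(i < N) (ker i)%:C * (G (x_ i) - G s))) <=
    \sum_(i < N) `|ker i| * cabs (G (x_ i) - G s).
  rewrite cabsM cabs_i mul1r; apply: le_trans (cabs_sum _ _ _) _.
  by apply: ler_sum => i _; rewrite cabsM cabs_real.
have c2 := le_trans (sumker B) main; have c3 := le_trans (sumker EB) errb.
have c4 : e / N%:R + (36 * (2 * e / N%:R) * J%:R + s * (2 * e / N%:R) / k0) <= d.
  have iN : N%:R^-1 <= 1 :> R by rewrite invf_le1// ler1n.
  have iJ : J%:R / N%:R <= 1 :> R.
    by rewrite ler_pdivrMr// mul1r ler_nat; case/andP: JN => _ /ltnW.
  rewrite (_ : _ + _ = e * N%:R^-1 + 72 * e * (J%:R / N%:R) + e * (s * 2 / k0) * N%:R^-1); last by ring.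
  have sk : 0 <= s / k0 by rewrite divr_ge0// ltW.
  have h1 : e * N%:R^-1 <= e by rewrite ler_piMr// ltW.
  have h2 : 72 * e * (J%:R / N%:R) <= 72 * e by rewrite ler_piMr// mulr_ge0// ltW.
  have h3 : e * (s * 2 / k0) * N%:R^-1 <= e * (s * 2 / k0).
    by rewrite ler_piMr// mulr_ge0 ?(ltW e0)// divr_ge0// mulr_ge0// ltW.
  have h4 : 0 <= e * (s / k0) by rewrite mulr_ge0// ltW.
  rewrite -eE (_ : e * (145 + s * 4 / k0) = 145 * e + 2 * (e * (s * 2 / k0))); last by ring.
  have h5 : e * (s * 2 / k0) = 2 * (e * (s / k0)) by ring.
  by move: h1 h2 h3 h4 h5 e0; clear; lra.
rewrite decomp; apply: le_trans (cabsD _ _) _.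
apply: le_trans (lerD c1 (cabsB _ _)) _.
by move: c2 c3 c4; clear; lra.
Qed.

End ConjugateFunction.

(** * Weighted summability and limits of complex sequences *)

Section SummableSequences.
Variable R : realType.
Implicit Types (w : nat -> R) (u v : nat -> R[i]) (z S T : R[i]).

Definition bounded_sums w := exists W, forall n, \sum_(k < n) w k <= W.

Lemma bounded_sums_tail w e : (forall k, 0 <= w k) -> bounded_sums w -> 0 < e ->
  exists m, forall n, \sum_(k < n | (m <= k)%N) w k <= e.
Proof.
move=> w0 [W hW] e0.
pose E := [set \sum_(k < n) w k | n in [set: nat]].
have supE : has_sup E.
  split; first by exists (\sum_(k < 0) w k), 0%N.
  by exists W => _ [n _ <-].
have [_ [m _ <-] hm] := sup_adherent e0 supE.
exists m => n; have [mn|nm] := leqP m n; last first.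
  rewrite big_pred0 ?ltW// => k; apply/negbTE; rewrite -ltnNge.
  by rewrite (ltn_trans (ltn_ord k)).
have : \sum_(k < n) w k <= sup E by apply: sup_upper_bound => //; exists n.
rewrite (bigID (fun k : 'I_n => (m <= k)%N))/= => h.
have : \sum_(k < n | ~~ (m <= k)%N) w k = \sum_(k < m) w k.
  rewrite (big_ord_widen n (fun k => w k) mn); apply: eq_bigl => k.
  by rewrite -ltnNge.
by lra.
Qed.

(** Dominated convergence, uniform in [n]: below the cut [m] the sum is at most [W m h], and beyond
    it the tail of [w] is small. *)
Lemma bounded_sums_min w e : (forall k, 0 <= w k) -> bounded_sums w -> 0 < e ->
  exists2 h0, 0 < h0 & forall n h, 0 <= h <= h0 ->
    \sum_(k < n) w k * Num.min 1 (k.+1%:R * h) <= e.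
Proof.
move=> w0 bw e0; have [m hm] := bounded_sums_tail w0 bw (divr_gt0 e0 (ltr0Sn R 1)).
have [W hW] := bw; have W0 : 0 <= W by have := hW 0%N; rewrite big_ord0.
exists (e / 2 / ((W + 1) * (m%:R + 1))).
  by rewrite divr_gt0 ?divr_gt0// mulr_gt0// ltr_wpDl.
move=> n h /andP[h0 hh].
have mh : W * (m%:R * h) <= e / 2.
  move: hh; rewrite ler_pdivlMr ?mulr_gt0 ?ltr_wpDl// => hh; apply: le_trans hh.
  rewrite mulrA [leRHS]mulrC ler_wpM2r//.
  by rewrite ler_pM// ?lerDl.
apply: le_trans (_ : \sum_(k < n) (w k * (m%:R * h) + (if (m <= k)%N then w k else 0)) <= _).
  apply: ler_sum => k _; have [mk|km] := leqP m k.
    rewrite -[X in _ <= _ + X]mulr1 -mulrDr ler_wpM2l//.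
    by rewrite ge_min lerDr mulr_ge0.
  by rewrite addr0 ler_wpM2l// ge_min ler_wpM2r ?orbT// ler_nat.
rewrite big_split/= -mulr_suml -big_mkcond/=.
have := hm n; have : (\sum_(k < n) w k) * (m%:R * h) <= W * (m%:R * h).
  by rewrite ler_wpM2r ?mulr_ge0.
by lra.
Qed.

Definition clim u S :=
  forall e : R, 0 < e -> exists n0, forall n, (n0 <= n)%N -> cabs (u n - S) <= e.

Lemma clim_le u S z (b : R) n0 : clim u S ->
  (forall n, (n0 <= n)%N -> cabs (u n - z) <= b) -> cabs (S - z) <= b.
Proof.
move=> uS ub; apply/ler_addgt0Pr => e e0; have [n1 h1] := uS e e0.
have -> : S - z = (u (maxn n0 n1) - z) - (u (maxn n0 n1) - S) by ring.
apply: le_trans (cabsB _ _) _.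
by rewrite lerD ?ub ?h1 ?leq_maxl ?leq_maxr.
Qed.

Lemma climD u v S T : clim u S -> clim v T -> clim (fun n => u n + v n) (S + T).
Proof.
move=> uS vT e e0.
have [n1 h1] := uS _ (divr_gt0 e0 (ltr0Sn R 1)).
have [n2 h2] := vT _ (divr_gt0 e0 (ltr0Sn R 1)).
exists (maxn n1 n2) => n; rewrite geq_max => /andP[/h1 + /h2].
have -> : u n + v n - (S + T) = (u n - S) + (v n - T) by ring.
by have := cabsD (u n - S) (v n - T); lra.
Qed.

Lemma climZ u S z : clim u S -> clim (fun n => z * u n) (z * S).
Proof.
move=> uS e e0; have z1 : 0 < cabs z + 1 by rewrite ltr_wpDl ?cabs_ge0.
have [n1 h1] := uS _ (divr_gt0 e0 z1).
exists n1 => n /h1; rewrite ler_pdivlMr// -mulrBr cabsM mulrC => h.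
by apply: le_trans h; rewrite ler_wpM2r ?cabs_ge0// lerDl.
Qed.

Lemma climN u S : clim u S -> clim (fun n => - u n) (- S).
Proof. by move=> uS e /uS[n1 h]; exists n1 => n /h; rewrite -opprD cabsN. Qed.

Lemma clim_cst z : clim (fun=> z) z.
Proof. by move=> e e0; exists 0%N => n _; rewrite subrr cabs0 ltW. Qed.

Lemma clim_ext u v S n0 : (forall n, (n0 <= n)%N -> u n = v n) -> clim u S -> clim v S.
Proof.
move=> uv uS e /uS[n1 h]; exists (maxn n0 n1) => n; rewrite geq_max => /andP[n0n n1n].
by rewrite -uv// h.
Qed.

Lemma clim_unique u S T : clim u S -> clim u T -> S = T.
Proof.
move=> uS uT; apply/eqP; rewrite -subr_eq0 -cabs_eq0 eq_le cabs_ge0 andbT.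
apply/ler_addgt0Pr => e e0; rewrite add0r; have [n0 h] := uT e e0.
exact: clim_le uS h.
Qed.

Lemma clim_re (x : nat -> R) (l : R) : x @ \oo --> l -> clim (fun n => (x n)%:C) l%:C.
Proof.
move=> /cvgrPdist_le xl e /xl[n0 _ h]; exists n0 => n n0n.
by rewrite -rmorphB/= cabs_real distrC; exact: h.
Qed.

Lemma summable_clim u w : (forall k, cabs (u k) <= w k) -> bounded_sums w ->
  exists S, clim (fun n => \sum_(k < n) u k) S.
Proof.
move=> uw [W hW].
have rsum (x : nat -> R) : (forall k, `|x k| <= w k) -> exists l : R,
    (fun n => \sum_(k < n) x k) @ \oo --> l.
  move=> xw.
  have c : cvgn (series x).
    apply: normed_cvg; apply: nondecreasing_is_cvgn.
      by apply: nondecreasing_series => k _ _; exact: normr_ge0.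
    exists W => _ [n _ <-]; apply: le_trans (hW n).
    by rewrite /normed_series_of seriesEord/=; apply: ler_sum => k _; exact: xw.
  exists (limn (series x)).
  have -> : (fun n => \sum_(k < n) x k) = series x.
    by rewrite seriesEord.
  exact: c.
have [a ha] := rsum (fun k => complex.Re (u k)) (fun k => le_trans (Re_le_cabs _) (uw k)).
have [b hb] := rsum (fun k => complex.Im (u k)) (fun k => le_trans (Im_le_cabs _) (uw k)).
exists (a%:C + 'i * b%:C).
apply: (clim_ext (n0 := 0%N)) (climD (clim_re ha) (climZ 'i (clim_re hb))) => n _.
by apply: complex_ext; rewrite !(ReD, ImD, ReM, ImM, Re_sum, Im_sum)/=; ring.
Qed.

(** Each block of terms from [n] to [n'] is dominated by the tail of [w] beyond [m]; let [n'] tend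
    to infinity. *)
Lemma clim_uniform u w S e m : (forall k, (m <= k)%N -> cabs (u k) <= w k) ->
  clim (fun n => \sum_(k < n) u k) S ->
  (forall n, \sum_(k < n | (m <= k)%N) w k <= e) ->
  forall n, (m <= n)%N -> cabs (\sum_(k < n) u k - S) <= e.
Proof.
move=> uw uS hm n mn; rewrite cabsC; apply: (clim_le (n0 := n) uS) => n' nn'.
rewrite -(big_mkord xpredT) -(big_mkord xpredT u) (big_cat_nat _ nn')//=.
rewrite [X in cabs X]addrC addKr.
apply: le_trans (cabs_sum _ _ _) _; apply: le_trans (hm n').
rewrite -(big_mkord (fun k => (m <= k)%N)).
rewrite [leRHS](big_cat_nat _ nn')//= -[leLHS]add0r lerD//.
  by apply: sumr_ge0 => k mk; rewrite (le_trans _ (uw k mk))// cabs_ge0.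
rewrite [leLHS]big_nat_cond [leRHS]big_nat_cond.
rewrite [leRHS](eq_bigl (fun k => (n <= k < n')%N && true)).
  by apply: ler_sum => k /andP[/andP[nk _] _]; rewrite uw// (leq_trans mn).
move=> k; rewrite andbT; case: (leqP n k) => //= nk.
by rewrite (leq_trans mn nk) andbT.
Qed.

End SummableSequences.

(** * Divided differences of cosine sums *)

Section DividedDifferences.
Variable R : realType.
Implicit Types (x y s e : R) (A : nat -> R[i]) (k n : nat).

(** This is [sin (k y) / sin y], the Chebyshev polynomial [U_(k-1)] at [cos y]. As a sum it is
    defined also where [sin y = 0], and its bound and Lipschitz constant are visible. *)
Definition dirichlet k y : R := \sum_(m < k) cos ((k%:R - 1 - 2 * m%:R) * y).

Lemma sin_dirichlet k y : sin y * dirichlet k y = sin (k%:R * y).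
Proof.
apply: (mulfI (_ : 2 != 0 :> R)); first by rewrite pnatr_eq0.
rewrite mulrA mulr_sumr -(big_mkord xpredT (fun m => 2 * sin y * cos ((k%:R - 1 - 2 * m%:R) * y))).
rewrite (eq_bigr (fun m => - sin ((k%:R - 2 * m.+1%:R) * y) -
                           - sin ((k%:R - 2 * m%:R) * y))); last first.
  move=> m _; rewrite -[m.+1%:R]natr1.
  have -> : (k%:R - 2 * (m%:R + 1)) * y = (k%:R - 1 - 2 * m%:R) * y - y by ring.
  have -> : (k%:R - 2 * m%:R) * y = (k%:R - 1 - 2 * m%:R) * y + y by ring.
  by rewrite sinB sinD; ring.
rewrite telescope_sumr//.
have -> : (k%:R - 2 * k%:R) * y = - (k%:R * y) by ring.
by rewrite mulr0 subr0 sinN; ring.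
Qed.

Lemma dirichlet_bound k y : `|dirichlet k y| <= k%:R.
Proof.
apply: le_trans (ler_norm_sum _ _ _) _.
apply: le_trans (_ : \sum_(m < k) 1 <= _); last by rewrite sumr_const card_ord.
by apply: ler_sum => m _; rewrite ler_norml cos_geN1 cos_le1.
Qed.

Lemma dirichlet_lip k x y : `|dirichlet k x - dirichlet k y| <= k%:R ^+ 2 * `|x - y|.
Proof.
rewrite /dirichlet -sumrB; apply: le_trans (ler_norm_sum _ _ _) _.
apply: le_trans (_ : \sum_(m < k) k%:R * `|x - y| <= _); last first.
  by rewrite sumr_const card_ord -[leLHS]mulr_natl mulrA expr2.
apply: ler_sum => m _; apply: le_trans (cos_lip _ _) _.
rewrite -mulrBr normrM ler_wpM2r// ler_norml.
have : m.+1%:R <= k%:R :> R by rewrite ler_nat.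
have : 0 <= m%:R :> R by [].
by rewrite -natr1 => ? ?; apply/andP; split; lra.
Qed.

(** The quotient of [cos (k x) - cos (k s)] by [cos x - cos s], each difference being written as a
    product of two sines; at [x = s = 0] it equals [k^2]. *)
Definition cosdd k x s := dirichlet k ((x + s) / 2) * dirichlet k ((x - s) / 2).

Lemma cosddE k x s : cosdd k x s * (cos x - cos s) = cos (k%:R * x) - cos (k%:R * s).
Proof.
have aux u v : cos (u + v) - cos (u - v) = - 2 * (sin u * sin v) :> R.
  by rewrite cosB cosD; ring.
rewrite [in cos x](_ : x = (x + s) / 2 + (x - s) / 2); last by field.
rewrite [in cos s](_ : s = (x + s) / 2 - (x - s) / 2); last by field.
rewrite [in cos (_ * x)](_ : k%:R * x = k%:R * ((x + s) / 2) + k%:R * ((x - s) / 2)); last by field.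
rewrite [in cos (_ * s)](_ : k%:R * s = k%:R * ((x + s) / 2) - k%:R * ((x - s) / 2)); last by field.
by rewrite !aux -!sin_dirichlet /cosdd; ring.
Qed.

Lemma cosdd_bound k x s : `|cosdd k x s| <= k%:R ^+ 2.
Proof. by rewrite normrM expr2 ler_pM// dirichlet_bound. Qed.

Lemma cosdd_lip k x s x' s' :
  `|cosdd k x s - cosdd k x' s'| <= k%:R ^+ 3 * (`|x - x'| + `|s - s'|).
Proof.
rewrite /cosdd; set a := dirichlet k _; set b := dirichlet k _.
set a' := dirichlet k _; set b' := dirichlet k _.
have -> : a * b - a' * b' = a * (b - b') + (a - a') * b' by ring.
have ha : `|a - a'| <= k%:R ^+ 2 * ((`|x - x'| + `|s - s'|) / 2).
  apply: le_trans (dirichlet_lip _ _ _) _; rewrite ler_wpM2l ?sqr_ge0//.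
  rewrite -mulrBl normrM [`|2^-1|]ger0_norm// ler_wpM2r//.
  by rewrite (_ : _ - _ = (x - x') + (s - s')) ?ler_normD//; ring.
have hb : `|b - b'| <= k%:R ^+ 2 * ((`|x - x'| + `|s - s'|) / 2).
  apply: le_trans (dirichlet_lip _ _ _) _; rewrite ler_wpM2l ?sqr_ge0//.
  rewrite -mulrBl normrM [`|2^-1|]ger0_norm// ler_wpM2r//.
  by rewrite (_ : _ - _ = (x - x') - (s - s')) ?ler_normB//; ring.
apply: le_trans (ler_normD _ _) _; rewrite !normrM.
have h1 := ler_pM (normr_ge0 _) (normr_ge0 _) (dirichlet_bound k ((x + s) / 2)) hb.
have h2 := ler_pM (normr_ge0 _) (normr_ge0 _) ha (dirichlet_bound k ((x' - s') / 2)).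
apply: le_trans (lerD h1 h2) _.
by rewrite le_eqVlt; apply/orP; left; apply/eqP; field.
Qed.

Definition cosdd_sum A n x s : R[i] := \sum_(k < n) A k * (cosdd k x s)%:C.

(** The square majorizes both [cosdd k] and the second derivative of [cos (k x)], and its
    summability is what [2 <= alpha] provides. *)
Definition weight A k : R := cabs (A k) * k.+1%:R ^+ 2.

Lemma weight_ge0 A k : 0 <= weight A k.
Proof. by rewrite mulr_ge0 ?cabs_ge0. Qed.

Lemma cosdd_term_le A k x s : cabs (A k * (cosdd k x s)%:C) <= weight A k.
Proof.
rewrite cabsM cabs_real ler_wpM2l ?cabs_ge0//.
by rewrite (le_trans (cosdd_bound _ _ _))// lerXn2r ?nnegrE// ler_nat.
Qed.

(** Termwise minimum of the trivial bound [2 k^2] and the Lipschitz bound [k^3 h], in the form that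
    [bounded_sums_min] consumes. *)
Lemma cosdd_sumB A n x s x' s' :
  cabs (cosdd_sum A n x s - cosdd_sum A n x' s') <=
  2 * \sum_(k < n) weight A k * Num.min 1 (k.+1%:R * (`|x - x'| + `|s - s'|)).
Proof.
rewrite /cosdd_sum -sumrB; apply: le_trans (cabs_sum _ _ _) _; rewrite mulr_sumr.
apply: ler_sum => k _; rewrite -mulrBr -rmorphB/= cabsM cabs_real /weight.
rewrite (_ : 2 * _ = cabs (A k) * (2 * (k.+1%:R ^+ 2 *
  Num.min 1 (k.+1%:R * (`|x - x'| + `|s - s'|))))); last by ring.
rewrite ler_wpM2l ?cabs_ge0//.
have kk : k%:R ^+ 2 <= k.+1%:R ^+ 2 :> R by rewrite lerXn2r ?nnegrE// ler_nat.
have kkk : k%:R ^+ 3 <= k.+1%:R ^+ 3 :> R by rewrite lerXn2r ?nnegrE// ler_nat.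
set h := `|x - x'| + _; have h0 : 0 <= h by rewrite addr_ge0.
rewrite minEle; case: ifP => _.
  have := cosdd_bound k x s; have := cosdd_bound k x' s'.
  by have := ler_normB (cosdd k x s) (cosdd k x' s'); lra.
apply: le_trans (cosdd_lip _ _ _ _ _) _; rewrite -/h.
have -> : 2 * (k.+1%:R ^+ 2 * (k.+1%:R * h)) = 2 * (k.+1%:R ^+ 3 * h) by ring.
have : k%:R ^+ 3 * h <= k.+1%:R ^+ 3 * h by rewrite ler_wpM2r.
have : 0 <= k.+1%:R ^+ 3 * h by rewrite mulr_ge0 ?exprn_ge0.
by lra.
Qed.

Lemma cosdd_sum_equicont A e : bounded_sums (weight A) -> 0 < e ->
  exists2 h0, 0 < h0 & forall n x s x' s', `|x - x'| + `|s - s'| <= h0 ->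
    cabs (cosdd_sum A n x s - cosdd_sum A n x' s') <= e.
Proof.
move=> bA e0.
have [h0 h00 hh] := bounded_sums_min (weight_ge0 A) bA (divr_gt0 e0 (ltr0Sn R 1)).
exists h0 => // n x s x' s' h; apply: le_trans (cosdd_sumB _ _ _ _ _ _) _.
by have := hh n _ (introT andP (conj (addr_ge0 (normr_ge0 _) (normr_ge0 _)) h)); lra.
Qed.

(** A sum of [n] terms is smooth at scale [1/n]: for [k < n] the quantity [k.+1 D] equals [n D]
    times [k.+1 / n <= 1], so [n D] comes out as a factor and the remaining sum is that of
    [bounded_sums_min] at [h = 1/n]. *)
Lemma cosdd_sum_near A e : bounded_sums (weight A) -> 0 < e ->
  exists n0, exists2 h0, 0 < h0 & forall n x x' s, (n0 <= n)%N -> `|x - x'| <= h0 ->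
    cabs (cosdd_sum A n x s - cosdd_sum A n x' s) <= e * Num.min (n%:R * `|x - x'|) 1.
Proof.
move=> bA e0.
have [h0 h00 hh] := bounded_sums_min (weight_ge0 A) bA (divr_gt0 e0 (ltr0Sn R 1)).
have [n0 hn0] : exists n0 : nat, forall n, (n0 <= n)%N -> 0 < n%:R :> R /\ n%:R^-1 <= h0.
  exists (Num.bound h0^-1).+1 => n nn.
  have hn : h0^-1 <= n%:R.
    have /archi_boundP/ltW h : 0 <= h0^-1 by rewrite invr_ge0 ltW.
    by rewrite (le_trans h)// ler_nat ltnW.
  have n0 : 0 < n%:R :> R by rewrite (lt_le_trans _ hn)// invr_gt0.
  by rewrite n0 -[leRHS]invrK lef_pV2 ?posrE ?invr_gt0.
exists n0, h0 => // n x x' s /hn0[nR nh] h; have nV : 0 <= n%:R^-1 :> R by rewrite invr_ge0 ltW.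
apply: le_trans (cosdd_sumB _ _ _ _ _ _) _; rewrite subrr normr0 addr0.
set D := `|x - x'| in h *; have D0 : 0 <= D by apply: normr_ge0.
rewrite minEle; case: ifP => _; last first.
  by have := hh n D; rewrite D0 h => /(_ isT); lra.
have := hh n n%:R^-1; rewrite nV nh => /(_ isT) hs.
apply: le_trans (_ : 2 * (n%:R * D * \sum_(k < n) weight A k * Num.min 1 (k.+1%:R * n%:R^-1)) <= _).
  rewrite ler_wpM2l// mulr_sumr; apply: ler_sum => k _.
  rewrite mulrCA ler_wpM2l ?weight_ge0//.
  rewrite [X in n%:R * D * X]min_r; last by rewrite ler_pdivrMr// mul1r ler_nat.
  rewrite (_ : n%:R * D * _ = k.+1%:R * D); last by field; rewrite gt_eqF.
  by rewrite ge_min lexx orbT.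
have : n%:R * D * \sum_(k < n) weight A k * Num.min 1 (k.+1%:R * n%:R^-1) <= n%:R * D * (e / 2).
  by rewrite ler_wpM2l// mulr_ge0// ltW.
by lra.
Qed.

(** The limit at [s = 0] is continuous and nonzero on the compact [[0, pi]], so its modulus has a
    positive minimum. Truncation and the passage to small [s] each cost a quarter of it. *)
Lemma cosdd_sum_nondegenerate A : bounded_sums (weight A) ->
  (forall x, 0 <= x <= pi -> ~ clim (fun n => cosdd_sum A n x 0) 0) ->
  exists2 mu, 0 < mu & exists n0, exists2 h0, 0 < h0 & forall n x s, (n0 <= n)%N ->
    0 <= x <= pi -> 0 <= s <= h0 -> mu <= cabs (cosdd_sum A n x s).
Proof.
move=> bA nd.
have ex x := summable_clim (fun k => cosdd_term_le A k x 0) bA.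
pose L x := projT1 (cid (ex x)).
have hL x : clim (fun n => cosdd_sum A n x 0) (L x) := projT2 (cid (ex x)).
have Lcont : continuous (fun x => cabs (L x)).
  move=> x; apply/cvgrPdist_le => e e0.
  have [h0 h00 hh] := cosdd_sum_equicont bA e0.
  near=> y.
  have Lxy : cabs (L x - L y) <= e.
    have := climD (hL x) (climN (hL y)) => /clim_le h.
    rewrite -[L x - L y]subr0; apply: (h _ _ 0%N) => n _.
    rewrite subr0; apply: hh; rewrite subrr normr0 addr0.
    by near: y; apply: filterS (nbhsx_ballx x h0 h00) => y; rewrite /ball/= => /ltW.
  exact: le_trans (cabs_dist _ _) Lxy.
have [c cp cmin] := EVT_min (@pi_ge0 R) (continuous_subspaceT Lcont).
rewrite in_itv/= in cp.
set mu := cabs (L c).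
have mu0 : 0 < mu.
  rewrite cabs_gt0; apply/negP => /eqP Lc; apply: (nd c cp).
  by rewrite -Lc; exact: hL.
have mu4 : 0 < mu / 4 by rewrite divr_gt0.
have [h0 h00 hh] := cosdd_sum_equicont bA mu4.
have [m hm] := bounded_sums_tail (weight_ge0 A) bA mu4.
exists (mu / 2); first by rewrite divr_gt0.
exists m, h0 => // n x s mn xp /andP[s0 sh].
have h1 := clim_uniform (fun k _ => cosdd_term_le A k x 0) (hL x) hm mn.
have h2 : cabs (cosdd_sum A n x s - cosdd_sum A n x 0) <= mu / 4.
  by apply: hh; rewrite subrr normr0 add0r subr0 ger0_norm.
have h3 : mu <= cabs (L x) by apply: cmin; rewrite in_itv.
rewrite -/(cosdd_sum A n x 0) in h1.
have -> : cosdd_sum A n x s = L x + ((cosdd_sum A n x 0 - L x) +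
   (cosdd_sum A n x s - cosdd_sum A n x 0)) by ring.
have := cabsB (L x + ((cosdd_sum A n x 0 - L x) +
   (cosdd_sum A n x s - cosdd_sum A n x 0))) ((cosdd_sum A n x 0 - L x) +
   (cosdd_sum A n x s - cosdd_sum A n x 0)); rewrite addrK.
have := cabsD (cosdd_sum A n x 0 - L x) (cosdd_sum A n x s - cosdd_sum A n x 0).
by lra.
Unshelve. all: by end_near. Qed.

End DividedDifferences.

(** * Bound on the odd part of a logarithm *)

Section PhaseBound.
Variable R : realType.
Implicit Types (x y s e mu : R) (A : nat -> R[i]) (k n : nat) (B P : R -> R[i]).

(** The constant [kappa] cancels in [cexp (B u - B x) = P u / P x], which is within
    [cabs (P u - P x) / mu] of 1. *)
Lemma log_ratio_path B P (kappa : R[i]) mu x y : 0 < mu -> kappa != 0 ->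
  continuous (fun u => complex.Im (B u)) ->
  (forall u, 0 <= u <= pi -> cexp (B u) = kappa * P u) ->
  (forall u, 0 <= u <= pi -> mu <= cabs (P u)) ->
  0 <= x <= pi -> 0 <= y <= pi ->
  (forall u, Num.min x y <= u <= Num.max x y -> cabs (P u - P x) <= mu / 4) ->
  cabs (B y - B x) <= 4 * cabs (P y - P x) / mu.
Proof.
move=> mu0 k0 cB BP Pmu xp yp hP.
have up u : Num.min x y <= u <= Num.max x y -> 0 <= u <= pi.
  case/andP: xp => x0 x1; case/andP: yp => y0 y1 /andP[+ +].
  rewrite ge_min le_max => /orP[h1|h1] /orP[h2|h2]; apply/andP; split; lra.
have key u : 0 <= u <= pi -> cabs (cexp (B u - B x) - 1) <= cabs (P u - P x) / mu.
  move=> u0; have Px0 : P x != 0 by rewrite -cabs_gt0 (lt_le_trans mu0)// Pmu.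
  rewrite cexpB !BP// -mulf_div divff// mul1r.
  have -> : P u / P x - 1 = (P u - P x) / P x by rewrite mulrBl divff.
  rewrite cabsM cabsV ler_wpM2l ?cabs_ge0// lef_pV2 ?posrE ?Pmu//.
  by rewrite cabs_gt0.
apply: le_trans (log_path cB _) _ => [u uxy|].
  apply: le_trans (key u (up u uxy)) _; rewrite ler_pdivrMr//.
  by rewrite (le_trans (hP u uxy))// mulrC mul1r.
by rewrite -mulrA ler_wpM2l// key.
Qed.

(** Bounds on the exponential say nothing about the winding of the logarithm over a long interval;
    subdividing the interval into short steps bounds it by the number of steps. *)
Lemma unit_steps B (h : R) : 0 < h ->
  (forall x y, 0 <= x <= pi -> 0 <= y <= pi -> `|x - y| <= h -> cabs (B x - B y) <= 1) ->
  forall k x y, 0 <= x <= pi -> 0 <= y <= pi -> `|x - y| <= k%:R * h ->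
    cabs (B x - B y) <= k%:R.
Proof.
move=> h0 step; elim=> [|k IH] x y xp yp.
  rewrite mul0r normr_le0 subr_eq0 => /eqP ->.
  by rewrite subrr cabs0.
have k1 : 0 < k.+1%:R :> R by [].
have k0 : 0 <= k%:R :> R by [].
move=> xy; pose z := y + (x - y) * (k%:R / k.+1%:R).
have zx : z - y = (x - y) * (k%:R / k.+1%:R) by rewrite /z; ring.
have xz : x - z = (x - y) / k.+1%:R.
  by rewrite /z -[in k.+1%:R]natr1; field; rewrite natr1.
have zp : 0 <= z <= pi.
  have -> : z = x * (k%:R / k.+1%:R) + y / k.+1%:R.
    by rewrite /z -[in k.+1%:R]natr1; field; rewrite natr1.
  case/andP: xp => x0 x1; case/andP: yp => y0 y1; apply/andP; split.
    by rewrite addr_ge0 ?mulr_ge0 ?divr_ge0.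
  have -> : pi = pi * (k%:R / k.+1%:R) + pi / k.+1%:R :> R.
    by rewrite -mulrDr -[X in _ + X]mul1r -mulrDl natr1 divff ?mulr1// gt_eqF.
  by rewrite lerD// ler_wpM2r// ?divr_ge0 ?invr_ge0.
have -> : B x - B y = (B x - B z) + (B z - B y) by ring.
apply: le_trans (cabsD _ _) _; rewrite -natr1 [_ + 1]addrC lerD//.
  by apply: step => //; rewrite xz normrM normfV [`|k.+1%:R|]gtr0_norm// ler_pdivrMr// mulrC.
apply: IH => //; rewrite zx normrM [`|k%:R / _|]ger0_norm ?divr_ge0//.
by rewrite mulrCA ler_wpM2l// ler_pdivrMr// mulrC.
Qed.

(** The thresholds [n0] and [s0] depend only on [A] and [e], not on [F], which changes with both [n]
    and [s] in the application. *)
Lemma phase_bound A e : bounded_sums (weight A) ->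
  (forall x, 0 <= x <= pi -> ~ clim (fun n => cosdd_sum A n x 0) 0) -> 0 < e ->
  exists n0, exists2 s0, 0 < s0 & forall n j F (kappa : R[i]) s,
    (n0 <= n)%N -> (0 < j <= n)%N -> s = pi * j%:R / n.+1%:R -> s <= s0 ->
    outer F -> continuous (fun x => complex.Im (F x)) -> kappa != 0 ->
    (forall x, 0 <= x <= pi -> cexp (F x + F (- x)) = kappa * cosdd_sum A n x s) ->
    cabs (F s - F (- s)) <= e * j%:R.
Proof.
move=> bA nd e0.
have [mu mu0 [n1 [h1 h10 hmu]]] := cosdd_sum_nondegenerate bA nd.
have mu4 : 0 < mu / 4 by rewrite divr_gt0.
have [h2 h20 hh2] := cosdd_sum_equicont bA mu4.
(* As [pi <= 4], [M] steps of length [h2] cross [[0, pi]]. *)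
have [M hM] : exists M : nat, 4 <= M%:R * h2.
  exists (Num.bound (4 / h2)); rewrite -ler_pdivrMr//.
  by apply/ltW/archi_boundP; rewrite divr_ge0// ltW.
(* The first bound meets the hypothesis of [log_ratio_path]; the second makes [36 * (4 * e1 / mu)]
   at most [e / 2]. *)
pose e1 := Num.min (mu / 4) (e * mu / 288).
have e10 : 0 < e1 by rewrite lt_min mu4 divr_gt0// mulr_gt0.
have e1mu : e1 <= mu / 4 by rewrite ge_min lexx.
have e1e : 36 * (4 * e1 / mu) <= e / 2.
  have : e1 <= e * mu / 288 by rewrite ge_min lexx orbT.
  rewrite mulrA ler_pdivrMr//; lra.
have [n2 [h3 h30 hh3]] := cosdd_sum_near bA e10.
pose x0 := Num.min h3 1.
have x00 : 0 < x0 by rewrite lt_min h30 ltr01.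
have x01 : x0 <= 1 by rewrite ge_min lexx orbT.
have x0h : x0 <= h3 by rewrite ge_min lexx.
have k00 : 0 < cos (x0 / 2) - cos x0.
  have pi2 := @pi_ge2 R.
  by rewrite subr_gt0 ltr_cos ?in_itv/=; [lra|apply/andP; split; lra|apply/andP; split; lra].
(* The last entry makes the far part of the kernel sum at most [e / 2]. *)
pose s0 := Num.min h1 (Num.min (x0 / 2) (e / 2 * (cos (x0 / 2) - cos x0) / (M%:R + 1))).
have M1 : 0 < M%:R + 1 :> R by rewrite ltr_wpDl.
exists (maxn n1 n2), s0.
  rewrite !lt_min h10 !divr_gt0//= ?mulr_gt0// ?divr_gt0//.
move=> n j F kappa s; rewrite geq_max => /andP[n1n n2n] jn sE.
rewrite !le_min => /and3P[sh1 sx0 sM] oF cF kap0 FP.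
have s00 : 0 <= s by rewrite sE divr_ge0// mulr_ge0// pi_ge0.
pose B := (fun x => F x + F (- x)) : R -> R[i].
pose P := fun x => cosdd_sum A n x s.
have cB : continuous (fun u => complex.Im (B u)).
  have -> : (fun u => complex.Im (B u)) = (fun u => complex.Im (F u) + complex.Im (F (- u))).
    by apply/funext => u; rewrite /B ImD.
  move=> u; apply: cvgD; first exact: cF.
  apply: (@continuous_comp _ _ _ (fun u : R => - u) (fun x => complex.Im (F x))).
    exact: opp_continuous.
  exact: cF.
have Pmu u : 0 <= u <= pi -> mu <= cabs (P u).
  by move=> up; apply: hmu => //; rewrite s00.
have path := log_ratio_path (B := B) (P := P) mu0 kap0 cB FP Pmu.
have far x y : 0 <= x <= pi -> 0 <= y <= pi -> cabs (B x - B y) <= M%:R.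
  move=> xp yp; apply: (unit_steps h20) => //; last first.
    apply: le_trans hM; apply: le_trans (pi_le4 R).
    case/andP: xp => x0' x1; case/andP: yp => y0 y1.
    by rewrite ler_norml; apply/andP; split; lra.
  move=> {xp yp} {}x {}y xp yp xy.
  apply: le_trans (path y x yp xp _) _.
    move=> u uyx; apply: hh2; rewrite subrr normr0 addr0.
    apply: le_trans xy; move: uyx => /andP[].
    case: (leP y x) => yx h h'.
      by rewrite !ger0_norm ?subr_ge0// lerB.
    by rewrite !ler0_norm ?subr_le0// ?(ltW yx)// lerN2 lerB.
  rewrite ler_pdivrMr// mul1r.
  have : cabs (P x - P y) <= mu / 4 by apply: hh2; rewrite subrr normr0 addr0.
  by lra.
have pi2 := @pi_ge2 R.
have sp : 0 <= s <= pi by apply/andP; split; lra.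
apply: le_trans (@conj_bound R F n.+1 j (4 * e1 / mu) M%:R x0 s oF cF _ sE _ sx0 _ _ _ _) _.
- by rewrite ltnS.
- by rewrite x00.
- by rewrite divr_ge0 ?mulr_ge0// ltW.
- by [].
- move=> x /andP[xge xx0].
  have xp : 0 <= x <= pi by apply/andP; split; lra.
  have near u : 0 <= u <= x0 -> cabs (P u - P s) <= e1 * Num.min (n%:R * `|u - s|) 1.
    move=> /andP[u0 u1]; apply: hh3 => //.
    by apply: le_trans x0h; rewrite ler_norml; apply/andP; split; lra.
  apply: le_trans (path s x sp xp _) _.
    move=> u uxs; apply: le_trans e1mu; apply: le_trans (near u _) _.
      move: uxs => /andP[+ +]; rewrite ge_min le_max.
      move=> /orP[h|h] /orP[h'|h']; apply/andP; split; lra.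
    by rewrite ler_piMr ?(ltW e10)// ge_min lexx orbT.
  rewrite -[_ / mu * _]mulrAC ler_wpM2r ?invr_ge0 ?(ltW mu0)// -mulrA ler_wpM2l//.
  apply: le_trans (near x _) _; first by rewrite xge.
  (* The sum has [n] terms but the grid has step [pi / n.+1]; [n <= n.+1] reconciles the two
     scales. *)
  rewrite ler_wpM2l ?(ltW e10)// le_min !ge_min lexx orbT andbT ler_wpM2r//.
  by rewrite ler_nat.
- by move=> x xp; exact: far.
have j1 : 1 <= j%:R :> R by rewrite ler1n; case/andP: jn.
have h4 : s * M%:R / (cos (x0 / 2) - cos x0) <= e / 2.
  rewrite ler_pdivrMr//; move: sM; rewrite ler_pdivlMr// => /(le_trans _); apply.
  by rewrite ler_wpM2l// lerDl.
have h5 : 36 * (4 * e1 / mu) * j%:R <= e / 2 * j%:R by rewrite ler_wpM2r.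
have h6 : e / 2 <= e / 2 * j%:R by rewrite ler_peMr// divr_ge0// ltW.
by move: h4 h5 h6; clear; lra.
Qed.

End PhaseBound.

(** * Integrals of cosines and the Fejer kernel *)

Section CosineSeries.
Variable R : realType.
Implicit Types (f g u : R -> R) (c e x y : R) (k m n : nat).

Definition cint f : R := \int[lebesgue_measure]_(x in `[0, 2 * pi]) f x.

Lemma continuous_integrable f : continuous f ->
  (@lebesgue_measure R).-integrable `[0, 2 * pi] (EFin \o f).
Proof.
move=> cf; apply: continuous_compact_integrable; first exact: segment_compact.
exact: continuous_subspaceT.
Qed.

Lemma cintD f g : continuous f -> continuous g ->
  cint (fun x => f x + g x) = cint f + cint g.
Proof. by move=> cf cg; apply: RintegralD => //; exact: continuous_integrable. Qed.

Lemma cintB f g : continuous f -> continuous g ->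
  cint (fun x => f x - g x) = cint f - cint g.
Proof. by move=> cf cg; apply: RintegralB => //; exact: continuous_integrable. Qed.

Lemma cintZ c f : continuous f -> cint (fun x => c * f x) = c * cint f.
Proof. by move=> cf; apply: RintegralZl => //; exact: continuous_integrable. Qed.

Lemma eq_cint f g : (forall x, f x = g x) -> cint f = cint g.
Proof. by move=> fg; apply: eq_Rintegral => x _. Qed.

Lemma cint_le f g : continuous f -> continuous g ->
  (forall x, 0 <= x <= 2 * pi -> f x <= g x) -> cint f <= cint g.
Proof.
by move=> cf cg fg; apply: le_Rintegral => //; exact: continuous_integrable.
Qed.

Lemma cint_cst c : cint (fun=> c) = 2 * pi * c.
Proof.
rewrite /cint Rintegral_cst//= lebesgue_measure_itv/= lte_fin mulr_gt0 ?pi_gt0//.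
by rewrite -EFinB/= subr0 mulrC.
Qed.

Lemma continuous_sum n (f : nat -> R -> R) :
  (forall k, continuous (f k)) -> continuous (fun x => \sum_(k < n) f k x).
Proof.
move=> cf; elim: n => [|n IH].
  rewrite (_ : (fun x => _) = cst 0); first exact: cst_continuous.
  by apply/funext => x; rewrite big_ord0.
rewrite (_ : (fun x => _) = (fun x => \sum_(k < n) f k x + f n x)); last first.
  by apply/funext => x; rewrite big_ord_recr.
by move=> x; apply: cvgD; [exact: IH|exact: cf].
Qed.

Lemma cint_sum n (f : nat -> R -> R) : (forall k, continuous (f k)) ->
  cint (fun x => \sum_(k < n) f k x) = \sum_(k < n) cint (f k).
Proof.
move=> cf; elim: n => [|n IH].
  rewrite big_ord0 -[RHS](mulr0 (2 * pi)) -cint_cst.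
  by apply: eq_cint => x; rewrite big_ord0.
rewrite big_ord_recr/= -IH -cintD//; last exact: continuous_sum.
by apply: eq_cint => x; rewrite big_ord_recr.
Qed.

Lemma continuous_cosZ c : continuous (fun x => cos (c * x)).
Proof.
move=> x; apply: (@continuous_comp _ _ _ (fun x : R => c * x) (@cos R)).
  exact: mulrl_continuous.
exact: continuous_cos.
Qed.

Lemma cint_cos k : (0 < k)%N -> cint (fun x => cos (k%:R * x)) = 0.
Proof.
move=> k0; have kR : k%:R != 0 :> R by rewrite pnatr_eq0 -lt0n.
pose G x := sin (k%:R * x) / k%:R.
have dG x : is_derive x 1 G (cos (k%:R * x)).
  have d1 : is_derive x 1 (fun x : R => k%:R * x) k%:R.
    have := is_deriveM (is_derive_cst (k%:R : R) x 1) (is_derive_id x 1).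
    by move=> /is_derive_eq; apply; rewrite scaler0 addr0 /GRing.scale/= mulr1.
  have := is_derive1_comp (is_derive_sin (k%:R * x)) d1 => d2.
  have := is_deriveM d2 (is_derive_cst ((k%:R)^-1 : R) x 1).
  by move=> /is_derive_eq; apply; rewrite scaler0 add0r /GRing.scale/= mulrCA mulVf ?mulr1.
rewrite /cint /Rintegral (@continuous_FTC2 _ _ G).
- have -> : G 0 = 0 by rewrite /G mulr0 sin0 mul0r.
  have -> : G (2 * pi) = 0 by rewrite /G mulrA -(natrM _ k 2) sin_nat_pi mul0r.
  by rewrite -EFinB subrr.
- by rewrite mulr_gt0 ?pi_gt0.
- by apply: continuous_subspaceT; exact: continuous_cosZ.
- have cG : continuous G.
    by move=> x; apply: differentiable_continuous; apply/derivable1_diffP; have [] := dG x.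
  split; first by move=> x _; have [] := dG x.
    by apply: cvg_at_right_filter; exact: cG.
  by apply: cvg_at_left_filter; exact: cG.
- by move=> x _; rewrite derive1E; have [] := dG x.
Qed.

Lemma cint_reflect f : continuous f -> cint (fun x => f (2 * pi - x)) = cint f.
Proof.
move=> cf; pose r (x : R) := 2 * pi - x.
have dr x : is_derive x 1 r (- 1).
  have := is_deriveB (is_derive_cst (2 * pi : R) x 1) (is_derive_id x 1).
  by move=> /is_derive_eq; apply; rewrite sub0r.
have r1 : derive1 r = cst (-1).
  by apply/funext => x; rewrite derive1E; have [] := dr x.
have cr : continuous r.
  by move=> x; apply: differentiable_continuous; apply/derivable1_diffP; have [] := dr x.
have := @integration_by_substitution_decreasing R r f 0 (2 * pi).
have -> : r 0 = 2 * pi by rewrite /r subr0.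
have -> : r (2 * pi) = 0 by rewrite /r subrr.
move=> H.
rewrite /cint /Rintegral; congr fine; rewrite H.
- apply: eq_integral => x _; rewrite r1 /=; congr EFin.
  by rewrite !fctE/= opprK mulr1.
- by rewrite mulr_ge0 ?pi_ge0.
- by move=> x y _ _; rewrite /r ltrD2l ltrN2.
- by rewrite r1 => x _; exact: cvg_cst.
- by rewrite r1; exact: is_cvg_cst.
- by rewrite r1; exact: is_cvg_cst.
- split; first by move=> x _; have [] := dr x.
    by apply: cvg_at_right_filter; exact: cr.
  by apply: cvg_at_left_filter; exact: cr.
- by apply: continuous_subspaceT.
Qed.

(** The Fejer kernel without its factor [1/m]: subtracting [m] corrects the doubled term [k = 0]. *)
Definition fejer m (t : R) : R := 2 * (\sum_(k < m) (m%:R - k%:R) * cos (k%:R * t)) - m%:R.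

Lemma fejer_square m t :
  fejer m t = (\sum_(k < m) cos (k%:R * t)) ^+ 2 + (\sum_(k < m) sin (k%:R * t)) ^+ 2.
Proof.
elim: m => [|m IH]; first by rewrite /fejer !big_ord0; ring.
have -> : fejer m.+1 t = fejer m t + (2 * (\sum_(k < m.+1) cos (k%:R * t)) - 1).
  rewrite /fejer (eq_bigr (fun k : 'I_m.+1 => (m%:R - k%:R) * cos (k%:R * t) + cos (k%:R * t))).
    by rewrite big_split/= big_ord_recr/= subrr mul0r addr0 -natr1; ring.
  by move=> k _; rewrite -natr1; ring.
rewrite IH ![\sum_(k < m.+1) sin _]big_ord_recr ![in RHS]big_ord_recr/= !sqrrD.
have h : \sum_(k < m.+1) cos (k%:R * t) - 1 = \sum_(k < m) cos ((m%:R - k%:R) * t).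
  rewrite big_ord_recl mul0r cos0 addrC addKr.
  rewrite (reindex_inj rev_ord_inj)/=; apply: eq_bigr => k _.
  by rewrite /bump add1n subnSK// natrB// ltnW.
have h2 : \sum_(k < m) cos ((m%:R - k%:R) * t) =
    (\sum_(k < m) cos (k%:R * t)) * cos (m%:R * t) + (\sum_(k < m) sin (k%:R * t)) * sin (m%:R * t).
  rewrite !mulr_suml -big_split/=; apply: eq_bigr => k _.
  by rewrite mulrBl cosB; ring.
have cs : cos (m%:R * t) ^+ 2 = 1 - sin (m%:R * t) ^+ 2 by rewrite cos2sin2.
have -> : 2 * \sum_(k < m.+1) cos (k%:R * t) - 1 = 2 * (\sum_(k < m.+1) cos (k%:R * t) - 1) + 1 by ring.
by rewrite h h2 cs !mulr2n; ring.
Qed.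

(** The mean of the Fejer kernels at [y - x] and [y + x]. It is even in [x] and acts on even
    functions as the Fejer kernel does, with cosines only. *)
Definition cfejer m y x : R :=
  2 * (\sum_(k < m) (m%:R - k%:R) * cos (k%:R * y) * cos (k%:R * x)) - m%:R.

Lemma cfejer_ge0 m y x : 0 <= cfejer m y x.
Proof.
have -> : cfejer m y x = (fejer m (y - x) + fejer m (y + x)) / 2.
  apply: (mulIf (_ : 2 != 0 :> R)); first by rewrite pnatr_eq0.
  rewrite divfK ?pnatr_eq0// /cfejer /fejer mulrBl.
  have -> : 2 * (\sum_(k < m) (m%:R - k%:R) * cos (k%:R * y) * cos (k%:R * x)) * 2 =
     2 * (\sum_(k < m) (m%:R - k%:R) * cos (k%:R * (y - x))) +
     2 * (\sum_(k < m) (m%:R - k%:R) * cos (k%:R * (y + x))).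
    rewrite -mulrDr -big_split/= -mulrA; congr (_ * _); rewrite mulr_suml.
    by apply: eq_bigr => k _; rewrite (mulrBr k%:R) (mulrDr k%:R y) cosB cosD; ring.
  by ring.
by rewrite divr_ge0// addr_ge0// fejer_square addr_ge0 ?sqr_ge0.
Qed.

Lemma continuous_cfejer m y : continuous (cfejer m y).
Proof.
move=> x; apply: cvgB; last exact: cvg_cst.
apply: cvgM; first exact: cvg_cst.
apply: (@continuous_sum m (fun k x => (m%:R - k%:R) * cos (k%:R * y) * cos (k%:R * x))) => k {}x.
by apply: cvgM; [exact: cvg_cst|exact: continuous_cosZ].
Qed.

Lemma cint_cfejer u m y : continuous u -> cint (fun x => u x * cfejer m y x) =
  2 * (\sum_(k < m) (m%:R - k%:R) * cos (k%:R * y) * cint (fun x => u x * cos (k%:R * x)))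
  - m%:R * cint u.
Proof.
move=> cu.
have cuk k : continuous (fun x => u x * cos (k%:R * x)).
  by move=> x; apply: cvgM; [exact: cu|exact: continuous_cosZ].
pose v k x := (m%:R - k%:R) * cos (k%:R * y) * (u x * cos (k%:R * x)).
have cv k : continuous (v k) by move=> x; apply: cvgM; [exact: cvg_cst|exact: cuk].
rewrite (_ : \sum_(k < m) _ = \sum_(k < m) cint (v k)); last first.
  by apply: eq_bigr => k _; rewrite [RHS]cintZ.
rewrite -cint_sum// -!cintZ// -?cintB//; last exact: continuous_sum.
- by apply: eq_cint => x; rewrite /cfejer mulrBr mulrCA [u x * m%:R]mulrC;
    congr (2 * _ - _); rewrite mulr_sumr; apply: eq_bigr => k _; rewrite /v; ring.
- by move=> x; apply: cvgM; [exact: cvg_cst|exact: continuous_sum].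
- by move=> x; apply: cvgM; [exact: cvg_cst|exact: cu].
Qed.

Lemma cint_coscos j k : cint (fun x => cos (j%:R * x) * cos (k%:R * x)) =
  pi * (((j == k)%:R) + ((j + k == 0)%N)%:R).
Proof.
wlog jk : j k / (j <= k)%N => [hw|].
  have [/hw//|/ltnW/hw] := leqP j k; rewrite addnC eq_sym => <-.
  by apply: eq_cint => x; rewrite mulrC.
have cintc l : cint (fun x => cos (l%:R * x)) = 2 * pi * (l == 0)%:R.
  case: l => [|l]; last by rewrite cint_cos ?mulr0.
  by rewrite -cint_cst; apply: eq_cint => x; rewrite mul0r cos0.
have -> : cint (fun x => cos (j%:R * x) * cos (k%:R * x)) =
   2^-1 * (cint (fun x => cos ((k - j)%:R * x)) + cint (fun x => cos ((j + k)%:R * x))).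
  have c1 := @continuous_cosZ (k - j)%:R; have c2 := @continuous_cosZ (j + k)%:R.
  rewrite -(cintD c1 c2) -cintZ; last by move=> x; apply: cvgD; [exact: c1|exact: c2].
  apply: eq_cint => x; rewrite natrD natrB// mulrBl mulrDl cosB cosD.
  by field.
rewrite !cintc subn_eq0 [(k <= j)%N](_ : _ = (j == k)); last by rewrite eqn_leq jk.
by field.
Qed.

End CosineSeries.

(** * Pointwise convergence of a cosine series *)

Section CosineSeriesConvergence.
Variable R : realType.
Implicit Types (u : R -> R) (c e x y : R) (k m n : nat).

Lemma cint_cos_cfejer j m y : (j < m)%N ->
  cint (fun x => cos (j%:R * x) * cfejer m y x) = 2 * pi * (m%:R - j%:R) * cos (j%:R * y).
Proof.
move=> jm; rewrite cint_cfejer; last exact: continuous_cosZ.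
under eq_bigr do rewrite cint_coscos.
rewrite (bigD1 (Ordinal jm))//= big1 ?addr0 => [|k kj]; last first.
  have jk : (j == k :> nat) = false by apply/negbTE; rewrite eq_sym.
  have -> : (j + k == 0)%N = false.
    by case: j jm jk kj => //; case: (nat_of_ord k).
  by rewrite jk addr0 mulr0 mulr0.
rewrite eqxx; case: j jm => [_|j jm].
  rewrite (_ : cint _ = 2 * pi); last first.
    by rewrite -[RHS]mulr1 -cint_cst; apply: eq_cint => x; rewrite mul0r cos0.
  rewrite /= !mul0r cos0. by ring.
by rewrite cint_cos//= mulr0 subr0; ring.
Qed.

Lemma cos_double x : cos (2 * x) = 2 * cos x ^+ 2 - 1.
Proof.
have -> : 2 * x = x + x by ring.
by rewrite cosD -!expr2 sin2cos2; ring.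
Qed.

(** The Korovkin test function: all terms in [m] cancel, whereas the mass of the kernel is [2 pi m],
    so the normalized kernel concentrates at [cos x = cos y]. *)
Lemma cint_sqdist_cfejer m y : (2 < m)%N ->
  cint (fun x => (cos x - cos y) ^+ 2 * cfejer m y x) = 2 * pi.
Proof.
move=> m2; have cF := @continuous_cfejer R m y.
pose t j x := cos (j%:R * x) * cfejer m y x.
have ct j c : continuous (fun x => c * t j x).
  move=> x; apply: cvgM; first exact: cvg_cst.
  by apply: cvgM; [exact: continuous_cosZ|exact: cF].
have ct1 j : continuous (t j).
  by move=> x; apply: cvgM; [exact: continuous_cosZ|exact: cF].
have c1 : continuous (fun x => (1 / 2 + cos y ^+ 2) * t 0%N x + (- 2 * cos y) * t 1%N x).
  by move=> x; apply: cvgD; exact: ct.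
have -> : cint (fun x => (cos x - cos y) ^+ 2 * cfejer m y x) =
    cint (fun x => ((1 / 2 + cos y ^+ 2) * t 0%N x + (- 2 * cos y) * t 1%N x) + 1 / 2 * t 2%N x).
  apply: eq_cint => x; rewrite /t mul0r cos0 !mul1r.
  by rewrite cos_double; field.
rewrite (cintD c1 (ct _ _)) (cintD (ct _ _) (ct _ _)) !cintZ//.
rewrite !cint_cos_cfejer// ?(ltn_trans _ m2)//.
by rewrite cos_double mul0r cos0 !mul1r subr0; move: (cos y) (pi : R) => *; field.
Qed.

(** Near [y] continuity suffices; elsewhere on [[0, pi]] the squared distance of cosines is bounded
    below and a large [K] compensates. Symmetry covers the other half. *)
Lemma le_sqdist u y e : continuous u -> (forall x, 0 <= x <= 2 * pi -> u (2 * pi - x) = u x) ->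
  0 <= y <= pi -> 0 < e ->
  exists2 K, 0 <= K & forall x, 0 <= x <= 2 * pi ->
    `|u x - u y| <= e + K * (cos x - cos y) ^+ 2.
Proof.
move=> cu ue /andP[y0 ypi] e0; have pi0 := @pi_gt0 R.
have [d d0 hd] : exists2 d, 0 < d & forall x, `|x - y| < d -> `|u x - u y| <= e.
  have /cvgrPdist_le/(_ e e0) := cu y.
  case/nbhs_ballP => d d0 hd; exists d => // x xd.
  by rewrite distrC; apply: hd; rewrite /ball/= distrC.
have [M M0 hM] : exists2 M, 0 <= M & forall x, 0 <= x <= pi -> `|u x - u y| <= M.
  pose f x := `|u x - u y|.
  have cf : continuous f.
    move=> x; apply: cvg_norm; apply: cvgB; [exact: cu|exact: cvg_cst].
  have [c _ hc] := EVT_max (@pi_ge0 R) (continuous_subspaceT cf).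
  exists (f c); first exact: normr_ge0.
  by move=> x xp; apply: hc; rewrite in_itv.
have [q q0 hq] : exists2 q, 0 < q & forall x, 0 <= x <= pi -> d <= `|x - y| ->
    q <= `|cos x - cos y|.
  (* The default 1 stands for a side on which no point of [[0, pi]] is at distance [d] or more from
     [y]. *)
  pose q1 := if y + d <= pi then cos y - cos (y + d) else 1.
  pose q2 := if d <= y then cos (y - d) - cos y else 1.
  have q10 : 0 < q1.
    rewrite /q1; case: ifP => // h.
    by rewrite subr_gt0 ltr_cos ?in_itv/=; [lra|apply/andP; split; lra|apply/andP; split; lra].
  have q20 : 0 < q2.
    rewrite /q2; case: ifP => // h.
    by rewrite subr_gt0 ltr_cos ?in_itv/=; [lra|apply/andP; split; lra|apply/andP; split; lra].
  exists (Num.min q1 q2); first by rewrite lt_min q10.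
  move=> x /andP[x0 xpi]; rewrite ge_min; have [xy|yx] := leP x y.
    rewrite ler0_norm ?subr_le0// opprB => h; apply/orP; right.
    rewrite /q2 ifT; last by lra.
    by rewrite (le_trans _ (ler_norm _))// lerB// cos_anti//; lra.
  rewrite gtr0_norm ?subr_gt0// => h; apply/orP; left.
  rewrite /q1 ifT; last by lra.
  by rewrite distrC (le_trans _ (ler_norm _))// lerB// cos_anti//; lra.
exists (M / q ^+ 2); first by rewrite divr_ge0 ?sqr_ge0.
have half x : 0 <= x <= pi -> `|u x - u y| <= e + M / q ^+ 2 * (cos x - cos y) ^+ 2.
  move=> xp; have [xd|dx] := ltP `|x - y| d.
    by rewrite (le_trans (hd _ xd))// lerDl mulr_ge0 ?sqr_ge0// divr_ge0 ?sqr_ge0.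
  rewrite (le_trans (hM _ xp))// (le_trans (_ : _ <= M / q ^+ 2 * (cos x - cos y) ^+ 2))//.
    rewrite mulrAC -mulrA ler_peMr// ler_pdivlMr ?exprn_gt0// mul1r.
    rewrite -[leRHS]real_normK ?num_real// lerXn2r ?nnegrE ?(ltW q0)//.
    exact: hq.
  by rewrite lerDr ltW.
move=> x /andP[x0 x2]; have [xp|px] := leP x pi; first by rewrite half ?x0.
have := half (2 * pi - x); rewrite ue ?x0//.
have -> : cos (2 * pi - x) = cos x.
  by rewrite (_ : 2 * pi - x = - x + pi *+ 2) ?cosD2pi ?cosN//; ring.
by apply; apply/andP; split; lra.
Qed.

(** Korovkin's argument handles the Fejer means. They differ from the partial sums by [2 T / m],
    where [T] is bounded because [k |a k|] is summable. *)
Lemma cos_series_cvg u y e (a : nat -> R) : continuous u ->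
  (forall x, 0 <= x <= 2 * pi -> u (2 * pi - x) = u x) -> 0 <= y <= pi ->
  (forall k, a k = (2 * pi)^-1 * cint (fun x => u x * cos (k%:R * x))) ->
  bounded_sums (fun k => k.+1%:R * `|a k|) -> 0 < e ->
  exists n0, forall n, (n0 <= n)%N ->
    `|2 * (\sum_(k < n) a k * cos (k%:R * y)) - a 0%N - u y| <= e.
Proof.
move=> cu ue yp aE [W hW] e0.
have pi0 := @pi_gt0 R.
have W0 : 0 <= W by have := hW 0%N; rewrite big_ord0.
have e2 : 0 < e / 2 by rewrite divr_gt0.
have [K K0 hK] := le_sqdist cu ue yp e2.
have KW0 : 0 <= K + 2 * W by rewrite addr_ge0// mulr_ge0.
pose n0 := (Num.bound (2 * (K + 2 * W) / e)).+3.
exists n0 => m n0m; have m2 : (2 < m)%N by rewrite (leq_trans _ n0m).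
have m0 : 0 < m%:R :> R by rewrite ltr0n (leq_trans _ m2).
have Km : (K + 2 * W) / m%:R <= e / 2.
  have : 2 * (K + 2 * W) / e <= m%:R.
    apply: le_trans (_ : (Num.bound (2 * (K + 2 * W) / e))%:R <= _).
      by apply/ltW/archi_boundP; apply: divr_ge0; [exact: mulr_ge0|exact: ltW].
    by rewrite ler_nat (leq_trans _ n0m)// /n0 -addn3 leq_addr.
  by rewrite ler_pdivrMr// ler_pdivrMr//; lra.
have cF := @continuous_cfejer R m y.
have cuF : continuous (fun x => u x * cfejer m y x).
  by move=> x; apply: cvgM; [exact: cu|exact: cF].
have cyF c : continuous (fun x => c * cfejer m y x).
  by move=> x; apply: cvgM; [exact: cvg_cst|exact: cF].
have intF : cint (cfejer m y) = 2 * pi * m%:R.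
  have := cint_cos_cfejer y (ltn_trans (ltn0Sn 1) m2).
  rewrite mul0r cos0 mulr1 subr0 => <-.
  by apply: eq_cint => x; rewrite mul0r cos0 mul1r.
pose D x := (cos x - cos y) ^+ 2 * cfejer m y x.
have cD : continuous D.
  move=> x; apply: cvgM; last exact: cF.
  apply: (@continuous_comp _ _ _ (fun x : R => cos x - cos y) (fun t : R => t ^+ 2)).
    by apply: cvgB; [exact: continuous_cos|exact: cvg_cst].
  exact: exprn_continuous.
pose H x := e / 2 * cfejer m y x + K * D x.
have cH : continuous H.
  by move=> x; apply: cvgD; [exact: cyF|apply: cvgM; [exact: cvg_cst|exact: cD]].
have intH : cint H = 2 * pi * (e / 2 * m%:R + K).
  rewrite cintD//; last by move=> x; apply: cvgM; [exact: cvg_cst|exact: cD].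
  by rewrite !cintZ// intF cint_sqdist_cfejer//; ring.
have main : `|cint (fun x => u x * cfejer m y x) - 2 * pi * m%:R * u y| <= 2 * pi * (e / 2 * m%:R + K).
  rewrite -intH (_ : _ - _ = cint (fun x => u x * cfejer m y x - u y * cfejer m y x)); last first.
    by rewrite cintB// cintZ// intF; ring.
  have cdiff : continuous (fun x => u x * cfejer m y x - u y * cfejer m y x).
    by move=> x; apply: cvgB; [exact: cuF|exact: cyF].
  have pt x : 0 <= x <= 2 * pi ->
      - H x <= u x * cfejer m y x - u y * cfejer m y x <= H x.
    move=> /hK; rewrite ler_norml => /andP[h1 h2].
    have F0 := cfejer_ge0 m y x.
    have := ler_wpM2r F0 h1; have := ler_wpM2r F0 h2.
    rewrite /H /D; clear; move: (cfejer m y x) (u x) (u y) ((cos x - cos y) ^+ 2) => F a b d h1 h2.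
    by apply/andP; split; lra.
  rewrite ler_norml; apply/andP; split; last first.
    by apply: cint_le => // x /pt/andP[].
  have <- : cint (fun x => - 1 * H x) = - cint H by rewrite cintZ// mulN1r.
  apply: cint_le => //; first by move=> x; apply: cvgM; [exact: cvg_cst|exact: cH].
  by move=> x /pt/andP[]; rewrite mulN1r.
have p2 : 0 < 2 * pi :> R by rewrite mulr_gt0.
have aE' k : cint (fun x => u x * cos (k%:R * x)) = 2 * pi * a k.
  by rewrite aE mulrA divff ?mul1r// gt_eqF.
have uE : cint u = 2 * pi * a 0%N.
  by rewrite -aE'; apply: eq_cint => x; rewrite mul0r cos0 mulr1.
set S := \sum_(k < m) a k * cos (k%:R * y).
pose T := \sum_(k < m) k%:R * a k * cos (k%:R * y).
have SE : \sum_(k < m) (m%:R - k%:R) * cos (k%:R * y) *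
      cint (fun x => u x * cos (k%:R * x)) = 2 * pi * (m%:R * S - T).
  rewrite /S /T [m%:R * _]mulr_sumr -sumrB mulr_sumr; apply: eq_bigr => k _.
  by rewrite aE'; ring.
rewrite cint_cfejer// SE uE in main.
have TW : `|T| <= W.
  apply: le_trans (ler_norm_sum _ _ _) _; apply: le_trans (hW m); apply: ler_sum => k _.
  rewrite !normrM [`|k%:R|]ger0_norm//.
  apply: le_trans (_ : k%:R * `|a k| <= _).
    by rewrite ler_piMr ?mulr_ge0// ler_norml cos_geN1 cos_le1.
  by rewrite ler_wpM2r// ler_nat.
have {}main : `|m%:R * (2 * S - a 0%N - u y) - 2 * T| <= e / 2 * m%:R + K.
  rewrite -(ler_pM2l p2) -[X in X * `|_|](gtr0_norm p2) -normrM.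
  move: main; congr (`|_| <= _); ring.
have : m%:R * `|2 * S - a 0%N - u y| <= e / 2 * m%:R + K + 2 * W.
  rewrite -[X in X * `|_|](gtr0_norm m0) -normrM.
  have := ler_normD (m%:R * (2 * S - a 0%N - u y) - 2 * T) (2 * T).
  rewrite subrK => h; apply: le_trans h _; rewrite lerD//.
  by rewrite normrM ger0_norm// ler_wpM2l.
rewrite mulrC -ler_pdivlMr// => /le_trans; apply.
rewrite -addrA mulrDl mulfK ?gt_eqF//.
by lra.
Qed.

End CosineSeriesConvergence.

(** * From continuity on a set to continuity along the circle *)

Section WithinContinuity.
Variable R : realType.
Implicit Types (z : R[i]) (e x y : R).

Lemma within_cabs (D : set R[i]) (f : R[i] -> R[i]) z0 e :
  {within D, continuous f} -> D z0 -> 0 < e ->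
  exists2 d : R, 0 < d & forall z, D z -> cabs (z - z0) < d -> cabs (f z - f z0) <= e.
Proof.
move=> /subspace_continuousP cf Dz0 e0.
have /cvgrPdist_le/(_ e%:C) := cf _ Dz0.
rewrite ltcR => /(_ e0); rewrite /within/= => /nbhs_ballP[d /= d0 hd].
have dE : d = (complex.Re d)%:C.
  by apply: complex_ext => //=; rewrite (ger0_Im (ltW d0)).
rewrite dE ltcR in d0; exists (complex.Re d) => // z Dz zd.
have zb : ball z0 d z by rewrite /ball/= -opprB normrN cabsE dE ltcR.
by have := hd z zb Dz; rewrite -opprB normrN cabsE lecR.
Qed.

Lemma expi_lip x y : cabs (expi x - expi y) <= 2 * `|x - y|.
Proof.
apply: le_trans (cabs_le _) _; rewrite !expiE /=.
by have := cos_lip y x; have := sin_lip y x; lra.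
Qed.

Lemma within_expi (D : set R[i]) (f : R[i] -> R[i]) : {within D, continuous f} ->
  (forall x, D (expi x)) ->
  continuous (fun x => complex.Re (f (expi x))) /\
  continuous (fun x => complex.Im (f (expi x))).
Proof.
move=> cf De.
have key (p : R[i] -> R) : (forall z w, p z - p w = p (z - w)) ->
    (forall z, `|p z| <= cabs z) -> continuous (fun x => p (f (expi x))).
  move=> pB ple x; apply/cvgrPdist_le => e e0.
  have [d d0 hd] := within_cabs cf (De x) e0.
  have d2 : 0 < d / 4 by rewrite divr_gt0.
  apply: filterS (nbhsx_ballx x (d / 4) d2) => y; rewrite /ball/= => xy.
  rewrite pB (le_trans (ple _))// cabsC hd//.
  by apply: le_lt_trans (expi_lip _ _) _; rewrite distrC; lra.
split; apply: key.
- by move=> z w; rewrite ReD ReN.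
- exact: Re_le_cabs.
- by move=> z w; rewrite ImD ImN.
- exact: Im_le_cabs.
Qed.

End WithinContinuity.

(** * Fourier coefficients of an even symbol *)

Section FourierCoefficients.
Variables (R : realType) (a : R[i] -> R[i]).
Implicit Types (x y e : R) (k n : nat) (l : int).

Definition coef k : R[i] := fourier a k%:Z.

Definition even_symbol :=
  {within @unit_circle R, continuous a} /\
  forall x, 0 <= x <= 2 * pi -> gfun a x = gfun a (2 * pi - x).

Lemma gfun_continuous : {within @unit_circle R, continuous a} ->
  continuous (fun x => complex.Re (gfun a x)) /\
  continuous (fun x => complex.Im (gfun a x)).
Proof.
move=> ca; have := within_expi ca; apply => x.
by rewrite /unit_circle/= cabsE cabs_expi.
Qed.

Lemma sin_int2pi l y : sin (2 * pi * l%:~R - y) = - sin y :> R.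
Proof.
have h n : sin (n%:R * (2 * pi) - y) = - sin y :> R.
  elim: n => [|n IH]; first by rewrite mul0r sub0r sinN.
  by rewrite -natr1 mulrDl mul1r addrAC [2 * pi]mulr_natl sinD2pi -[pi *+ 2]mulr_natl.
have h' n : sin (n%:R * (2 * pi) + y) = sin y :> R.
  elim: n => [|n IH]; first by rewrite mul0r add0r.
  by rewrite -natr1 mulrDl mul1r addrAC [2 * pi]mulr_natl sinD2pi -[pi *+ 2]mulr_natl.
case: l => n; first by rewrite mulrC h.
by rewrite NegzE mulrNz mulrN -opprD sinN mulrC h'.
Qed.

(** The reflection [x -> 2 pi - x] changes the sign of the integrand, so the integral equals its
    opposite. *)
Lemma cint_odd (v : R -> R) l : continuous v ->
  (forall x, 0 <= x <= 2 * pi -> v (2 * pi - x) = v x) ->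
  cint (fun x => v x * sin (l%:~R * x)) = 0.
Proof.
move=> cv ve.
have cs : continuous (fun x : R => sin (l%:~R * x)).
  move=> x; apply: (@continuous_comp _ _ _ (fun x : R => l%:~R * x) (@sin R)).
    exact: mulrl_continuous.
  exact: continuous_sin.
have cf : continuous (fun x => v x * sin (l%:~R * x)).
  by move=> x; apply: cvgM; [exact: cv|exact: cs].
have := cint_reflect cf.
have -> : cint (fun x => v (2 * pi - x) * sin (l%:~R * (2 * pi - x))) =
    - 1 * cint (fun x => v x * sin (l%:~R * x)).
  rewrite -cintZ//; apply: eq_Rintegral => x; rewrite inE/= in_itv/= => xp.
  by rewrite ve// mulrBr [l%:~R * (2 * pi)]mulrC sin_int2pi; ring.
by lra.
Qed.

Lemma fourierE l : even_symbol ->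
  fourier a l = ((2 * pi)^-1 * cint (fun x => complex.Re (gfun a x) * cos (l%:~R * x)))%:C +
    'i * ((2 * pi)^-1 * cint (fun x => complex.Im (gfun a x) * cos (l%:~R * x)))%:C.
Proof.
move=> [ca ge]; have [cu cv] := gfun_continuous ca.
set u := fun x => complex.Re (gfun a x) in cu *.
set v := fun x => complex.Im (gfun a x) in cv *.
have ue x : 0 <= x <= 2 * pi -> u (2 * pi - x) = u x by move=> /ge; rewrite /u => ->.
have ve x : 0 <= x <= 2 * pi -> v (2 * pi - x) = v x by move=> /ge; rewrite /v => ->.
have cc : continuous (fun x : R => cos (l%:~R * x)) by exact: continuous_cosZ.
have cs : continuous (fun x : R => sin (l%:~R * x)).
  move=> x; apply: (@continuous_comp _ _ _ (fun x : R => l%:~R * x) (@sin R)).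
    exact: mulrl_continuous.
  exact: continuous_sin.
have cM (f g : R -> R) : continuous f -> continuous g -> continuous (fun x => f x * g x).
  by move=> cf cg x; apply: cvgM; [exact: cf|exact: cg].
have ee x : cexp (- ('i * l%:~R * x%:C)) = cos (l%:~R * x) +i* - sin (l%:~R * x).
  rewrite -sinN -cosN -cexp_i; congr cexp.
  by rewrite rmorphN rmorphM rmorph_int; ring.
have rE x : complex.Re (gfun a x * cexp (- ('i * l%:~R * x%:C))) =
    u x * cos (l%:~R * x) + v x * sin (l%:~R * x).
  by rewrite ee ReM/= mulrN opprK.
have iE x : complex.Im (gfun a x * cexp (- ('i * l%:~R * x%:C))) =
    v x * cos (l%:~R * x) - u x * sin (l%:~R * x).
  by rewrite ee ImM/= mulrN addrC.
rewrite /fourier /cintegral -/(cint _) -/(cint _).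
rewrite (eq_cint rE) (eq_cint iE).
rewrite (cintD (cM _ _ cu cc) (cM _ _ cv cs)) (cintB (cM _ _ cv cc) (cM _ _ cu cs)).
rewrite !cint_odd// addr0 subr0.
by apply: complex_ext; rewrite !(ReM, ImM, ReD, ImD)/=; ring.
Qed.

Lemma fourierN l : even_symbol -> fourier a (- l) = fourier a l.
Proof.
move=> ea; rewrite !fourierE//.
by congr (_%:C + 'i * _%:C); congr (_ * _); apply: eq_cint => x; rewrite mulrNz mulNr cosN.
Qed.

Lemma bounded_weight (alpha : R) : 2 <= alpha -> wiener alpha a ->
  bounded_sums (weight coef).
Proof.
move=> al [_ esum_fin].
pose w l := (cabs (fourier a l) * (`|l|%N.+1)%:R `^ alpha)%:E : \bar R.
have {}esum_fin : (\esum_(l in [set: int]) w l < +oo)%E by exact: esum_fin.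
have w0 l : (0 <= w l)%E.
  by rewrite lee_fin; apply: mulr_ge0; [exact: cabs_ge0|exact: powR_ge0].
exists (fine (\esum_(l in [set: int]) w l)) => n.
have fin : (\esum_(l in [set: int]) w l) \is a fin_num.
  by rewrite ge0_fin_numE// esum_ge0.
rewrite -lee_fin fineK//; apply: esum_ge.
pose r := [seq Posz k | k <- iota 0 n].
have ur : uniq r by rewrite map_inj_uniq ?iota_uniq// => ? ? [].
exists [set` r]; first by split => //; exact: finite_seq.
rewrite -fsbig_seq// big_map -sumEFin.
rewrite -(big_mkord xpredT (fun k => (weight coef k)%:E)) /index_iota subn0.
apply: lee_sum => k _; rewrite lee_fin /weight ler_wpM2l ?cabs_ge0//.
rewrite -powR_mulrn// ler_powR// ler1n.
by [].
Qed.

Definition zcos k (z : R[i]) : R[i] := cexp ('i * k%:R * z) + cexp (- ('i * k%:R * z)).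

Lemma zcos_real k x : zcos k x%:C = (2 * cos (k%:R * x))%:C.
Proof.
rewrite -cexp_i2cos /zcos.
have -> : 'i * (k%:R * x)%:C = 'i * k%:R * x%:C by rewrite rmorphM/= rmorph_nat; ring.
by [].
Qed.

(** The term [k = 0] counts the constant coefficient twice, hence the subtraction. The index is
    [n.+1] because [gn a 0] is an empty sum. *)
Lemma gnE n z : even_symbol ->
  gn a n.+1 z = (\sum_(k < n.+1) coef k * zcos k z) - coef 0%N.
Proof.
move=> ea; rewrite /gn; set t := cexp ('i * z).
have t0 : t != 0 by exact: cexp_neq0.
have zt k : zcos k z = t ^ k%:Z + t ^ (- k%:Z).
  rewrite /zcos -exprnP -exprnN /t cexpX -cexpN.
  by congr (cexp _ + cexp _); ring.
elim: n => [|n IH].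
  rewrite /trunc_symbol /= big_nat1 /= subr0 expr0z mulr1.
  rewrite big_ord_recl big_ord0 addr0 zt oppr0 expr0z.
  by rewrite /coef /=; ring.
rewrite big_ord_recr/= addrAC -IH /trunc_symbol /=.
rewrite [in LHS]big_nat_recr//= [X in X + _]big_nat_recl//= zt /coef.
have -> : (n.*2.+2)%:Z - n.+1%:Z = n.+1%:Z by lia.
have -> : 0%:Z - n.+1%:Z = - n.+1%:Z by lia.
rewrite (eq_big_nat _ _ (F2 := fun k => fourier a (k%:Z - n%:Z) * t ^ (k%:Z - n%:Z))); last first.
  by move=> k _; have -> : k.+1%:Z - n.+1%:Z = k%:Z - n%:Z by lia.
by rewrite fourierN// mulrDr addrC [X in _ + X]addrC addrCA addrA; congr (_ + _); rewrite addrC.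
Qed.

Lemma gn_cvg x : even_symbol -> bounded_sums (weight coef) -> 0 <= x <= pi ->
  clim (fun n => gn a n x%:C) (gfun a x).
Proof.
move=> ea [W hW] xp e e0; have [ca ge] := ea; have [cu cv] := gfun_continuous ca.
have bs (b : nat -> R) : (forall k, `|b k| <= cabs (coef k)) ->
    bounded_sums (fun k => k.+1%:R * `|b k|).
  move=> hb; exists W => n; apply: le_trans (hW n); apply: ler_sum => k _.
  rewrite mulrC /weight ler_pM//.
  by rewrite expr2 ler_peMr// ler1n.
have e2 : 0 < e / 2 by rewrite divr_gt0.
have cE k : coef k = ((2 * pi)^-1 * cint (fun x => complex.Re (gfun a x) * cos (k%:R * x)))%:C +
    'i * ((2 * pi)^-1 * cint (fun x => complex.Im (gfun a x) * cos (k%:R * x)))%:C.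
  by rewrite /coef fourierE.
have ReE k : complex.Re (coef k) = (2 * pi)^-1 * cint (fun x => complex.Re (gfun a x) * cos (k%:R * x)).
  by rewrite cE ReD ReM/=; ring.
have ImE k : complex.Im (coef k) = (2 * pi)^-1 * cint (fun x => complex.Im (gfun a x) * cos (k%:R * x)).
  by rewrite cE ImD ImM/=; ring.
have [|n1 h1] := cos_series_cvg cu _ xp ReE (bs _ (fun k => Re_le_cabs _)) e2.
  by move=> y /ge ->.
have [|n2 h2] := cos_series_cvg cv _ xp ImE (bs _ (fun k => Im_le_cabs _)) e2.
  by move=> y /ge ->.
exists (maxn 1 (maxn n1 n2)) => -[|n]; rewrite !geq_max //= => /andP[/h1 {}h1 /h2 {}h2].
apply: le_trans (cabs_le _) _; rewrite gnE//.
have -> : e = e / 2 + e / 2 by field.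
have gE : \sum_(k < n.+1) coef k * zcos k x%:C = \sum_(k < n.+1) coef k * (2 * cos (k%:R * x))%:C.
  by apply: eq_bigr => k _; rewrite zcos_real.
rewrite gE lerD//.
  move: h1; congr (`|_| <= _); rewrite !(ReD, ReN) Re_sum mulr_sumr; congr (_ - _ - _).
  by apply: eq_bigr => k _; rewrite ReM/=; ring.
move: h2; congr (`|_| <= _); rewrite !(ImD, ImN) Im_sum mulr_sumr; congr (_ - _ - _).
by apply: eq_bigr => k _; rewrite ImM/=; ring.
Qed.

End FourierCoefficients.

(** * Termwise differentiation of cosine series *)

Section TermwiseDerivative.
Variable R : realType.
Implicit Types (x y e h : R) (A B : nat -> R[i]) (k n : nat).

Lemma is_derive_eps (f : R -> R) x d :
  (forall e, 0 < e -> exists2 r, 0 < r & forall h, `|h| < r ->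
     `|f (x + h) - f x - h * d| <= e * `|h|) -> is_derive x 1 f d.
Proof.
move=> fd.
have lim : (fun h => h^-1 *: ((f \o shift x) (h *: (1 : R)) - f x)) @ 0^' --> d.
  apply/cvgrPdist_le => e e0; have [r r0 hr] := fd e e0.
  exists r => //= h; rewrite /ball/= sub0r normrN => hr' h0.
  have h0' : 0 < `|h| by rewrite normr_gt0.
  rewrite distrC -(ler_pM2r h0') -normrM mulrBl.
  have -> : h^-1 *: (f (h *: (1 : R) + x) - f x) * h = f (x + h) - f x.
    rewrite /GRing.scale/= mulr1 [h + x]addrC mulrAC mulVf ?mul1r//.
  by rewrite [d * h]mulrC; exact: hr.
split; last exact: cvg_lim lim.
by apply/cvg_ex; exists d.
Qed.

Lemma is_cderive_eps (f : R -> R[i]) x (d : R[i]) :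
  (forall e, 0 < e -> exists2 r, 0 < r & forall h, `|h| < r ->
     cabs (f (x + h) - f x - h%:C * d) <= e * `|h|) -> is_cderive f x d.
Proof.
move=> fd; split; apply: is_derive_eps => e /fd[r r0 hr]; exists r => // h /hr;
    apply: le_trans.
  by have := Re_le_cabs (f (x + h) - f x - h%:C * d); rewrite !(ReD, ReN) ReM/= mul0r subr0.
by have := Im_le_cabs (f (x + h) - f x - h%:C * d); rewrite !(ImD, ImN) ImM/= mul0r addr0.
Qed.

(** By the mean value theorem the [k]-th error is [h] times an increment of [phi' k], and
    [bounded_sums_min] makes the sum of these [o(h)]. The constant [c0] allows for the offset by the
    zeroth coefficient. *)
Lemma is_cderive_series B (phi phi' : nat -> R -> R) (f : R -> R[i]) x0 r (c0 d : R[i]) :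
  bounded_sums (weight B) ->
  (forall k y, is_derive y 1 (phi k) (phi' k y)) ->
  (forall k x y, `|phi' k y - phi' k x| <=
     2 * k.+1%:R ^+ 2 * Num.min 1 (k.+1%:R * `|y - x|)) ->
  0 < r ->
  (forall y, `|y - x0| < r -> clim (fun n => \sum_(k < n) B k * (phi k y)%:C) (f y + c0)) ->
  clim (fun n => \sum_(k < n) B k * (phi' k x0)%:C) d ->
  is_cderive f x0 d.
Proof.
move=> bB dphi lphi r0 fE dE; apply: is_cderive_eps => e e0.
have [h0 h00 hh] := bounded_sums_min (weight_ge0 B) bB (divr_gt0 e0 (ltr0Sn R 1)).
exists (Num.min r h0); first by rewrite lt_min r0.
move=> h; rewrite lt_min => /andP[hr /ltW hh0].
have f1 := fE (x0 + h); rewrite addrAC subrr add0r in f1.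
have f2 := fE x0; rewrite subrr normr0 in f2.
have := climD (climD (f1 hr) (climN (f2 r0))) (climN (climZ h%:C dE)).
rewrite -/(_ - _) (_ : _ - _ - _ = f (x0 + h) - f x0 - h%:C * d); last by ring.
move=> /clim_le L; rewrite -[_ - _ * d]subr0; apply: (L _ _ 0%N) => n _.
rewrite subr0 mulr_sumr -!sumrB.
apply: le_trans (cabs_sum _ _ _) _.
apply: le_trans (_ : 2 * `|h| * \sum_(k < n) weight B k * Num.min 1 (k.+1%:R * `|h|) <= _).
  rewrite mulr_sumr; apply: ler_sum => k _.
  have -> : B k * (phi k (x0 + h))%:C - B k * (phi k x0)%:C - h%:C * (B k * (phi' k x0)%:C) =
      B k * (phi k (x0 + h) - phi k x0 - h * phi' k x0)%:C.
    by rewrite !rmorphB rmorphM/=; ring.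
  rewrite cabsM cabs_real.
  have [c [c1 c2 ->]] := @MVT_real _ (phi k) (phi' k) x0 (x0 + h) (dphi k).
  rewrite [x0 + h - x0]addrAC subrr add0r.
  rewrite (_ : _ - _ = h * (phi' k c - phi' k x0)) ?normrM; last by ring.
  have hc : `|c - x0| <= `|h|.
    move: c1 c2; have [h1|h1] := leP 0 h.
      rewrite min_l ?lerDl// max_r ?lerDl// => c1 c2.
      by rewrite !ger0_norm; lra.
    rewrite min_r ?gerDl ?(ltW h1)// max_l ?gerDl ?(ltW h1)// => c1 c2.
    by rewrite !ler0_norm; lra.
  have -> : 2 * `|h| * (weight B k * Num.min 1 (k.+1%:R * `|h|)) =
      `|h| * (2 * k.+1%:R ^+ 2 * Num.min 1 (k.+1%:R * `|h|)) * cabs (B k).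
    by rewrite /weight; ring.
  rewrite [leLHS]mulrC ler_wpM2r ?cabs_ge0// ler_wpM2l//.
  apply: le_trans (lphi k x0 c) _; rewrite ler_wpM2l ?mulr_ge0 ?sqr_ge0//.
  by rewrite le_min !ge_min lexx/= ler_wpM2l ?orbT.
have := hh n `|h|; rewrite normr_ge0 hh0 => /(_ isT) h1.
have : `|h| * \sum_(k < n) weight B k * Num.min 1 (k.+1%:R * `|h|) <= `|h| * (e / 2).
  by rewrite ler_wpM2l.
by lra.
Qed.

Lemma is_derive_mulZ (c : R) y : is_derive y 1 (fun x : R => c * x) c.
Proof.
have := is_deriveM (is_derive_cst c y 1) (is_derive_id y 1).
by move=> /is_derive_eq; apply; rewrite scaler0 addr0 /GRing.scale/= mulr1.
Qed.

Lemma trig_lip_min (f : R -> R) k x y : (forall u v, `|f u - f v| <= `|u - v|) ->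
  (forall u, `|f u| <= 1) ->
  `|f (k%:R * y) - f (k%:R * x)| <= 2 * Num.min 1 (k.+1%:R * `|y - x|).
Proof.
move=> flip f1; rewrite minEle; case: ifP => _.
  by have := ler_normB (f (k%:R * y)) (f (k%:R * x)); have := f1 (k%:R * y);
     have := f1 (k%:R * x); lra.
apply: le_trans (flip _ _) _; rewrite -mulrBr normrM ger0_norm//.
have : k%:R * `|y - x| <= k.+1%:R * `|y - x| by rewrite ler_wpM2r// ler_nat.
have : 0 <= k.+1%:R * `|y - x| by rewrite mulr_ge0.
by lra.
Qed.

Lemma cosine_series_derivatives A (G : R -> R[i]) (c0 : R[i]) lo hi :
  bounded_sums (weight A) ->
  (forall y, lo < y < hi -> clim (fun n => \sum_(k < n) A k * (cos (k%:R * y))%:C) (G y + c0)) ->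
  forall x, lo < x < hi ->
    clim (fun n => \sum_(k < n) A k * (- k%:R ^+ 2 * cos (k%:R * x))%:C)
         (cderive1 (cderive1 G) x).
Proof.
move=> bA GE.
have kk k : k%:R <= k.+1%:R :> R by rewrite ler_nat.
have k2 k : k%:R ^+ 2 <= k.+1%:R ^+ 2 :> R by rewrite lerXn2r ?nnegrE.
have k1 k : k%:R <= k.+1%:R ^+ 2 :> R.
  by rewrite (le_trans (kk k))// expr2 ler_peMr// ler1n.
have lim (psi : nat -> R) : (forall k, `|psi k| <= k.+1%:R ^+ 2) ->
    exists S, clim (fun n => \sum_(k < n) A k * (psi k)%:C) S.
  move=> hpsi; apply: (summable_clim (u := fun k => A k * (psi k)%:C) _ bA) => k.
  by rewrite cabsM cabs_real ler_wpM2l ?cabs_ge0.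
have s1 u : `|sin u| <= 1 :> R by rewrite ler_norml sin_geN1 sin_le1.
have c1 u : `|cos u| <= 1 :> R by rewrite ler_norml cos_geN1 cos_le1.
have b1 y k : `|- k%:R * sin (k%:R * y)| <= k.+1%:R ^+ 2.
  by rewrite normrM normrN [`|k%:R|]ger0_norm// (le_trans _ (k1 k))// ler_piMr.
have b2 y k : `|- k%:R ^+ 2 * cos (k%:R * y)| <= k.+1%:R ^+ 2.
  by rewrite normrM normrN [`|_ ^+ 2|]ger0_norm ?sqr_ge0// (le_trans _ (k2 k))// ler_piMr.
have near x : lo < x < hi -> exists2 r, 0 < r & forall y, `|y - x| < r -> lo < y < hi.
  move=> /andP[lx xh]; exists (Num.min (x - lo) (hi - x)).
    by rewrite lt_min !subr_gt0 lx.
  move=> y; rewrite lt_min !ltr_norml => /andP[/andP[? ?] /andP[? ?]].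
  by apply/andP; split; lra.
have cosD k y : is_derive y 1 (fun z : R => cos (k%:R * z)) (- k%:R * sin (k%:R * y)).
  have := is_derive1_comp (is_derive_cos (k%:R * y)) (is_derive_mulZ k%:R y).
  by move=> /is_derive_eq; apply; rewrite mulrC; ring.
have sinD k y : is_derive y 1 (fun z : R => - k%:R * sin (k%:R * z)) (- k%:R ^+ 2 * cos (k%:R * y)).
  have h := is_derive1_comp (is_derive_sin (k%:R * y)) (is_derive_mulZ k%:R y).
  have := is_deriveM (is_derive_cst (- k%:R : R) y 1) h.
  by move=> /is_derive_eq; apply; rewrite scaler0 addr0 /GRing.scale/=; ring.
have G1 y : lo < y < hi -> clim (fun n => \sum_(k < n) A k * (- k%:R * sin (k%:R * y))%:C)
    (cderive1 G y).
  move=> yI; have [S hS] := lim _ (b1 y); have [r r0 hr] := near y yI.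
  rewrite (@is_cderive_deriv _ G y S)//.
  apply: (is_cderive_series (c0 := c0) bA cosD _ r0 _ hS); last by move=> z /hr /GE.
  move=> k x z; rewrite -mulrBr normrM normrN [`|k%:R|]ger0_norm//.
  apply: le_trans (ler_wpM2l _ (trig_lip_min k x z (fun u v => sin_lip v u) s1)) _ => //.
  by rewrite mulrCA -mulrA ler_wpM2l// ler_wpM2r// le_min ler01 mulr_ge0.
move=> x xI; have [S hS] := lim _ (b2 x); have [r r0 hr] := near x xI.
rewrite (@is_cderive_deriv _ (cderive1 G) x S)//.
apply: (is_cderive_series (c0 := 0) bA sinD _ r0 _ hS); last by move=> z /hr /G1; rewrite addr0.
move=> k y z; rewrite -mulrBr normrM normrN [`|_ ^+ 2|]ger0_norm ?sqr_ge0//.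
apply: le_trans (ler_wpM2l _ (trig_lip_min k y z (fun u v => cos_lip v u) c1)) _ => //.
by rewrite mulrCA -mulrA ler_wpM2l// ler_wpM2r// le_min ler01 mulr_ge0.
Qed.

End TermwiseDerivative.

(** * The symbol and its second derivative as cosine series *)

Section SymbolSeries.
Variables (R : realType) (a : R[i] -> R[i]).
Implicit Types (x y : R).

Lemma gfunD2pi x : gfun a (x + 2 * pi) = gfun a x.
Proof.
rewrite /gfun; congr (a _); rewrite !cexp_i [2 * pi]mulr_natl.
by rewrite cosD2pi sinD2pi.
Qed.

Lemma cos_nat2pi k x : cos (k%:R * (2 * pi - x)) = cos (k%:R * x) :> R.
Proof.
elim: k x => [|k IH] x; first by rewrite !mul0r.
have h : sin (k%:R * (2 * pi - x)) = - sin (k%:R * x).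
  by have := sin_int2pi k%:Z (k%:R * x); rewrite mulrBr [k%:R * (2 * pi)]mulrC.
have -> : k.+1%:R * (2 * pi - x) = k%:R * (2 * pi - x) - x + pi *+ 2.
  by rewrite -natr1 -[pi *+ 2]mulr_natl; ring.
have -> : k.+1%:R * x = k%:R * x + x by rewrite -natr1; ring.
by rewrite cosD2pi cosB IH h cosD; ring.
Qed.

(** Periodicity and evenness extend the expansion beyond [[0, pi]], because the second derivatives
    at 0 and [pi] are two-sided. *)
Lemma gfun_series x : even_symbol a -> bounded_sums (weight (coef a)) ->
  - pi <= x <= 2 * pi ->
  clim (fun n => \sum_(k < n) coef a k * (2 * cos (k%:R * x))%:C) (gfun a x + coef a 0%N).
Proof.
move=> ea bA; have pi0 := @pi_gt0 R.
have base y : 0 <= y <= pi ->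
    clim (fun n => \sum_(k < n) coef a k * (2 * cos (k%:R * y))%:C) (gfun a y + coef a 0%N).
  move=> yp; have := climD (gn_cvg ea bA yp) (clim_cst (coef a 0%N)).
  apply: (clim_ext (n0 := 1%N)) => -[|n] // _; rewrite gnE// subrK.
  by apply: eq_bigr => k _; rewrite zcos_real.
move=> /andP[xl xu]; have [x0|x0] := leP 0 x; last first.
  have -> : gfun a x = gfun a (- x).
    rewrite -gfunD2pi; have [_ ->] := ea; last by apply/andP; split; lra.
    by congr (gfun a _); ring.
  have := base (- x) ltac:(apply/andP; split; lra).
  by apply: (clim_ext (n0 := 0%N)) => n _; apply: eq_bigr => k _; rewrite mulrN cosN.
have [xp|px] := leP x pi; first by apply: base; rewrite x0.
have [_ ->] := ea; last by rewrite x0.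
have := base (2 * pi - x) ltac:(apply/andP; split; lra).
by apply: (clim_ext (n0 := 0%N)) => n _; apply: eq_bigr => k _; rewrite cos_nat2pi.
Qed.

Lemma gfun_deriv2 x : even_symbol a -> bounded_sums (weight (coef a)) ->
  - pi < x < 2 * pi ->
  clim (fun n => \sum_(k < n) coef a k * (2 * (- k%:R ^+ 2 * cos (k%:R * x)))%:C)
       (cderive1 (cderive1 (gfun a)) x).
Proof.
move=> ea bA xI; pose A k := 2 * coef a k.
have bA2 : bounded_sums (weight A).
  have [W hW] := bA; exists (2 * W) => n.
  rewrite (eq_bigr (fun k : 'I_n => 2 * weight (coef a) k)); last first.
    by move=> k _; rewrite /weight cabsM (cabs_nat R 2) mulrA.
  by rewrite -mulr_sumr ler_wpM2l// hW.
have GE y : - pi < y < 2 * pi ->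
    clim (fun n => \sum_(k < n) A k * (cos (k%:R * y))%:C) (gfun a y + coef a 0%N).
  move=> /andP[y1 y2]; have := gfun_series ea bA (_ : - pi <= y <= 2 * pi).
  rewrite !ltW// => /(_ isT).
  apply: (clim_ext (n0 := 0%N)) => n _; apply: eq_bigr => k _.
  by rewrite rmorphM rmorph_nat /A; ring.
have := cosine_series_derivatives bA2 GE xI.
apply: (clim_ext (n0 := 0%N)) => n _; apply: eq_bigr => k _.
by rewrite [in RHS]rmorphM rmorph_nat /A; ring.
Qed.

End SymbolSeries.

(** * Second-order expansion in a strip of width of order [1/n] *)

Section SecondOrderExpansion.
Variable R : realType.
Implicit Types (z w : R[i]) (A : nat -> R[i]) (C e : R) (k n : nat).

(** Three successive uses of [cMVT] along the segment from 0 to [w]; each contributes a factor 2 and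
    a factor [cabs w]. *)
Lemma cexp_taylor w C : `|complex.Re w| <= C ->
  cabs (cexp w - 1 - w) <= 4 * expR C * cabs w ^+ 2 /\
  cabs (cexp w - 1 - w - w ^+ 2 / 2) <= 8 * expR C * cabs w ^+ 3.
Proof.
move=> wC; have C0 : 0 <= C by rewrite (le_trans _ wC).
pose E (t : R) := cexp (w * t%:C).
have dE t : is_cderive E t (w * E t).
  have := is_cderive_cexp (is_cderive_scale w (is_cderive_id t)).
  by rewrite mulr1.
have d0 t : is_cderive (fun t => w * t%:C) t w.
  by have := is_cderive_scale w (is_cderive_id t); rewrite mulr1.
have Ele t : 0 <= t <= 1 -> cabs (E t) <= expR C.
  move=> /andP[t0 t1]; rewrite cabs_cexp ler_expR (le_trans (ler_norm _))//.
  rewrite ReM/= mulr0 subr0 normrM [`|t|]ger0_norm// -[leRHS]mulr1.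
  by rewrite ler_pM.
have E0 : E 0 = 1 by rewrite /E mulr0 cexp0.
have w0 := cabs_ge0 w; have eC : 0 <= expR C := expR_ge0 C.
have b1 t : 0 <= t <= 1 -> cabs (E t - 1) <= 2 * (cabs w * expR C).
  move=> /andP[t0 t1]; rewrite -E0.
  have := @cMVT _ E (fun t => w * E t) (cabs w * expR C) 0 t t0 (fun x _ => dE x).
  move=> h; apply: le_trans (h _) _ => [x /andP[x0 x1]|].
    by rewrite cabsM ler_wpM2l// Ele// x0 (le_trans x1).
  by rewrite subr0 ler_piMr// mulr_ge0// mulr_ge0.
pose E2 t := E t + - 1 * (w * t%:C).
have dE2 t : is_cderive E2 t (w * (E t - 1)).
  have := is_cderiveD (dE t) (is_cderive_scale (- 1) (d0 t)).
  by move=> h; apply: is_cderive_eq h _; ring.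
have b2 t : 0 <= t <= 1 -> cabs (E t - 1 - w * t%:C) <= 4 * expR C * cabs w ^+ 2.
  move=> /andP[t0 t1].
  have -> : E t - 1 - w * t%:C = E2 t - E2 0 by rewrite /E2 E0 mulr0 mulr0; ring.
  have := @cMVT _ E2 (fun t => w * (E t - 1)) (cabs w * (2 * (cabs w * expR C))) 0 t t0 (fun x _ => dE2 x).
  move=> h; apply: le_trans (h _) _ => [x /andP[x0 x1]|].
    by rewrite cabsM ler_wpM2l// b1// x0 (le_trans x1).
  rewrite subr0 (_ : 4 * _ * _ = 2 * (cabs w * (2 * (cabs w * expR C)))); last by ring.
  by rewrite ler_piMr// !mulr_ge0.
pose E3 t := E2 t + - (w ^+ 2 / 2) * t%:C ^+ 2.
have dE3 t : is_cderive E3 t (w * (E t - 1 - w * t%:C)).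
  have := is_cderiveD (dE2 t) (is_cderive_scale (- (w ^+ 2 / 2)) (is_cderiveX 1 t)).
  by move=> h; apply: is_cderive_eq h _; rewrite expr1; field.
split; first by have := b2 1; rewrite lexx ler01 => /(_ isT); rewrite /E mulr1.
have -> : cexp w - 1 - w - w ^+ 2 / 2 = E3 1 - E3 0.
  rewrite /E3 /E2 E0 /E; rewrite [_ * 0%:C]mulr0 [w * 1%:C]mulr1 [1%:C ^+ 2]expr1n.
  by rewrite [0%:C ^+ 2]expr0n/=; ring.
have := @cMVT _ E3 (fun t => w * (E t - 1 - w * t%:C)) (cabs w * (4 * expR C * cabs w ^+ 2)) 0 1 ler01 (fun x _ => dE3 x).
move=> h; apply: le_trans (h _) _ => [x x01|].
  by rewrite cabsM ler_wpM2l// b2.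
by rewrite subr0 mulr1 le_eqVlt; apply/orP; left; apply/eqP; ring.
Qed.

(** Odd terms cancel in the even combination. The quadratic bound is kept beside the cubic one
    because only [k^2] is summable against the coefficients. *)
Lemma cexp_even_taylor w C : `|complex.Re w| <= C ->
  cabs (cexp w + cexp (- w) - 2 - w ^+ 2) <= 16 * expR C * cabs w ^+ 2 * Num.min 1 (cabs w).
Proof.
move=> wC; have [h1 h2] := cexp_taylor wC.
have [h3 h4] : cabs (cexp (- w) - 1 + w) <= 4 * expR C * cabs w ^+ 2 /\
    cabs (cexp (- w) - 1 + w - w ^+ 2 / 2) <= 8 * expR C * cabs w ^+ 3.
  have := @cexp_taylor (- w) C; rewrite ReN normrN => /(_ wC).
  by rewrite cabsN opprK sqrrN.
have C0 : 0 <= C by rewrite (le_trans _ wC).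
have eC : 1 <= expR C by rewrite -expR0 ler_expR.
have w0 := cabs_ge0 w; rewrite minEle; case: ifP => _.
  have -> : cexp w + cexp (- w) - 2 - w ^+ 2 = (cexp w - 1 - w) + (cexp (- w) - 1 + w) - w ^+ 2 by ring.
  apply: le_trans (cabsB _ _) _; apply: le_trans (lerD (cabsD _ _) (lexx _)) _.
  have : cabs w ^+ 2 <= expR C * cabs w ^+ 2 by rewrite ler_peMl// sqr_ge0.
  by have := sqr_ge0 (cabs w); rewrite cabsX; lra.
have -> : cexp w + cexp (- w) - 2 - w ^+ 2 =
    (cexp w - 1 - w - w ^+ 2 / 2) + (cexp (- w) - 1 + w - w ^+ 2 / 2) by field.
apply: le_trans (cabsD _ _) _; have -> : 16 * expR C * cabs w ^+ 2 * cabs w =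
  8 * expR C * cabs w ^+ 3 + 8 * expR C * cabs w ^+ 3 by ring.
by rewrite lerD.
Qed.

Lemma zcos_taylor k z C : k%:R * `|complex.Im z| <= C ->
  cabs (zcos k z - 2 + k%:R ^+ 2 * z ^+ 2) <=
  16 * expR C * cabs z ^+ 2 * (k.+1%:R ^+ 2 * Num.min 1 (k.+1%:R * cabs z)).
Proof.
move=> zC; pose w := 'i * k%:R * z.
have Rw : `|complex.Re w| <= C.
  rewrite /w -(rmorph_nat (real_complex R)) !(ReM, ImM)/=.
  rewrite (_ : _ - _ = - (k%:R * complex.Im z)); last by ring.
  by rewrite normrN normrM [`|k%:R|]ger0_norm.
have cw : cabs w = k%:R * cabs z by rewrite !cabsM cabs_i mul1r cabs_nat.
have w2 : w ^+ 2 = - (k%:R ^+ 2 * z ^+ 2).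
  have i2 : 'i ^+ 2 = - 1 :> R[i] by rewrite sqr_i.
  by rewrite /w !exprMn i2; ring.
have := cexp_even_taylor Rw; rewrite w2 opprK -/(zcos k z) cw => h.
apply: le_trans h _; rewrite exprMn.
have kk : k%:R <= k.+1%:R :> R by rewrite ler_nat.
have z0 := cabs_ge0 z.
have -> : 16 * expR C * (k%:R ^+ 2 * cabs z ^+ 2) * Num.min 1 (k%:R * cabs z) =
  16 * expR C * cabs z ^+ 2 * (k%:R ^+ 2 * Num.min 1 (k%:R * cabs z)) by ring.
rewrite ler_wpM2l ?mulr_ge0 ?expR_ge0 ?sqr_ge0// ler_pM ?sqr_ge0//.
- by rewrite le_min ler01 mulr_ge0.
- by rewrite lerXn2r ?nnegrE.
- by rewrite le_min !ge_min lexx/= ler_wpM2r ?orbT.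
Qed.

(** For [k < n] the strip gives [k |Im z| <= C], so the exponentials stay bounded. The term [n^-2]
    pays for replacing the truncated sum of the [A k] by its limit. *)
Lemma cosine_sum_expansion A C S0 S2 e : bounded_sums (weight A) ->
  clim (fun n => \sum_(k < n) A k) S0 ->
  clim (fun n => \sum_(k < n) A k * k%:R ^+ 2) S2 -> 0 < e ->
  exists n0, exists2 h0, 0 < h0 & forall n z, (n0 <= n)%N -> cabs z <= h0 ->
    `|complex.Im z| <= C / n%:R ->
    cabs (\sum_(k < n) A k * zcos k z - 2 * S0 + S2 * z ^+ 2) <=
    e * (cabs z ^+ 2 + (n%:R ^+ 2)^-1).
Proof.
move=> bA h0 h2 e0.
have eC := expR_gt0 C.
have e16 : 0 < e / 2 / (16 * expR C) by rewrite !divr_gt0// mulr_gt0.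
have [h1 h10 hh] := bounded_sums_min (weight_ge0 A) bA e16.
have e2 : 0 < e / 2 by rewrite divr_gt0.
have [m hm] := bounded_sums_tail (weight_ge0 A) bA e2.
exists m.+1, h1 => // n z mn zh zC.
have n0 : 0 < n%:R :> R by rewrite ltr0n (leq_trans _ mn).
have hmn n' : \sum_(k < n' | (n <= k)%N) weight A k <= e / 2.
  apply: le_trans (hm n'); rewrite [leLHS]big_mkcond [leRHS]big_mkcond/=.
  apply: ler_sum => k _; case: leqP => nk; last by case: ifP => // _; exact: weight_ge0.
  by rewrite (leq_trans _ nk)// (leq_trans (leqnSn m) mn).
have z0 := cabs_ge0 z.
have t2 : cabs (\sum_(k < n) A k * k%:R ^+ 2 - S2) <= e / 2.
  apply: (clim_uniform (u := fun k => A k * k%:R ^+ 2) (w := weight A) _ h2 hmn) => // k _.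
  rewrite cabsM cabsX cabs_nat ler_wpM2l ?cabs_ge0// lerXn2r ?nnegrE// ler_nat//.
(* Beyond [n] the coefficients are at most [weight A k / n^2]. *)
have t0 : cabs (\sum_(k < n) A k - S0) <= e / 2 / n%:R ^+ 2.
  apply: (clim_uniform (u := A) (w := fun k => weight A k / n%:R ^+ 2) _ h0 _ (leqnn n)).
    move=> k nk; rewrite ler_pdivlMr ?exprn_gt0// ler_wpM2l ?cabs_ge0//.
    by rewrite lerXn2r ?nnegrE// ler_nat (leq_trans nk).
  by move=> n'; rewrite -mulr_suml ler_wpM2r// invr_ge0 sqr_ge0.
have tz : cabs (\sum_(k < n) A k * (zcos k z - 2 + k%:R ^+ 2 * z ^+ 2)) <= e / 2 * cabs z ^+ 2.
  apply: le_trans (cabs_sum _ _ _) _.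
  apply: le_trans (_ : 16 * expR C * cabs z ^+ 2 *
     \sum_(k < n) weight A k * Num.min 1 (k.+1%:R * cabs z) <= _).
    rewrite mulr_sumr; apply: ler_sum => k _; rewrite cabsM.
    have -> : 16 * expR C * cabs z ^+ 2 * (weight A k * Num.min 1 (k.+1%:R * cabs z)) =
      cabs (A k) * (16 * expR C * cabs z ^+ 2 * (k.+1%:R ^+ 2 * Num.min 1 (k.+1%:R * cabs z))).
      by rewrite /weight; ring.
    rewrite ler_wpM2l ?cabs_ge0// zcos_taylor//.
    move: zC; rewrite ler_pdivlMr// mulrC; apply: le_trans.
    by rewrite ler_wpM2r// ler_nat ltnW.
  have := hh n (cabs z); rewrite z0 zh => /(_ isT); rewrite ler_pdivlMr ?mulr_gt0// => h.
  have : (\sum_(k < n) weight A k * Num.min 1 (k.+1%:R * cabs z)) * (16 * expR C) * cabs z ^+ 2 <=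
     e / 2 * cabs z ^+ 2 by rewrite ler_wpM2r ?sqr_ge0.
  by apply: le_trans; rewrite le_eqVlt; apply/orP; left; apply/eqP; ring.
have -> : \sum_(k < n) A k * zcos k z - 2 * S0 + S2 * z ^+ 2 =
   \sum_(k < n) A k * (zcos k z - 2 + k%:R ^+ 2 * z ^+ 2) +
   2 * (\sum_(k < n) A k - S0) - (\sum_(k < n) A k * k%:R ^+ 2 - S2) * z ^+ 2.
  have -> : \sum_(k < n) A k * (zcos k z - 2 + k%:R ^+ 2 * z ^+ 2) =
     \sum_(k < n) A k * zcos k z - 2 * \sum_(k < n) A k + (\sum_(k < n) A k * k%:R ^+ 2) * z ^+ 2.
    rewrite mulr_sumr mulr_suml -sumrB -big_split/=; apply: eq_bigr => k _; ring.
  by ring.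
apply: le_trans (cabsB _ _) _; rewrite cabsM cabsX.
apply: le_trans (lerD (cabsD _ _) (lexx _)) _; rewrite cabsM (cabs_nat R 2).
have := ler_wpM2r (sqr_ge0 (cabs z)) t2.
have -> : e * (cabs z ^+ 2 + (n%:R ^+ 2)^-1) = e * cabs z ^+ 2 + 2 * (e / 2 / n%:R ^+ 2).
  by field; rewrite gt_eqF.
by move: tz t0; lra.
Qed.

End SecondOrderExpansion.

(** * Both end points by one reflection *)

Section EndpointReflection.
Variables (R : realType) (a : R[i] -> R[i]).
Implicit Types (x y s e : R) (z : R[i]) (k n : nat) (b : bool).

(* [b] selects the end point [pi] of [0, pi], which the reflection [x -> pi - x]
   moves to [0] at the cost of the signs [(-1)^k] on the coefficients. *)
Definition refl b x : R := if b then pi - x else x.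
Definition sgn b k : R := if b then (- 1) ^+ k else 1.
Definition rcoef b k : R[i] := (sgn b k)%:C * coef a k.

Lemma cos_nat_pi k : cos (k%:R * pi) = (- 1) ^+ k :> R.
Proof.
elim: k => [|k IH]; first by rewrite mul0r cos0.
by rewrite -natr1 mulrDl mul1r cosDpi IH exprS mulN1r.
Qed.

Lemma cos_refl b k x : cos (k%:R * refl b x) = sgn b k * cos (k%:R * x).
Proof.
case: b; rewrite /refl /sgn ?mul1r//.
by rewrite mulrBr cosB cos_nat_pi sin_nat_pi mul0r addr0.
Qed.

Lemma zcos_refl b k z :
  zcos k (if b then pi%:C - z else z) = (sgn b k)%:C * zcos k z.
Proof.
case: b; rewrite /sgn ?mul1r//.
have e1 : cexp ('i * (k%:R * pi)%:C) = ((- 1) ^+ k)%:C :> R[i].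
  by rewrite cexp_i cos_nat_pi sin_nat_pi.
have e2 : cexp (- ('i * (k%:R * pi)%:C)) = ((- 1) ^+ k)%:C :> R[i].
  by rewrite mulNi cexp_i cosN sinN cos_nat_pi sin_nat_pi oppr0.
rewrite /zcos.
have -> : 'i * k%:R * (pi%:C - z) = 'i * (k%:R * pi)%:C + - ('i * k%:R * z).
  by rewrite rmorphM/= rmorph_nat; move: (pi%:C) => p; ring.
by rewrite opprD opprK !cexpD e1 e2 -mulrDr [cexp _ + _]addrC.
Qed.

Lemma refl_in b x : 0 <= x <= pi -> 0 <= refl b x <= pi.
Proof. by case: b => // /andP[? ?]; apply/andP; split; rewrite /refl; lra. Qed.

Lemma cabs_rcoef b k : cabs (rcoef b k) = cabs (coef a k).
Proof.
rewrite cabsM cabs_real -[RHS]mul1r; congr (_ * _).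
by case: b; rewrite /sgn ?normr1// normrX normrN1 expr1n.
Qed.

Lemma bounded_weight_rcoef b : bounded_sums (weight (coef a)) ->
  bounded_sums (weight (rcoef b)).
Proof.
move=> [W hW]; exists W => n; apply: le_trans (hW n).
by apply: ler_sum => k _; rewrite /weight cabs_rcoef.
Qed.

Lemma gn_refl b n x : even_symbol a ->
  gn a n.+1 (refl b x)%:C = (\sum_(k < n.+1) rcoef b k * (2 * cos (k%:R * x))%:C) - coef a 0%N.
Proof.
move=> ea; rewrite gnE//; congr (_ - _); apply: eq_bigr => k _.
by rewrite zcos_real cos_refl /rcoef !rmorphM/=; ring.
Qed.

Lemma gn_refl_sub b n x s : even_symbol a ->
  gn a n.+1 (refl b x)%:C - gn a n.+1 (refl b s)%:C =
  (2 * (cos x - cos s))%:C * cosdd_sum (rcoef b) n.+1 x s.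
Proof.
move=> ea; rewrite !gn_refl// opprB addrA subrK -sumrB /cosdd_sum mulr_sumr.
apply: eq_bigr => k _; rewrite mulrCA -mulrBr -rmorphB -mulrBr -cosddE.
by rewrite -rmorphM; congr (_ * _%:C); ring.
Qed.

Lemma dirichlet0 k : dirichlet k 0 = k%:R :> R.
Proof.
rewrite /dirichlet (eq_bigr (fun=> 1)) ?sumr_const ?card_ord// => m _.
by rewrite mulr0 cos0.
Qed.

(** At [x != 0] a zero limit would make [gfun a] take the same value at [refl b x] and [refl b 0],
    against injectivity. At [x = 0] the limit is minus half the second derivative at [refl b 0]. *)
Lemma symbol_nondegenerate b alpha x : CSL alpha a -> even_symbol a ->
  bounded_sums (weight (coef a)) -> 0 <= x <= pi ->
  ~ clim (fun n => cosdd_sum (rcoef b) n x 0) 0.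
Proof.
move=> csl ea bA xp L; have pi0 := @pi_gt0 R.
have r0 : 0 <= refl b 0 <= pi by apply: refl_in; rewrite lexx ltW.
have [x0|x0] := eqVneq x 0; last first.
  have rx := refl_in b xp.
  have := climD (gn_cvg ea bA rx) (climN (gn_cvg ea bA r0)).
  have := climZ (2 * (cos x - cos 0))%:C L; rewrite mulr0 => L0 L1.
  have /eqP : gfun a (refl b x) - gfun a (refl b 0) = 0.
    apply: clim_unique L1 _; apply: (clim_ext (n0 := 1%N)) L0 => -[|n] // _.
    by rewrite gn_refl_sub.
  rewrite subr_eq0 => /eqP gg.
  have E : refl b x = refl b 0 by move: (CSL_inj csl) => inj; apply: inj => //; rewrite in_itv.
  by move/eqP: x0; apply; move: E; rewrite /refl; case: (b) => // E; lra.
have g2 : cderive1 (cderive1 (gfun a)) (refl b 0) != 0.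
  case: (b); rewrite /refl ?subr0; first exact: CSL_deriv2_pi csl.
  by case: (CSL_deriv2_0 csl).
move/eqP: g2; apply; apply: (clim_unique (u := fun n => \sum_(k < n) coef a k * (2 * (- k%:R ^+ 2 * cos (k%:R * refl b 0)))%:C)).
  exact: (@gfun_deriv2 R a (refl b 0) ea bA ltac:(case/andP: r0 => ? ?; apply/andP; split; lra)).
have := climZ (- 2) L; rewrite mulr0.
apply: (clim_ext (n0 := 0%N)) => n _; rewrite /cosdd_sum mulr_sumr.
apply: eq_bigr => k _; rewrite x0 /cosdd addr0 subr0 mul0r dirichlet0.
rewrite cos_refl mulr0 cos0 /rcoef !rmorphM rmorphN rmorphM rmorph_nat rmorph_nat rmorph1.
by ring.
Qed.

End EndpointReflection.

(** * From the Wiener-Hopf factor to the phase *)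

Section PhaseOfFactor.
Variables (R : realType) (a : R[i] -> R[i]).
Implicit Types (x y s e : R) (z : R[i]) (k n : nat) (b : bool).

Lemma expiN x : expi (- x) = (expi x)^-1.
Proof. by rewrite -!cexp_expi -mulNi cexpN. Qed.

Lemma outer_shift (F : R -> R[i]) : outer F -> outer (fun x => F (x + pi)).
Proof.
move=> [c [rs [hrs hF]]]; exists c, [seq - z | z <- rs]; split.
  by apply/allP => w /mapP[z /(allP hrs) z1 ->]; rewrite cabsN.
move=> x; rewrite hF big_map; congr (_ * _); apply: eq_bigr => z _.
have -> : expi (x + pi) = - expi x by rewrite !expiE cosDpi sinDpi.
by rewrite mulNr mulrN.
Qed.

Lemma eq_at_limit (f g : R -> R[i]) s r :
  continuous (fun x => complex.Re (f x)) -> continuous (fun x => complex.Im (f x)) ->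
  (forall e, 0 < e -> exists2 h, 0 < h & forall x, `|x - s| <= h -> cabs (g x - g s) <= e) ->
  0 < r -> (forall x, `|x - s| < r -> x != s -> f x = g x) -> f s = g s.
Proof.
move=> cr ci cg r0 fg; apply/eqP; rewrite -subr_eq0 -cabs_eq0 eq_le cabs_ge0 andbT.
apply/ler_addgt0Pr => e e0; rewrite add0r.
have e3 : 0 < e / 3 by rewrite divr_gt0.
have /cvgrPdist_le/(_ _ e3)/nbhs_ballP[d1 /= d10 h1] := cr s.
have /cvgrPdist_le/(_ _ e3)/nbhs_ballP[d2 /= d20 h2] := ci s.
have [d3 d30 h3] := cg _ e3.
set d := Num.min (Num.min d1 d2) (Num.min d3 r).
have d0 : 0 < d by rewrite !lt_min d10 d20 d30.
have xs : s + d / 2 - s = d / 2 by ring.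
have nx : `|s + d / 2 - s| = d / 2 by rewrite xs ger0_norm// divr_ge0// ltW.
have dd : d / 2 < d by lra.
have [l1 [l2 [l3 l4]]] : d / 2 < d1 /\ d / 2 < d2 /\ d / 2 <= d3 /\ d / 2 < r.
  have : d <= d by []; rewrite {2}/d !le_min => /andP[/andP[? ?] /andP[? ?]].
  by repeat split; lra.
have fx := fg (s + d / 2); rewrite nx in fx.
have {}fx := fx l4 ltac:(by rewrite -subr_eq0 xs gt_eqF// divr_gt0).
have k1 : `|complex.Re (f s) - complex.Re (f (s + d / 2))| <= e / 3.
  by apply: h1; rewrite /ball/= distrC nx.
have k2 : `|complex.Im (f s) - complex.Im (f (s + d / 2))| <= e / 3.
  by apply: h2; rewrite /ball/= distrC nx.
have k3 := h3 (s + d / 2); rewrite nx in k3; have {}k3 := k3 l3.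
have -> : f s - g s = (f s - f (s + d / 2)) + (g (s + d / 2) - g s) by rewrite fx; ring.
apply: le_trans (cabsD _ _) _; have := cabs_le (f s - f (s + d / 2)).
rewrite ReD ImD ReN ImN; lra.
Qed.

Lemma is_cderive_horner_expi (p : {poly R[i]}) x :
  is_cderive (fun y => p.[expi y]) x (\sum_(k < size p) p`_k * ('i * k%:R * expi x ^+ k)).
Proof.
have := @is_cderive_sum R (size p) (fun k y => p`_k * expi y ^+ k) x
  (fun k => p`_k * ('i * k%:R * expi x ^+ k)) (fun k _ => is_cderive_scale _ (is_cderive_expiX k x)).
by apply: is_cderive_ext => y; rewrite horner_coef.
Qed.

Lemma horner_expi_continuous (p : {poly R[i]}) (h : R -> R) (c : R) :
  (forall x, is_derive x 1 h c) ->
  continuous (fun x => complex.Re (p.[expi (h x)] * p.[expi (- h x)])) /\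
  continuous (fun x => complex.Im (p.[expi (h x)] * p.[expi (- h x)])).
Proof.
move=> hh; have nh x : is_derive x 1 (fun y => - h y) (- c) by exact: is_deriveN.
have hd x := is_cderiveM (is_cderive_comp (is_cderive_horner_expi p (h x)) (hh x))
  (is_cderive_comp (h := fun y => - h y) (is_cderive_horner_expi p (- h x)) (nh x)).
by have := is_cderive_cont hd.
Qed.

(** With [X] and [S] the reflected points, the denominator of [bn] is [expi S * 2 (cos S - cos X)],
    and [expi S] cancels against the numerator. Reflection negates cosines, which accounts for the
    sign. *)
Lemma factor_at_expi b C n s (p : {poly R[i]}) x : even_symbol a ->
  wiener_hopf a C n.+1 (refl b s)%:C p ->
  0 < s < pi -> 0 <= x <= pi -> x != s ->
  p.[expi (refl b x)] * p.[expi (- refl b x)] =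
  (if b then 1 else - 1) * cosdd_sum (rcoef a b) n.+1 x s.
Proof.
move=> ea [_ _ wh] sp xp xs.
have sp' : 0 <= s <= pi by case/andP: sp => ? ?; rewrite !ltW.
set X := refl b x; set S := refl b s.
have Xp : 0 <= X <= pi := refl_in b xp.
have Sp : 0 <= S <= pi := refl_in b sp'.
have XS : X != S.
  apply: contra_neq xs; rewrite /X /S /refl; case: (b) => // h; lra.
have dcos : cos X - cos S != 0 by apply: cos_neq.
have e0 := cexp_neq0 ('i * X%:C); rewrite cexp_expi in e0.
have ne u v : 0 <= u <= pi -> 0 <= v <= pi -> cos u - cos v != 0 :> R -> expi u != expi v.
  by move=> _ _; apply: contra_neq; rewrite !expiE => -[-> _]; rewrite subrr.
have ne1 : expi X != expi S by apply: ne.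
have ne2 : expi X != expi (- S).
  apply: contra_neq dcos; rewrite !expiE cosN => -[-> _]; rewrite subrr//.
rewrite expiN -wh//; last by rewrite mulNi cexp_expi.
rewrite /bn cexp_expi.
have -> : trunc_symbol a n.+1 (expi X) = gn a n.+1 X%:C by rewrite /gn cexp_expi.
rewrite gn_refl_sub//.
have eS0 : expi S != 0 by have := cexp_neq0 ('i * S%:C); rewrite cexp_expi.
have den : (expi X - expi S) * ((expi X)^-1 - expi S) = expi S * (2 * (cos S - cos X))%:C.
  have c2 u : (2 * cos u)%:C = expi u + (expi u)^-1 :> R[i].
    by rewrite -cexp_i2cos mulNi !cexp_expi expiN.
  have -> : (2 * (cos S - cos X))%:C = (2 * cos S)%:C - (2 * cos X)%:C :> R[i].
    by rewrite -rmorphB -mulrBr.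
  by rewrite !c2; field; rewrite e0 eS0.
rewrite den; set P := cosdd_sum _ _ _ _.
have dC : (2 * (cos S - cos X))%:C != 0 :> R[i].
  by rewrite -(rmorph0 (real_complex R)) (inj_eq (@complexI R)) mulf_neq0 ?pnatr_eq0// -oppr_eq0 opprB.
have -> : (2 * (cos x - cos s))%:C = (if b then 1 else - 1) * (2 * (cos S - cos X))%:C :> R[i].
  rewrite /S /X; case: (b) => /=; rewrite /refl.
    by rewrite mul1r !cosB cospi sinpi; congr (_%:C); ring.
  by rewrite mulN1r -rmorphN/=; congr (_%:C); ring.
move: dC eS0; move: (2 * _)%:C (expi S) P => w t P w0 t0.
by field; rewrite w0 t0.
Qed.

Lemma eta_bound b alpha C e : CSL alpha a -> even_symbol a ->
  bounded_sums (weight (coef a)) -> 0 < C -> 0 < e ->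
  exists n0, exists2 s0, 0 < s0 & forall n j s,
    (n0 <= n)%N -> (0 < j <= n)%N -> s = pi * j%:R / n.+1%:R -> s <= s0 ->
    cabs (eta a C n (refl b s)%:C) <= e * j%:R.
Proof.
move=> csl ea bA C0 e0.
have bA' := bounded_weight_rcoef b bA.
have [n0 [s0 s00 H]] := phase_bound bA' (fun x xp => symbol_nondegenerate csl ea bA xp) e0.
exists n0, s0 => // n j s n0n jn sE ss0.
(* Without a factorization [eta] is 0 and the bound is trivial, so existence of the factor need not
   be proved. *)
rewrite /eta; case: xgetP => [v vE [p [L [wh [cL eL] ->]]]|_]; last first.
  by rewrite cabs0 mulr_ge0// ltW.
case: n n0n jn sE wh cL eL {vE v} => [|n] n0n jn sE wh cL eL.
  by case/andP: jn => j0; rewrite leqn0 => /eqP j0'; rewrite j0' in j0.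
have /andP[sg0 spi] : 0 < s < pi by rewrite sE; apply: grid_in; rewrite ltnS.
have sp : 0 < s < pi by rewrite sg0.
have disc1 t : cabs t <= 1 -> disc C n.+1 t.
  move=> t1; rewrite /disc/= cabsE lecR (le_trans t1)//.
  by rewrite -expR0 ler_expR divr_ge0// ltW.
have De x : disc C n.+1 (expi x) by apply: disc1; rewrite cabs_expi.
have [cR cI] := within_expi cL De.
have oF : outer (fun x => L (expi x)).
  apply: (outer_of_poly (p := p)); last by move=> x; rewrite eL.
  move=> t t1; have [_ h _] := wh; apply: h; apply: disc1.
  by move: t1; rewrite cabsE -(rmorph1 (real_complex R)) lecR.
(* As [expi (pi - x) = expi (- x + pi)], the shift by [pi] realizes the reflection with [x] and
   [- x] exchanged; this only changes the sign of the phase. *)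
pose F := fun x => L (expi (if b then x + pi else x)).
have oF' : outer F by rewrite /F; case: (b) => //; exact: (outer_shift oF).
have cF : continuous (fun x => complex.Im (F x)).
  rewrite /F; case: (b); last exact: cI.
  move=> x; apply: (@continuous_comp _ _ _ (fun x : R => x + pi) (fun x => complex.Im (L (expi x)))).
    by apply: cvgD; [exact: cvg_id|exact: cvg_cst].
  exact: cI.
have pm (x : R) : expi (pi - x + pi) = expi (- x).
  have -> : pi - x + pi = - x + pi *+ 2 by rewrite mulr2n; ring.
  by rewrite !expiE cosD2pi sinD2pi.
have Fs x : L (expi (refl b x)) - L (expi (- refl b x)) =
    (if b then - 1 else 1) * (F x - F (- x)).
  rewrite /F /refl; case: (b); last by rewrite mul1r.
  have -> : expi (pi - x) = expi (- x + pi) by congr expi; ring.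
  have -> : expi (- (pi - x)) = expi (x + pi).
    have -> : x + pi = - (pi - x) + pi *+ 2 by rewrite mulr2n; ring.
    by rewrite !expiE cosD2pi sinD2pi.
  by ring.
rewrite mulNi !cexp_expi cabsM cabsV cabs_i invr1 mul1r Fs cabsM.
have -> : cabs (if b then - 1 else 1 : R[i]) = 1 by case: (b); rewrite ?cabsN cabs1.
rewrite mul1r; apply: (H n.+1 j F (if b then 1 else - 1)) => //.
  by case: (b); rewrite ?oppr_eq0 oner_neq0.
have FF x : cexp (F x + F (- x)) = p.[expi (refl b x)] * p.[expi (- refl b x)].
  rewrite cexpD /F /refl !eL//; case: (b) => //.
  rewrite mulrC; congr (_ * _); first by congr (p.[expi _]); ring.
  have -> : x + pi = - (pi - x) + pi *+ 2 by rewrite mulr2n; ring.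
  by rewrite !expiE cosD2pi sinD2pi.
have off x : 0 <= x <= pi -> x != s -> cexp (F x + F (- x)) =
    (if b then 1 else - 1) * cosdd_sum (rcoef a b) n.+1 x s.
  by move=> xp xs; rewrite FF; apply: factor_at_expi wh sp xp xs.
(* At [x = s] the Wiener-Hopf identity is silent, its quotient being [0 / 0]; both sides are
   continuous there, so equality passes to the limit. *)
move=> x xp; have [->|xs] := eqVneq x s; last exact: off.
have [cfR cfI] : continuous (fun x => complex.Re (cexp (F x + F (- x)))) /\
    continuous (fun x => complex.Im (cexp (F x + F (- x)))).
  have dr (y : R) : is_derive y 1 (refl b : R -> R) (if b then - 1 else 1).
    rewrite /refl; case: (b); last exact: is_derive_id.
    have := is_deriveB (is_derive_cst (pi : R) y 1) (is_derive_id y 1).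
    by move=> /is_derive_eq; apply; rewrite sub0r.
  have [h1 h2] := horner_expi_continuous p dr.
  have e1 : (fun y => complex.Re (p.[expi (refl b y)] * p.[expi (- refl b y)])) =
      (fun y => complex.Re (cexp (F y + F (- y)))) by apply/funext => y; rewrite FF.
  have e2 : (fun y => complex.Im (p.[expi (refl b y)] * p.[expi (- refl b y)])) =
      (fun y => complex.Im (cexp (F y + F (- y)))) by apply/funext => y; rewrite FF.
  by rewrite -e1 -e2.
apply: (@eq_at_limit (fun x => cexp (F x + F (- x)))
  (fun x => (if b then 1 else - 1) * cosdd_sum (rcoef a b) n.+1 x s) s (Num.min s (pi - s)) cfR cfI).
- move=> e1 e10; have [h h0 hh] := cosdd_sum_equicont bA' e10.
  exists h => // y ys; rewrite -mulrBr cabsM.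
  have -> : cabs (if b then 1 else - 1 : R[i]) = 1 by case: (b); rewrite ?cabsN cabs1.
  by rewrite mul1r; apply: hh; rewrite subrr normr0 addr0.
- by rewrite lt_min sg0 subr_gt0.
- move=> y; rewrite lt_min !ltr_norml => /andP[/andP[? ?] /andP[? ?]] ys.
  by apply: off => //; apply/andP; split; lra.
Qed.

End PhaseOfFactor.

(** * Eigenvalue asymptotics at an end point *)

Section EndpointAsymptotics.
Variables (R : realType) (a : R[i] -> R[i]).

(** With [rho = J / n.+1], the reflected parameter [z] satisfies [z = pi rho + o(rho)], so both the
    replacement of [z^2] by [(pi rho)^2] and the remainder of the expansion are [o(rho^2)],
    uniformly in [j]. *)
Lemma endpoint_asymptotics (b : bool) (alpha c C e : R) (lam : nat -> nat -> R[i])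
    (jb := fun n j => if b then (n.+1 - j)%N else j) :
  2 <= alpha -> CSL alpha a -> 0 < C -> eigenvalue_numbering a c C lam -> 0 < e ->
  exists n0, exists2 rho0 : R, 0 < rho0 & forall n j, (n0 <= n)%N -> (0 < j <= n)%N ->
    (jb n j)%:R / n.+1%:R <= rho0 ->
    cabs (lam n j - (gfun a (refl b 0) + (pi ^+ 2)%:C *
            cderive1 (cderive1 (gfun a)) (refl b 0) / 2 *
            ((jb n j)%:R ^+ 2 / n.+1%:R ^+ 2))) <=
    e * ((jb n j)%:R / n.+1%:R) ^+ 2.
Proof.
move=> al csl C0 [cn cn0 [m0 _ num]] e0.
have ea : even_symbol a by split; [case: (CSL_wiener csl)|exact: CSL_even csl].
have bA := bounded_weight al (CSL_wiener csl).
have bA' := bounded_weight_rcoef b bA.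
have pi0 := @pi_gt0 R; have pi4 := @pi_le4 R.
have x0p : 0 <= refl b (0 : R) <= pi by apply: refl_in; rewrite lexx ltW.
pose D2 := cderive1 (cderive1 (gfun a)) (refl b 0).
pose S0 := (gfun a (refl b 0) + coef a 0%N) / 2; pose S2 := - (D2 / 2).
have L0 : clim (fun n => \sum_(k < n) rcoef a b k) S0.
  have := climZ 2^-1 (climD (gn_cvg ea bA x0p) (clim_cst (coef a 0%N))).
  rewrite mulrC; apply: (clim_ext (n0 := 1%N)) => -[|n] // _.
  rewrite gn_refl// subrK mulr_sumr; apply: eq_bigr => k _.
  by rewrite mulr0 cos0 mulr1 rmorph_nat mulrCA mulVf ?mulr1// pnatr_eq0.
have L2 : clim (fun n => \sum_(k < n) rcoef a b k * k%:R ^+ 2) S2.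
  have xI : - pi < refl b (0 : R) < 2 * pi by case/andP: x0p => ? ?; apply/andP; split; lra.
  have := climZ (- 2^-1) (gfun_deriv2 ea bA xI); rewrite mulNr mulrC.
  apply: (clim_ext (n0 := 0%N)) => n _; rewrite mulr_sumr; apply: eq_bigr => k _.
  rewrite cos_refl mulr0 cos0 /rcoef mulr1 rmorphM rmorphM rmorphN rmorphXn !rmorph_nat.
  by field.
(* From [cabs z <= 6 rho] and [1/n <= 2 rho] the remainder is at most [e1 * (36 + 4) rho^2] with
   [e1 = e / 80], that is half of the allowance. *)
have e10 : 0 < e / 80 by rewrite divr_gt0.
have [n1 [h0 h00 H1]] := cosine_sum_expansion C bA' L0 L2 e10.
(* The error in [z^2] is at most [2 e2 rho * 10 rho]; multiplied by [S2] it has to stay below the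
   other half. *)
pose e2 := Num.min 1 (e / (40 * (cabs S2 + 1))).
have S21 : 0 < cabs S2 + 1 by rewrite ltr_wpDl ?cabs_ge0.
have e20 : 0 < e2 by rewrite lt_min ltr01 divr_gt0// mulr_gt0.
have e21 : e2 <= 1 by rewrite ge_min lexx.
have e2e : 20 * e2 * cabs S2 <= e / 2.
  have : e2 <= e / (40 * (cabs S2 + 1)) by rewrite ge_min lexx orbT.
  rewrite ler_pdivlMr ?mulr_gt0// => h.
  by clearbody e2; move: h e20; clear; lra.
clearbody e2; have [n2 [s0 s00 H2]] := eta_bound b csl ea bA C0 e20.
have [n3 H3] : exists n3, forall n, (n3 <= n)%N -> cn n <= e2.
  have /cvgrPdist_le/(_ e2 e20)[n3 _ h] := cn0; exists n3 => n /h.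
  by rewrite /= sub0r normrN => /(le_trans (ler_norm _)).
exists (maxn (maxn 1 m0) (maxn n1 (maxn n2 n3))), (Num.min (h0 / 6) (s0 / 4)).
  by rewrite lt_min !divr_gt0.
move=> n j; rewrite !geq_max => /andP[/andP[ngt m0n] /and3P[n1n n2n n3n]] jn.
rewrite le_min => /andP[rh rs].
have [_ _ /(_ j jn)[s [[_ sIm] lamE sd]]] := num n m0n.
have jbn : (0 < jb n j <= n)%N by rewrite /jb; clear -jn; case: (b) => //; lia.
set J := jb n j in rh rs jbn *.
have N0 : 0 < n.+1%:R :> R by [].
have nR : 0 < n%:R :> R by rewrite ltr0n.
set rho := J%:R / n.+1%:R in rh rs *.
have rho1 : n.+1%:R^-1 <= rho.
  by rewrite /rho -[leLHS]mul1r ler_wpM2r ?invr_ge0// ler1n; case/andP: jbn.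
have rho0 : 0 < rho by rewrite (lt_le_trans _ rho1)// invr_gt0.
have dE : dgrid R n j = refl b (pi * rho).
  rewrite /dgrid /rho /J /jb /refl; case: (b); last by rewrite mulrA.
  have jn' : (j <= n.+1)%N by case/andP: jn => _ /leqW.
  rewrite natrB//; move: (pi : R) => p; by field; rewrite gt_eqF.
have prho : pi * rho <= 4 * rho by rewrite ler_wpM2r// ltW.
have etaE : cabs (eta a C n (dgrid R n j)%:C) <= e2 * J%:R.
  by rewrite dE; apply: H2 => //; [rewrite /rho mulrA|move: prho rs; clear; lra].
pose z := if b then pi%:C - s else s.
have sz : s = if b then pi%:C - z else z.
  by rewrite /z; case: (b) => //; rewrite subKr.
have sdist : cabs (s - (dgrid R n j)%:C) <= 2 * e2 * rho.
  have {}sd : cabs (s - egrid a C n j) <= cn n / n.+1%:R.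
    by move: sd; rewrite cabsE lecR.
  have -> : s - (dgrid R n j)%:C = (s - egrid a C n j) - eta a C n (dgrid R n j)%:C / n.+1%:R.
    by rewrite /egrid; ring.
  apply: le_trans (cabsB _ _) _; rewrite cabsM cabsV cabs_nat.
  (* Since [1 <= J], an error [o(1 / n.+1)] is also [o(rho)]. *)
  have h1 : cn n / n.+1%:R <= e2 * rho.
    apply: le_trans (_ : e2 * n.+1%:R^-1 <= _).
      by rewrite ler_wpM2r ?invr_ge0// H3.
    by rewrite ler_wpM2l// ltW.
  have h2 : cabs (eta a C n (dgrid R n j)%:C) / n.+1%:R <= e2 * rho.
    by rewrite /rho mulrA ler_wpM2r ?invr_ge0.
  have -> : 2 * e2 * rho = e2 * rho + e2 * rho by ring.
  exact: lerD (le_trans sd h1) h2.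
have zdist : cabs (z - (pi * rho)%:C) <= 2 * e2 * rho.
  move: sdist; rewrite dE sz /refl; case: (b) => //.
  rewrite rmorphB/= -cabsN; congr (cabs _ <= _).
  by move: (pi%:C) (pi * rho)%:C => p q; ring.
have zIm : `|complex.Im z| <= C / n%:R.
  have : `|complex.Im s| <= C / n%:R by rewrite ler_norml.
  by rewrite /z; case: (b) => //; rewrite ImD ImN/= sub0r normrN.
have z6 : cabs z <= 6 * rho.
  have := cabsD (z - (pi * rho)%:C) (pi * rho)%:C; rewrite subrK cabs_real.
  rewrite ger0_norm ?mulr_ge0 ?(ltW rho0) ?(ltW pi0)// => h; apply: le_trans h _.
  have h2 : e2 * rho <= rho by rewrite ler_piMl// ltW.
  by move: zdist h2 prho; clear; lra.
have zh : cabs z <= h0 by move: z6 rh; clear; lra.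
have main := H1 n z n1n zh zIm.
have lE : lam n j = \sum_(k < n) rcoef a b k * zcos k z - coef a 0%N.
  have gE m w : (0 < m)%N -> gn a m w = (\sum_(k < m) coef a k * zcos k w) - coef a 0%N.
    by case: m => // m _; exact: gnE.
  rewrite lamE gE//; congr (_ - _); apply: eq_bigr => k _.
  by rewrite [in LHS]sz zcos_refl /rcoef mulrCA mulrA.
have -> : lam n j - (gfun a (refl b 0) + (pi ^+ 2)%:C *
            cderive1 (cderive1 (gfun a)) (refl b 0) / 2 * (J%:R ^+ 2 / n.+1%:R ^+ 2)) =
   (\sum_(k < n) rcoef a b k * zcos k z - 2 * S0 + S2 * z ^+ 2) -
   S2 * ((z - (pi * rho)%:C) * (z + (pi * rho)%:C)).
  have -> : (pi * rho)%:C = pi%:C * (J%:R / n.+1%:R) :> R[i].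
    by rewrite /rho rmorphM/= fmorph_div !rmorph_nat.
  have -> : (pi ^+ 2)%:C = pi%:C ^+ 2 :> R[i] by rewrite rmorphXn.
  rewrite lE -/D2 /S0 /S2.
  have : n.+1%:R != 0 :> R[i] by rewrite pnatr_eq0.
  clear -D2; move: D2 (\sum_(k < n) _) (pi%:C) (n.+1%:R) => D S p N N1.
  by field.
apply: le_trans (cabsB _ _) _; rewrite !cabsM.
have inv1 : (n%:R ^+ 2)^-1 <= 4 * rho ^+ 2.
  have h : n%:R^-1 <= 2 * rho.
    apply: le_trans (_ : 2 * n.+1%:R^-1 <= _); last by rewrite ler_wpM2l.
    rewrite -[leLHS]mul1r ler_pdivrMr// mulrAC ler_pdivlMr// mul1r -natrM ler_nat.
    by clear -ngt; lia.
  rewrite -exprVn (_ : 4 * rho ^+ 2 = (2 * rho) ^+ 2); last by ring.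
  by rewrite lerXn2r ?nnegrE ?invr_ge0// mulr_ge0// ltW.
have z62 : cabs z ^+ 2 <= 36 * rho ^+ 2.
  rewrite (_ : 36 * rho ^+ 2 = (6 * rho) ^+ 2); last by ring.
  by rewrite lerXn2r ?nnegrE ?cabs_ge0// mulr_ge0// ltW.
have m1 : e / 80 * (cabs z ^+ 2 + (n%:R ^+ 2)^-1) <= e / 2 * rho ^+ 2.
  have -> : e / 2 * rho ^+ 2 = e / 80 * (36 * rho ^+ 2 + 4 * rho ^+ 2) by field.
  by rewrite ler_wpM2l ?(ltW e10)// lerD.
have zp : cabs (z + (pi * rho)%:C) <= 10 * rho.
  apply: le_trans (cabsD _ _) _; rewrite cabs_real ger0_norm ?mulr_ge0 ?(ltW rho0) ?(ltW pi0)//.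
  by move: z6 prho; clear; lra.
have m2 : cabs S2 * (cabs (z - (pi * rho)%:C) * cabs (z + (pi * rho)%:C)) <= e / 2 * rho ^+ 2.
  apply: le_trans (_ : cabs S2 * ((2 * e2 * rho) * (10 * rho)) <= _).
    by rewrite ler_wpM2l ?cabs_ge0// ler_pM ?cabs_ge0.
  have -> : cabs S2 * (2 * e2 * rho * (10 * rho)) = 20 * e2 * cabs S2 * rho ^+ 2 by ring.
  by rewrite ler_wpM2r// sqr_ge0.
by move: main m1 m2; clear; lra.
Qed.

End EndpointAsymptotics.

(** Each [e] has its own thresholds [n0] and [rho0]; the ratio [J n / n.+1] eventually falls below
    [rho0], and [n <= n.+1] changes the denominator to the one wanted. *)
Lemma asymptotics_littleo (R : realType) (lamj : nat -> R[i]) (J : nat -> nat)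
    (g0 g2 : R[i]) :
  (forall n, (1 <= n)%N -> (1 <= J n)%N) ->
  (forall e : R, 0 < e -> exists n0, exists2 rho0 : R, 0 < rho0 & forall n, (n0 <= n)%N ->
     (J n)%:R / n.+1%:R <= rho0 ->
     cabs (lamj n - (g0 + g2 * ((J n)%:R ^+ 2 / n.+1%:R ^+ 2))) <=
     e * ((J n)%:R / n.+1%:R) ^+ 2) ->
  (fun n => (J n)%:R / n.+1%:R : R) @ \oo --> (0 : R) ->
  (fun n => lamj n - (g0 + g2 * ((J n)%:R ^+ 2 / n.+1%:R ^+ 2))) =o_\oo
  (fun n => (J n)%:R ^+ 2 / n%:R ^+ 2 : R[i]).
Proof.
move=> J1 H J0; apply/eqoP => eps eps0.
have eE : eps = (complex.Re eps)%:C.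
  by apply: complex_ext => //=; rewrite (ger0_Im (ltW eps0)).
rewrite eE ltcR in eps0; have [n0 [rho0 rho00 {}H]] := H _ eps0.
have /cvgrPdist_le/(_ _ rho00)[n1 _ h1] := J0.
exists (maxn 1 (maxn n0 n1)) => // n; rewrite /= !geq_max => /and3P[n1n n0n /h1].
rewrite /= sub0r normrN => /(le_trans (ler_norm _)) /(H n n0n) {}H.
rewrite eE !cabsE -rmorphM/= lecR; apply: le_trans H _.
rewrite cabsM cabsV !cabsX !cabs_nat ler_wpM2l ?(ltW eps0)// expr_div_n.
rewrite ler_wpM2l ?sqr_ge0// lef_pV2 ?posrE ?exprn_gt0 ?ltr0n//.
by rewrite lerXn2r ?nnegrE// ler_nat.
Qed.

Theorem lemma3p2 (R : realType) (alpha : R) (a : R[i] -> R[i])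
    (c C : R) (lam : nat -> nat -> R[i]) (j : nat -> nat) :
  2 <= alpha -> CSL alpha a -> 0 < c -> 0 < C ->
  eigenvalue_numbering a c C lam ->
  (forall n, (1 <= n)%N -> (1 <= j n <= n)%N) ->
  ((fun n => (j n)%:R / n.+1%:R : R) @ \oo --> (0 : R) ->
     exists2 Delta4 : nat -> R[i],
       forall n, lam n (j n) =
         gfun a 0 + (pi ^+ 2)%:C * cderive1 (cderive1 (gfun a)) 0 / 2
                    * ((j n)%:R ^+ 2 / n.+1%:R ^+ 2) + Delta4 n
     & Delta4 =o_\oo (fun n => (j n)%:R ^+ 2 / n%:R ^+ 2 : R[i])) /\
  ((fun n => (n.+1%:R - (j n)%:R) / n.+1%:R : R) @ \oo --> (0 : R) ->
     exists2 Delta5 : nat -> R[i],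
       forall n, lam n (j n) =
         gfun a pi + (pi ^+ 2)%:C * cderive1 (cderive1 (gfun a)) pi / 2
                     * ((n.+1%:R - (j n)%:R) ^+ 2 / n.+1%:R ^+ 2) + Delta5 n
     & Delta5 =o_\oo (fun n => (n.+1%:R - (j n)%:R) ^+ 2 / n%:R ^+ 2 : R[i])).
Proof.
move=> al csl c0 C0 num jn.
have end_o b (J := fun n => if b then (n.+1 - j n)%N else j n) :
    (fun n => (J n)%:R / n.+1%:R : R) @ \oo --> (0 : R) ->
    (fun n => lam n (j n) - (gfun a (refl b 0) + (pi ^+ 2)%:C *
       cderive1 (cderive1 (gfun a)) (refl b 0) / 2 * ((J n)%:R ^+ 2 / n.+1%:R ^+ 2)))
    =o_\oo (fun n => (J n)%:R ^+ 2 / n%:R ^+ 2 : R[i]).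
  apply: asymptotics_littleo => [n n1|e e0].
    by rewrite /J; case: (b); have := jn n n1; lia.
  have [n0 [rho0 rho00 H]] := endpoint_asymptotics b al csl C0 num e0.
  exists (maxn 1 n0), rho0 => // n; rewrite geq_max => /andP[n1 n0n].
  by apply: H => //; exact: jn.
split=> jo; [have := end_o false jo|].
  move=> H; eexists; last exact: H.
  by move=> n /=; rewrite addrC subrK.
have jE n : (1 <= n)%N -> (n.+1 - j n)%N%:R = n.+1%:R - (j n)%:R :> R.
  by move=> /jn jn'; rewrite natrB//; lia.
have jEC n : (1 <= n)%N -> (n.+1 - j n)%N%:R = n.+1%:R - (j n)%:R :> R[i].
  by move=> /jn jn'; rewrite natrB//; lia.
have J0 : (fun n => (n.+1 - j n)%N%:R / n.+1%:R : R) @ \oo --> (0 : R).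
  apply: cvg_trans jo; apply: near_eq_cvg; exists 1%N => // n n1.
  by rewrite jE.
have H := end_o true J0; rewrite /refl subr0 in H.
(* The remainder is written with subtraction in [R[i]], as the equation must hold for every [n]. At
   [n = 0] the index [j 0] is unconstrained and [n.+1 - j n] may truncate, so the two forms are
   identified only from [n = 1] on. *)
exists (fun n => lam n (j n) - (gfun a pi + (pi ^+ 2)%:C *
   cderive1 (cderive1 (gfun a)) pi / 2 * ((n.+1%:R - (j n)%:R) ^+ 2 / n.+1%:R ^+ 2))).
  by move=> n; rewrite addrC subrK.
apply/eqoP => eps eps0; have /eqoP/(_ eps eps0)[n0 _ h] := H.
exists (maxn 1 n0) => // n; rewrite /= geq_max => /andP[n1 /h].
by rewrite /= jEC.
Qed.
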